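(* Consider the spectral triple $(\mathcal A(S^4_q),\mathcal H,D,\gamma)$, with $\mathcal H=\mathcal H_+\oplus\mathcal H_-$ the direct sum of the two chiral representations described in the context and $D|l,m_1,m_2;j\rangle_\pm=(l+\frac32)|l,m_1,m_2;j\rangle_\mp$. In the region $\mathrm{Re}\,s>2$ its dimension spectrum $\Sigma$ consists of the two points $\{3,4\}$, which are simple poles of the zeta-functions. The top residue coincides with the integral on the subspace of classical points of $S^4_q$, that is $${\int\!\!\!\!\!-}\; a|D|^{-4}:=\mathrm{Res}_{s=4}\mathrm{Tr}(a|D|^{-s})=\frac{2}{3\pi}\int_0^{2\pi}\sigma(a)(\theta)\,d\theta$$ for all $a\in\mathcal A(S^4_q)$, where $\sigma:\mathcal A(S^4_q)\to\mathcal A(S^1)$ is the $*$-algebra morphism defined by $\sigma(x_0)=\sigma(x_1)=0$ and $\sigma(x_2)=u$, with $u(\theta)=e^{i\theta}$ the unitary generator of $\mathcal A(S^1)$.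
   Context: Fix $0<q<1$; $[x]=(q^x-q^{-x})/(q-q^{-1})$. $\mathcal A(S^4_q)$ is the unital $*$-algebra generated by $x_0=x_0^*,x_1,x_1^*,x_2,x_2^*$ with relations $x_ix_j=q^2x_jx_i$ ($0\le i<j\le2$), $x_i^*x_j=q^2x_jx_i^*$ ($i\ne j$), $[x_1^*,x_1]=(1-q^4)x_0^2$, $[x_2^*,x_2]=x_1^*x_1-q^4x_1x_1^*$, $x_0^2+x_1x_1^*+x_2x_2^*=1$. Chiral representations: $\mathcal H_\pm$ are Hilbert spaces with orthonormal bases $|l,m_1,m_2;j\rangle_\pm$, where $l\in\mathbb N+\frac12$, $j=\frac12,\frac32,\dots,l$, $j-|m_1|\in\mathbb N$, $l+\frac12-j-|m_2|\in\mathbb N$. In any coefficient with indices $(l,j,m_2)$, $\epsilon=\pm\frac12$ is determined by $l+\epsilon-j-m_2\in2\mathbb N$. Terms with vectors outside the index set are omitted. The $*$-representation of $\mathcal A(S^4_q)$ on $\mathcal H_\pm$ is $$\begin{aligned} x_0|l,m_1,m_2;j\rangle_\pm&=A^+_{j,m_1}\big(C^+_{l,j,m_2}|l+1,m_1,m_2;j+1\rangle_\pm\mp C^0_{l,j,m_2}|l,m_1,m_2;j+1\rangle_\pm+C^-_{l,j,m_2}|l-1,m_1,m_2;j+1\rangle_\pm\big)\\ &+A^0_{j,m_1}\big(H^+_{l,j,m_2}|l+1,m_1,m_2;j\rangle_\pm\pm H^0_{l,j,m_2}|l,m_1,m_2;j\rangle_\pm+H^+_{l-1,j,m_2}|l-1,m_1,m_2;j\rangle_\pm\big)\\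 &+A^+_{j-1,m_1}\big(C^-_{l+1,j-1,m_2}|l+1,m_1,m_2;j-1\rangle_\pm\mp C^0_{l,j-1,m_2}|l,m_1,m_2;j-1\rangle_\pm+C^+_{l-1,j-1,m_2}|l-1,m_1,m_2;j-1\rangle_\pm\big),\\ x_1|l,m_1,m_2;j\rangle_\pm&=B^+_{j,m_1}\big(C^+_{l,j,m_2}|l+1,m_1+1,m_2;j+1\rangle_\pm\mp C^0_{l,j,m_2}|l,m_1+1,m_2;j+1\rangle_\pm+C^-_{l,j,m_2}|l-1,m_1+1,m_2;j+1\rangle_\pm\big)\\ &+B^0_{j,m_1}\big(H^+_{l,j,m_2}|l+1,m_1+1,m_2;j\rangle_\pm\pm H^0_{l,j,m_2}|l,m_1+1,m_2;j\rangle_\pm+H^+_{l-1,j,m_2}|l-1,m_1+1,m_2;j\rangle_\pm\big)\\ &+B^-_{j,m_1}\big(C^-_{l+1,j-1,m_2}|l+1,m_1+1,m_2;j-1\rangle_\pm\mp C^0_{l,j-1,m_2}|l,m_1+1,m_2;j-1\rangle_\pm+C^+_{l-1,j-1,m_2}|l-1,m_1+1,m_2;j-1\rangle_\pm\big),\\ x_2|l,m_1,m_2;j\rangle_\pm&=D^+_{l,j,m_2}|l+1,m_1,m_2+1;j\rangle_\pm\pm D^0_{l,j,m_2}|l,m_1,m_2+1;j\rangle_\pm+D^-_{l,j,m_2}|l-1,m_1,m_2+1;j\rangle_\pm, \end{aligned}$$ with coefficients $$\begin{aligned} A^+_{j,m_1}&=q^{m_1-1}\tfrac{\sqrt{[j+m_1+1][j-m_1+1]}}{[2j+2]},\quad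 A^0_{j,m_1}=q^{-2}\tfrac{q^{j+m_1+1}[2][j-m_1]-[2j]}{[2j][2j+2]},\\ B^+_{j,m_1}&=q^{-j+m_1-1/2}\tfrac{\sqrt{[j+m_1+1][j+m_1+2]}}{[2j+2]},\quad B^0_{j,m_1}=(1+q^2)q^{m_1-1/2}\tfrac{\sqrt{[j-m_1][j+m_1+1]}}{[2j][2j+2]},\quad B^-_{j,m_1}=-q^{j+m_1+1/2}\tfrac{\sqrt{[j-m_1][j-m_1-1]}}{[2j]},\\ C^+_{l,j,m_2}&=-q^{m_2-1-\epsilon}\tfrac{\sqrt{[l+j+m_2+3+\epsilon][l+j-m_2+3-\epsilon]}}{[2l+4]},\\ C^0_{l,j,m_2}&=[4\epsilon]\,q^{2\epsilon l+m_2-1+3\epsilon}\tfrac{\sqrt{[l+\frac12+j-2\epsilon m_2+2][l+\frac12-j-2\epsilon m_2]}}{[2l+2][2l+4]},\\ C^-_{l,j,m_2}&=-q^{m_2-1+\epsilon}\tfrac{\sqrt{[l-j+m_2-\epsilon][l-j-m_2+\epsilon]}}{[2l+2]},\\ H^+_{l,j,m_2}&=q^{m_2-1+\epsilon(2j+1)}\tfrac{\sqrt{[l+2\epsilon j-m_2+2+\epsilon][l-2\epsilon j+m_2+2-\epsilon]}}{[2l+4]},\\ H^0_{l,j,m_2}&=\tfrac{[l-\epsilon(2j+1)-m_2+1][l-\epsilon(2j+1)+m_2+2]-q^{-2}[l+\epsilon(2j+1)-m_2+2][l+\epsilon(2j+1)+m_2+1]}{[2l+2][2l+4]},\\ D^+_{l,j,m_2}&=q^{-l+m_2-3/2}\tfrac{\sqrt{[l+j+m_2+3+\epsilon][l-j+m_2+2-\epsilon]}}{[2l+4]},\\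 D^0_{l,j,m_2}&=[2]q^{m_2+1/2}\tfrac{\sqrt{[l-2\epsilon j-m_2+1-\epsilon][l-2\epsilon j+m_2+2-\epsilon]}}{[2l+2][2l+4]},\\ D^-_{l,j,m_2}&=-q^{l+m_2+3/2}\tfrac{\sqrt{[l-j-m_2+\epsilon][l+j-m_2+1-\epsilon]}}{[2l+2]}. \end{aligned}$$ The grading $\gamma$ is $\pm1$ on $\mathcal H_\pm$. With $\delta(T)=[|D|,T]$, $\Psi^0$ is the algebra generated by $\bigcup_{k\ge0}\delta^k(\mathcal A(S^4_q)\cup[D,\mathcal A(S^4_q)])$, and $\zeta_T(s)=\mathrm{Tr}(T|D|^{-s})$ for $T\in\Psi^0$ (holomorphic for $\mathrm{Re}\,s>4$). The part of the dimension spectrum in the region $\mathrm{Re}\,s>2$ is the set of poles, in that region, of the meromorphic extensions of the functions $\zeta_T$ to $\{\mathrm{Re}\,s>2\}$, $T\in\Psi^0$ (existence of these extensions, with no other singularities, being part of the assertion). *)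

(* Defs.v *)
From HB Require Import structures.
From mathcomp Require Import all_boot all_order all_algebra generic_quotient.
From mathcomp Require Import all_classical all_reals all_analysis.
From mathcomp Require Import complex ring lra.
Set Implicit Arguments.
Unset Strict Implicit.
Unset Printing Implicit Defensive.
Import Order.TTheory GRing.Theory Num.Theory.
Import numFieldNormedType.Exports.
Local Open Scope classical_set_scope.
Local Open Scope quotient_scope.
Local Open Scope complex_scope.
Local Open Scope ring_scope.

Local Notation normc := Normc.normc.
Local Notation Re := complex.Re.
Local Notation Im := complex.Im.

Inductive sterm (R : realType) : Type :=
| SGen of 'I_3
| SConst of R[i]
| SAdd of sterm R & sterm R
| SMul of sterm R & sterm R
| SStar of sterm R.

HB.instance Definition _ (R : realType) := gen_eqMixin (sterm R).
HB.instance Definition _ (R : realType) := gen_choiceMixin (sterm R).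

Arguments SGen {R} _.

Definition SSub (R : realType) (a b : sterm R) : sterm R :=
  SAdd a (SMul (SConst (-1)) b).

Definition t0 (R : realType) : sterm R := SGen (inord 0).
Definition t1 (R : realType) : sterm R := SGen (inord 1).
Definition t2 (R : realType) : sterm R := SGen (inord 2).
Arguments t0 {R}.
Arguments t1 {R}.
Arguments t2 {R}.

(* The algebra A(S^4_q) is the quotient of the terms by the smallest congruence
   that contains the axioms of unital complex *-algebras and the defining
   relations. *)
Inductive sphere_eq (R : realType) (q : R) : sterm R -> sterm R -> Prop :=
| se_refl a : sphere_eq q a a
| se_sym a b : sphere_eq q a b -> sphere_eq q b a
| se_trans b a c : sphere_eq q a b -> sphere_eq q b c -> sphere_eq q a c
| se_add a a' b b' : sphere_eq q a a' -> sphere_eq q b b' ->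
    sphere_eq q (SAdd a b) (SAdd a' b')
| se_mul a a' b b' : sphere_eq q a a' -> sphere_eq q b b' ->
    sphere_eq q (SMul a b) (SMul a' b')
| se_star a a' : sphere_eq q a a' -> sphere_eq q (SStar a) (SStar a')
| se_addA a b c : sphere_eq q (SAdd a (SAdd b c)) (SAdd (SAdd a b) c)
| se_addC a b : sphere_eq q (SAdd a b) (SAdd b a)
| se_add0 a : sphere_eq q (SAdd (SConst 0) a) a
| se_mulA a b c : sphere_eq q (SMul a (SMul b c)) (SMul (SMul a b) c)
| se_mul1 a : sphere_eq q (SMul (SConst 1) a) a
| se_mul0 a : sphere_eq q (SMul (SConst 0) a) (SConst 0)
| se_mulDl a b c :
    sphere_eq q (SMul (SAdd a b) c) (SAdd (SMul a c) (SMul b c))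
| se_mulDr a b c :
    sphere_eq q (SMul a (SAdd b c)) (SAdd (SMul a b) (SMul a c))
| se_constD c d : sphere_eq q (SAdd (SConst c) (SConst d)) (SConst (c + d))
| se_constM c d : sphere_eq q (SMul (SConst c) (SConst d)) (SConst (c * d))
| se_constC c a : sphere_eq q (SMul (SConst c) a) (SMul a (SConst c))
| se_starD a b :
    sphere_eq q (SStar (SAdd a b)) (SAdd (SStar a) (SStar b))
| se_starM a b :
    sphere_eq q (SStar (SMul a b)) (SMul (SStar b) (SStar a))
| se_starK a : sphere_eq q (SStar (SStar a)) a
| se_star_const c : sphere_eq q (SStar (SConst c)) (SConst c^*%C)
| se_x0_sa : sphere_eq q (SStar t0) t0
| se_comm (i j : 'I_3) : (i < j)%N ->
    sphere_eq q (SMul (SGen i) (SGen j))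
      (SMul (SConst (q ^+ 2)%:C) (SMul (SGen j) (SGen i)))
| se_star_comm (i j : 'I_3) : i <> j ->
    sphere_eq q (SMul (SStar (SGen i)) (SGen j))
      (SMul (SConst (q ^+ 2)%:C) (SMul (SGen j) (SStar (SGen i))))
| se_x1_comm :
    sphere_eq q (SSub (SMul (SStar t1) t1) (SMul t1 (SStar t1)))
      (SMul (SConst (1 - q ^+ 4)%:C) (SMul t0 t0))
| se_x2_comm :
    sphere_eq q (SSub (SMul (SStar t2) t2) (SMul t2 (SStar t2)))
      (SSub (SMul (SStar t1) t1)
            (SMul (SConst (q ^+ 4)%:C) (SMul t1 (SStar t1))))
| se_sphere :
    sphere_eq q
      (SAdd (SMul t0 t0) (SAdd (SMul t1 (SStar t1)) (SMul t2 (SStar t2))))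
      (SConst 1).

Section SphereAlgebra.
Variables (R : realType) (q : R).
Implicit Types a b : sterm R.

Definition sphere_eqb : rel (sterm R) := fun a b => `[< sphere_eq q a b >].

Lemma sphere_eqb_refl : reflexive sphere_eqb.
Proof. by move=> a; apply/asboolP; exact: se_refl. Qed.

Lemma sphere_eqb_sym : symmetric sphere_eqb.
Proof. by move=> a b; apply/asboolP/asboolP; exact: se_sym. Qed.

Lemma sphere_eqb_trans : transitive sphere_eqb.
Proof.
by move=> b a c /asboolP ab /asboolP bc; apply/asboolP; exact: se_trans ab bc.
Qed.

Definition sphere_equiv : equiv_rel (sterm R) :=
  EquivRel sphere_eqb sphere_eqb_refl sphere_eqb_sym sphere_eqb_trans.

Definition sphere : Type := {eq_quot sphere_equiv}.
HB.instance Definition _ := Choice.on sphere.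

Definition spi (a : sterm R) : sphere := \pi_({eq_quot sphere_equiv}) a.
Definition srepr (x : sphere) : sterm R :=
  repr (x : {eq_quot sphere_equiv}).

Lemma sreprK x : spi (srepr x) = x.
Proof. exact: reprK. Qed.

Lemma spiE a b : (spi a = spi b) <-> sphere_eq q a b.
Proof.
split=> [/eqP|ab]; first by rewrite eqmodE => /asboolP.
by apply/eqP; rewrite eqmodE; apply/asboolP.
Qed.

Lemma srepr_pi a : sphere_eq q (srepr (spi a)) a.
Proof. by apply/spiE; rewrite sreprK. Qed.

Definition sphere_const (c : R[i]) : sphere := spi (SConst c).
Definition sphere_add (x y : sphere) : sphere := spi (SAdd (srepr x) (srepr y)).
Definition sphere_mul (x y : sphere) : sphere := spi (SMul (srepr x) (srepr y)).
Definition sphere_opp (x : sphere) : sphere := sphere_mul (sphere_const (-1)) x.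
Definition sphere_scale (c : R[i]) (x : sphere) : sphere :=
  sphere_mul (sphere_const c) x.
Definition star (x : sphere) : sphere := spi (SStar (srepr x)).

Lemma spiD a b : sphere_add (spi a) (spi b) = spi (SAdd a b).
Proof. by apply/spiE/se_add; exact: srepr_pi. Qed.

Lemma spiM a b : sphere_mul (spi a) (spi b) = spi (SMul a b).
Proof. by apply/spiE/se_mul; exact: srepr_pi. Qed.

Lemma spi_star a : star (spi a) = spi (SStar a).
Proof. by apply/spiE/se_star; exact: srepr_pi. Qed.

Lemma sphere_addA : associative sphere_add.
Proof.
move=> x y z; rewrite -(sreprK x) -(sreprK y) -(sreprK z) !spiD.
exact/spiE/se_addA.
Qed.

Lemma sphere_addC : commutative sphere_add.
Proof.
by move=> x y; rewrite -(sreprK x) -(sreprK y) !spiD; exact/spiE/se_addC.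
Qed.

Lemma sphere_add0 : left_id (sphere_const 0) sphere_add.
Proof. by move=> x; rewrite -(sreprK x) spiD; exact/spiE/se_add0. Qed.

Lemma sphere_mulA : associative sphere_mul.
Proof.
move=> x y z; rewrite -(sreprK x) -(sreprK y) -(sreprK z) !spiM.
exact/spiE/se_mulA.
Qed.

Lemma sphere_mul1 : left_id (sphere_const 1) sphere_mul.
Proof. by move=> x; rewrite -(sreprK x) spiM; exact/spiE/se_mul1. Qed.

Lemma sphere_constC c x :
  sphere_mul (sphere_const c) x = sphere_mul x (sphere_const c).
Proof. by rewrite -(sreprK x) !spiM; exact/spiE/se_constC. Qed.

Lemma sphere_mulr1 : right_id (sphere_const 1) sphere_mul.
Proof. by move=> x; rewrite -sphere_constC sphere_mul1. Qed.

Lemma sphere_mulDl : left_distributive sphere_mul sphere_add.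
Proof.
move=> x y z; rewrite -(sreprK x) -(sreprK y) -(sreprK z) !(spiM, spiD).
exact/spiE/se_mulDl.
Qed.

Lemma sphere_mulDr : right_distributive sphere_mul sphere_add.
Proof.
move=> x y z; rewrite -(sreprK x) -(sreprK y) -(sreprK z) !(spiM, spiD).
exact/spiE/se_mulDr.
Qed.

Lemma sphere_constD c d :
  sphere_add (sphere_const c) (sphere_const d) = sphere_const (c + d).
Proof. by rewrite spiD; exact/spiE/se_constD. Qed.

Lemma sphere_constM c d :
  sphere_mul (sphere_const c) (sphere_const d) = sphere_const (c * d).
Proof. by rewrite spiM; exact/spiE/se_constM. Qed.

Lemma sphere_addN : left_inverse (sphere_const 0) sphere_opp sphere_add.
Proof.
move=> x; rewrite /sphere_opp -{2}(sphere_mul1 x) -sphere_mulDl sphere_constD.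
by rewrite addNr -(sreprK x) spiM; exact/spiE/se_mul0.
Qed.

Definition classical_gen (theta : R) (i : 'I_3) : R[i] :=
  if (i == 2 :> nat) then cos theta +i* sin theta else 0.

(* The value of a term under x_0, x_1 |-> 0, x_2 |-> exp(i theta). *)
Fixpoint classical_value (theta : R) (a : sterm R) : R[i] :=
  match a with
  | SGen i => classical_gen theta i
  | SConst c => c
  | SAdd a b => classical_value theta a + classical_value theta b
  | SMul a b => classical_value theta a * classical_value theta b
  | SStar a => (classical_value theta a)^*%C
  end.

Lemma classical_value_eq theta a b : sphere_eq q a b ->
  classical_value theta a = classical_value theta b.
Proof.
have ux (t : R) : (cos t +i* sin t) * (cos t +i* sin t)^*%C = 1 :> R[i].
  apply/eqP; rewrite eq_complex /=; apply/andP; split; apply/eqP.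
    by rewrite mulrN opprK -!expr2 cos2Dsin2.
  by rewrite mulrN [sin t * _]mulrC addNr.
have g0 : classical_gen theta (inord 0) = 0 by rewrite /classical_gen inordK.
have g1 : classical_gen theta (inord 1) = 0 by rewrite /classical_gen inordK.
have g2 : classical_gen theta (inord 2) = cos theta +i* sin theta.
  by rewrite /classical_gen inordK.
elim=> //=.
- by move=> a1 a2 a3 _ -> _ ->.
- by move=> ? ? ? ? _ -> _ ->.
- by move=> ? ? ? ? _ -> _ ->.
- by move=> ? ? _ ->.
- by move=> ? ? ?; rewrite addrA.
- by move=> ? ?; rewrite addrC.
- by move=> ?; rewrite add0r.
- by move=> ? ? ?; rewrite mulrA.
- by move=> ?; rewrite mul1r.
- by move=> ?; rewrite mul0r.
- by move=> ? ? ?; rewrite mulrDl.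
- by move=> ? ? ?; rewrite mulrDr.
- by move=> ? ?; rewrite mulrC.
- by move=> ? ?; rewrite rmorphD.
- by move=> ? ?; rewrite rmorphM mulrC.
- by move=> ?; rewrite conjcK.
- by rewrite g0 conjc0.
- move=> i j ij; rewrite /classical_gen; have -> : (i == 2 :> nat) = false.
    by apply/negbTE/eqP => i2; move: ij (ltn_ord j); rewrite i2; case: (nat_of_ord j) => [|[|[|]]].
  by rewrite mul0r mulr0 mulr0.
- move=> i j ij; rewrite /classical_gen; have [i2|i2] := eqVneq (i : nat) 2%N.
    have [j2|j2] := eqVneq (j : nat) 2%N; last by rewrite mulr0 mul0r mulr0.
    by case: ij; apply: val_inj; rewrite /= i2 j2.
  by rewrite conjc0 mul0r mulr0 mulr0.
- by rewrite g0 g1 conjc0 !(mulr0, addr0).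
- by rewrite g1 g2 conjc0 !(mulr0, addr0) mulN1r [X in X - _]mulrC addrN.
- by rewrite g0 g1 g2 conjc0 !(mulr0, add0r) ux.
Qed.

Lemma sphere_oner_neq0 : sphere_const 1 != sphere_const 0.
Proof.
apply/eqP => /spiE /(classical_value_eq 0) /= /eqP; apply/negP.
exact: oner_neq0.
Qed.

HB.instance Definition _ := GRing.isZmodule.Build sphere
  sphere_addA sphere_addC sphere_add0 sphere_addN.

HB.instance Definition _ := GRing.Zmodule_isNzRing.Build sphere
  sphere_mulA sphere_mul1 sphere_mulr1 sphere_mulDl sphere_mulDr
  sphere_oner_neq0.

Lemma sphere_scaleA c d (x : sphere) :
  sphere_scale c (sphere_scale d x) = sphere_scale (c * d) x.
Proof. by rewrite /sphere_scale sphere_mulA sphere_constM. Qed.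

Lemma sphere_scale1 : left_id 1 sphere_scale.
Proof. exact: sphere_mul1. Qed.

Lemma sphere_scaleDr : right_distributive sphere_scale +%R.
Proof. by move=> c x y; exact: sphere_mulDr. Qed.

Lemma sphere_scaleDl (x : sphere) :
  {morph sphere_scale^~ x : c d / c + d}.
Proof. by move=> c d; rewrite /sphere_scale -sphere_constD; exact: sphere_mulDl. Qed.

HB.instance Definition _ := GRing.Zmodule_isLmodule.Build R[i] sphere
  sphere_scaleA sphere_scale1 sphere_scaleDr sphere_scaleDl.

Lemma sphere_scaleAl c (x y : sphere) : c *: (x * y) = (c *: x) * y.
Proof. exact: sphere_mulA. Qed.

HB.instance Definition _ := GRing.Lmodule_isLalgebra.Build R[i] sphere
  sphere_scaleAl.

Lemma sphere_scaleAr c (x y : sphere) : c *: (x * y) = x * (c *: y).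
Proof.
by rewrite scalerAl; apply: etrans (esym (mulrA x _ y)); congr (_ * y);
  exact: sphere_constC.
Qed.

HB.instance Definition _ := GRing.Lalgebra_isAlgebra.Build R[i] sphere
  sphere_scaleAr.

Definition x0 : sphere := spi t0.
Definition x1 : sphere := spi t1.
Definition x2 : sphere := spi t2.

End SphereAlgebra.

Arguments x0 {R q}.
Arguments x1 {R q}.
Arguments x2 {R q}.

Definition circle_u (R : realType) (theta : R) : R[i] :=
  cos theta +i* sin theta.

Inductive circle_algebra (R : realType) : (R -> R[i]) -> Prop :=
| circle_const c : circle_algebra (fun=> c)
| circle_gen : circle_algebra (@circle_u R)
| circle_add f g : circle_algebra f -> circle_algebra g ->
    circle_algebra (f + g)
| circle_mul f g : circle_algebra f -> circle_algebra g ->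
    circle_algebra (f * g)
| circle_conj f : circle_algebra f -> circle_algebra (fun t => (f t)^*%C).

Definition circle_morphism (R : realType) (q : R)
    (sigma : sphere q -> R -> R[i]) : Prop :=
  [/\ forall a, circle_algebra (sigma a),
      sigma 1 = 1,
      linear sigma,
      {morph sigma : a b / a * b} &
      forall a, sigma (star a) = fun t => (sigma a t)^*%C].

Definition classical_points (R : realType) (q : R)
    (sigma : sphere q -> R -> R[i]) : Prop :=
  [/\ circle_morphism sigma, sigma x0 = 0, sigma x1 = 0 &
      sigma x2 = @circle_u R].

Lemma classical_points_exists (R : realType) (q : R) :
  exists sigma : sphere q -> R -> R[i], classical_points sigma.
Proof.
pose cv (a : sterm R) (t : R) := classical_value t a.
pose sigma (a : sphere q) (t : R) := classical_value t (srepr a).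
have sigmaE a : sigma (spi q a) = cv a.
  apply/funext => t; apply: classical_value_eq; exact: srepr_pi.
have vD a b : cv (SAdd a b) =
    cv a + cv b :> (R -> R[i]) by apply/funext.
have vM a b : cv (SMul a b) =
    cv a * cv b :> (R -> R[i]) by apply/funext.
exists sigma; split; first split.
- move=> a; rewrite -(sreprK a) sigmaE.
  elim: (srepr a) => [i|c|b ib d id|b ib d id|b ib].
  + have [i2|i2] := eqVneq (i : nat) 2%N.
      rewrite (_ : cv _ = @circle_u R); first exact: circle_gen.
      by apply/funext => t; rewrite /cv /= /classical_gen i2.
    rewrite (_ : cv _ = fun=> 0); first exact: circle_const.
    by apply/funext => t; rewrite /cv /= /classical_gen (negbTE i2).
  + exact: circle_const.
  + by rewrite vD; exact: circle_add.
  + by rewrite vM; exact: circle_mul.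
  + exact: circle_conj.
- by rewrite sigmaE.
- move=> c a b; rewrite -(sreprK a) -(sreprK b).
  rewrite [X in sigma X](_ : _ =
    spi q (SAdd (SMul (SConst c) (srepr a)) (srepr b))); last first.
    by rewrite -spiD -spiM.
  by rewrite !sigmaE.
- by move=> a b; rewrite -(sreprK a) -(sreprK b) [_ * _]spiM !sigmaE vM.
- by move=> a; rewrite -(sreprK a) spi_star !sigmaE.
- by rewrite sigmaE; apply/funext => t; rewrite /cv /= /classical_gen inordK.
- by rewrite sigmaE; apply/funext => t; rewrite /cv /= /classical_gen inordK.
- by rewrite sigmaE; apply/funext => t; rewrite /cv /= /classical_gen inordK.
Qed.

(* These agree with the usual sums on absolutely summable families. *)
Definition rsum (R : realType) (I : choiceType) (f : I -> R) : R :=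
  fine (\esum_(i in [set: I]) (Num.max (f i) 0)%:E) -
  fine (\esum_(i in [set: I]) (Num.max (- f i) 0)%:E).

Definition csum (R : realType) (I : choiceType) (f : I -> R[i]) : R[i] :=
  rsum (fun i => Re (f i)) +i* rsum (fun i => Im (f i)).

Definition csummable (R : realType) (I : choiceType) (f : I -> R[i]) : Prop :=
  summable [set: I] (fun i => (normc (f i))%:E).

(* l, m_1, m_2 and j are half-integers, represented as rationals. *)
Definition labels : Type := (rat * rat * rat * rat)%type.

Definition in_range (v : labels) : bool :=
  let: (l, m1, m2, j) := v in
  [&& l - 2^-1 \is a Num.nat, j - 2^-1 \is a Num.nat, l - j \is a Num.nat,
      j - `|m1| \is a Num.nat & l + 2^-1 - j - `|m2| \is a Num.nat].

Definition lattice : Type := {v : labels | in_range v}.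
HB.instance Definition _ := Choice.on lattice.

Definition l_of (p : lattice) : rat := (val p).1.1.1.

(* The boolean is the eigenvalue of the grading: true on H_+, false on H_-. *)
Definition basis_index : Type := (bool * lattice)%type.
HB.instance Definition _ := Choice.on basis_index.

Section HilbertSpace.
Variable R : realType.
Implicit Types f g : basis_index -> R[i].

Definition square_summable f : bool :=
  summable [set: basis_index] (fun k => ((normc (f k)) ^+ 2)%:E).

Definition l2 : {pred basis_index -> R[i]} := [pred f | square_summable f].

Lemma l2P f : (f \in l2) <->
  (\esum_(k in [set: basis_index]) ((normc (f k)) ^+ 2)%:E < +oo)%E.
Proof.
rewrite unfold_in /= /square_summable /summable.
rewrite (eq_esum (b := fun k => ((normc (f k)) ^+ 2)%:E))//.
by move=> k _; rewrite gee0_abs// lee_fin sqr_ge0.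
Qed.

Lemma l2_dominated f (g : basis_index -> R) (n : nat) :
  (forall k, (normc (f k)) ^+ 2 <= g k *+ n) -> (forall k, 0 <= g k) ->
  (\esum_(k in [set: basis_index]) (g k)%:E < +oo)%E -> f \in l2.
Proof.
move=> fg g0 gfin; apply/l2P.
apply: (@le_lt_trans _ _ (\esum_(k in [set: basis_index]) (g k *+ n)%:E)%E).
  by apply: le_esum => k _; rewrite lee_fin.
elim: n {fg} => [|n ih].
  by rewrite esum1 ?ltry// => k _; rewrite mulr0n.
under eq_esum do rewrite mulrS EFinD.
rewrite esumD; first by rewrite lte_add_pinfty.
  by move=> k _; rewrite lee_fin.
by move=> k _; rewrite lee_fin mulrn_wge0.
Qed.

Lemma normcD_sqr (x y : R[i]) :
  (normc (x + y)) ^+ 2 <= ((normc x) ^+ 2 + (normc y) ^+ 2) *+ 2.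
Proof.
case: x y => [a b] [c d] /=; rewrite !sqr_sqrtr ?addr_ge0 ?sqr_ge0//.
rewrite -subr_ge0.
rewrite [X in 0 <= X](_ : _ = (a - c) ^+ 2 + (b - d) ^+ 2); last by ring.
by rewrite addr_ge0 ?sqr_ge0.
Qed.

Lemma l2_submod_closed : submod_closed l2.
Proof.
split.
  apply/l2P; rewrite esum1 ?ltry// => k _.
  by rewrite [normc _]Normc.normc0 expr0n.
have add f g : f \in l2 -> g \in l2 -> f + g \in l2.
  move=> /l2P fin /l2P gin.
  apply: (@l2_dominated _ (fun k => (normc (f k)) ^+ 2 + (normc (g k)) ^+ 2) 2).
  - by move=> k; exact: normcD_sqr.
  - by move=> k; rewrite addr_ge0 ?sqr_ge0.
  - under eq_esum do rewrite EFinD.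
    rewrite esumD; first by rewrite lte_add_pinfty.
      by move=> k _; rewrite lee_fin sqr_ge0.
    by move=> k _; rewrite lee_fin sqr_ge0.
move=> c f g fin gin; apply: add => //; move/l2P: fin => fin.
have [n nP] : exists n, (normc c) ^+ 2 <= n%:R :> R.
  exists (Num.truncn ((normc c) ^+ 2)).+1; apply/ltW.
  by rewrite truncnS_gt.
apply: (@l2_dominated _ (fun k => (normc (f k)) ^+ 2) n) => //.
- move=> k; rewrite Normc.normcM exprMn -mulr_natl.
  by rewrite ler_wpM2r ?sqr_ge0.
- by move=> k; rewrite sqr_ge0.
Qed.

HB.instance Definition _ := GRing.isSubmodClosed.Build _ _ l2 l2_submod_closed.

Record hilbert : Type := Hilbert {
  hilbert_val :> basis_index -> R[i];
  hilbert_l2 : hilbert_val \in l2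
}.

HB.instance Definition _ := [isSub of hilbert for hilbert_val].
HB.instance Definition _ := [Choice of hilbert by <:].
HB.instance Definition _ := [SubChoice_isSubLmodule of hilbert by <:].

(* Conjugate-linear in the first variable. *)
Definition inner (phi psi : hilbert) : R[i] :=
  csum (fun k => (phi k)^*%C * psi k).

Definition hnorm (psi : hilbert) : R := Num.sqrt (Re (inner psi psi)).

Definition bounded_op (T : hilbert -> hilbert) : Prop :=
  linear T /\ exists M : R, forall psi, hnorm (T psi) <= M * hnorm psi.

Lemma delta_l2 (k : basis_index) : (fun k' => (k' == k)%:R) \in l2.
Proof.
apply/l2P; rewrite (_ : esum _ _ = (\esum_(i in [set k]) 1)%E).
  by rewrite esum_set1// ltry.
rewrite [RHS]esum_mkcond; apply: eq_esum => i _.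
have [->|ik] := eqVneq i k.
  by rewrite mem_set// (_ : normc _ = 1) ?expr1n//; exact: Normc.normc1.
rewrite memNset; last exact/eqP.
by rewrite (_ : normc _ = 0) ?expr0n//; exact: Normc.normc0.
Qed.

Definition basis (k : basis_index) : hilbert := Hilbert (delta_l2 k).

(* Out-of-range labels give 0: this omits the corresponding terms in the
   formulas for the generators. *)
Definition ket (c : bool) (l m1 m2 j : rat) : hilbert :=
  if insub (l, m1, m2, j) is Some p then basis (c, p : lattice) else 0.

Definition eigenvalue (p : lattice) : R := ratr (l_of p + 3 / 2).

(* Unbounded operators are given by their graphs; these two have their maximal
   domains, on which they are self-adjoint. *)
Definition dirac (psi phi : hilbert) : Prop :=
  forall c p, phi (c, p) = (eigenvalue p)%:C * psi (~~ c, p).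

Definition abs_dirac (psi phi : hilbert) : Prop :=
  forall c p, phi (c, p) = (eigenvalue p)%:C * psi (c, p).

Lemma dirac_ket (c : bool) (l m1 m2 j : rat) :
  dirac (ket c l m1 m2 j)
        ((ratr (l + 3 / 2) : R)%:C *: ket (~~ c) l m1 m2 j).
Proof.
rewrite /ket; case: insubP => [p _ pE|_] c' p' /=; last by rewrite scaler0 mulr0.
rewrite /eigenvalue /l_of.
have [->|pp'] := eqVneq p' p; last first.
  rewrite /GRing.scale /= /GRing.scale /= !xpair_eqE (negbTE pp') !andbF.
  by rewrite !mulr0.
rewrite pE /=; congr (_ * _).
by rewrite !xpair_eqE !eqxx !andbT; case: c c' => [] [].
Qed.

Lemma l2_flip (psi : hilbert) : (fun k => psi (~~ k.1, k.2)) \in l2.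
Proof.
have /l2P h := hilbert_l2 psi; apply/l2P.
pose e (k : basis_index) : basis_index := (~~ k.1, k.2).
have eK : involutive e by case=> b p; rewrite /e /= negbK.
have eb : set_bij [set: basis_index] [set: basis_index] e.
  split => [k //|k k' _ _ kk'|k _]; first exact: (inv_inj eK).
  by exists (e k).
by rewrite (reindex_esum [set: basis_index] [set: basis_index] e) in h.
Qed.

Lemma dirac_sqr (psi phi : hilbert) :
  (exists2 chi, dirac psi chi & dirac chi phi) <->
  (exists2 chi, abs_dirac psi chi & abs_dirac chi phi).
Proof.
split=> -[chi h1 h2]; exists (Hilbert (l2_flip chi)) => c p /=.
- by rewrite h1 negbK.
- by rewrite h2.
- by rewrite h1.
- by rewrite h2 negbK.
Qed.

Definition cpow (x : R) (z : R[i]) : R[i] :=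
  (expR (Re z * ln x) * cos (Im z * ln x)) +i*
  (expR (Re z * ln x) * sin (Im z * ln x)).

(* |D|^z, extended by 0 outside of its domain; it is bounded and everywhere
   defined when the real part of z is nonpositive. *)
Definition abs_dirac_pow (z : R[i]) (psi : hilbert) : hilbert :=
  insubd (0 : hilbert) (fun k => cpow (eigenvalue k.2) z * psi k).

Lemma abs_dirac_pow_basis (z : R[i]) (k : basis_index) :
  abs_dirac_pow z (basis k) = cpow (eigenvalue k.2) z *: basis k.
Proof.
apply/val_inj; rewrite /abs_dirac_pow.
have E : (fun k' => cpow (eigenvalue k'.2) z * basis k k') =
    (cpow (eigenvalue k.2) z *: basis k : hilbert) :> (basis_index -> R[i]).
  apply/funext => k'; rewrite /GRing.scale /= /GRing.scale /=.
  have [->|_] := eqVneq k' k; first by [].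
  by rewrite mulr0 scaler0.
by rewrite insubdK E//; exact: hilbert_l2.
Qed.

Definition diagonal (T : hilbert -> hilbert) (k : basis_index) : R[i] :=
  inner (basis k) (T (basis k)).

Definition trace (T : hilbert -> hilbert) : R[i] := csum (diagonal T).

Definition zeta (T : hilbert -> hilbert) (s : R[i]) : R[i] :=
  trace (T \o abs_dirac_pow (- s)).

(* S is the bounded extension of the commutator D T - T D. *)
Definition commutator (D : hilbert -> hilbert -> Prop)
    (T S : hilbert -> hilbert) : Prop :=
  bounded_op S /\
  forall psi phi, D psi phi -> D (T psi) (S psi + T phi).

(* The union over k of delta^k (A `|` [D, A]). *)
Inductive delta_orbit (A : Type) (rho : A -> hilbert -> hilbert) :
    (hilbert -> hilbert) -> Prop :=
| delta_rep a : delta_orbit rho (rho a)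
| delta_dirac a S : commutator dirac (rho a) S -> delta_orbit rho S
| delta_step T S : delta_orbit rho T -> commutator abs_dirac T S ->
    delta_orbit rho S.

Inductive Psi0 (A : Type) (rho : A -> hilbert -> hilbert) :
    (hilbert -> hilbert) -> Prop :=
| Psi0_gen T : delta_orbit rho T -> Psi0 rho T
| Psi0_scale (c : R[i]) T : Psi0 rho T -> Psi0 rho (fun psi => c *: T psi)
| Psi0_add T S : Psi0 rho T -> Psi0 rho S ->
    Psi0 rho (fun psi => T psi + S psi)
| Psi0_mul T S : Psi0 rho T -> Psi0 rho S -> Psi0 rho (T \o S).

End HilbertSpace.

Section Meromorphic.
Variable R : realType.
Implicit Types (f g : R[i] -> R[i]) (s : R[i]).

Definition holomorphic_at f s : Prop :=
  \forall z \near (s : R[i]^o), derivable (f : R[i]^o -> R[i]^o) z 1.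

Definition pole_of_order (n : nat) f s : Prop :=
  exists g, [/\ holomorphic_at g s, g s != 0 &
    \forall z \near (s : R[i]^o)^', f z = g z / (z - s) ^+ n].

Definition is_pole f s : Prop := exists2 n, (0 < n)%N & pole_of_order n f s.

Definition is_simple_pole f s : Prop := pole_of_order 1 f s.

Definition meromorphic_on (U : set R[i]) f : Prop :=
  forall s, U s -> holomorphic_at f s \/ is_pole f s.

(* r is the coefficient of (z - s)^-1 in the Laurent expansion of f at s. *)
Definition is_residue f s (r : R[i]) : Prop :=
  exists (n : nat) (c : nat -> R[i]) g,
    [/\ holomorphic_at g s, c 0%N = r &
      \forall z \near (s : R[i]^o)^',
        f z = \sum_(k < n.+1) c k / (z - s) ^+ k.+1 + g z].

(* F is meromorphic on Re s > 2 and continues the zeta function of T, which is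
   given by an absolutely convergent trace on Re s > 4. *)
Definition zeta_extension (T : hilbert R -> hilbert R) (F : R[i] -> R[i]) :
    Prop :=
  meromorphic_on [set s | 2 < Re s] F /\
  forall s, 4 < Re s ->
    csummable (diagonal (T \o abs_dirac_pow (- s))) /\ F s = zeta T s.

Definition circle_integral (f : R -> R[i]) : R[i] :=
  (\int[lebesgue_measure]_(t in `[0%R, 2 * pi]) Re (f t)) +i*
  (\int[lebesgue_measure]_(t in `[0%R, 2 * pi]) Im (f t)).

End Meromorphic.

Section ChiralRepresentation.
Variables (R : realType) (q : R).

Definition star_representation (rho : sphere q -> hilbert R -> hilbert R) :
    Prop :=
  [/\ forall a, bounded_op (rho a),
      rho 1 = id,
      linear rho,
      forall a b, rho (a * b) = rho a \o rho b &
      forall a phi psi, inner (rho (star a) phi) psi = inner phi (rho a psi)].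

Definition qpow (x : rat) : R := q `^ ratr x.

Definition qn (x : rat) : R := (qpow x - qpow (- x)) / (q - q^-1).

Definition eps (l j m2 : rat) : rat :=
  if (l + 2^-1 - j - m2) / 2 \is a Num.nat then 2^-1 else - 2^-1.

Lemma eps_even (l m1 m2 j : rat) : in_range (l, m1, m2, j) ->
  (l + eps l j m2 - j - m2) / 2 \is a Num.nat.
Proof.
case/and5P => _ _ /natrP[a aE] _ /natrP[b bE].
have [n nE] : exists n, l + 2^-1 - j - m2 = n%:R.
  have [m0|m0] := leP 0 m2.
    by exists b; rewrite -bE ger0_norm.
  exists (2 * a + 1 - b)%N; rewrite ltr0_norm // in bE.
  have le : (b <= 2 * a + 1)%N.
    by have := ler0n rat a; rewrite -(@ler_nat rat) natrD natrM -bE -aE; lra.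
  rewrite natrB // natrD natrM -bE -aE; lra.
rewrite /eps nE; case: ifPn => [|odd_n].
  by rewrite nE.
have nodd : odd n.
  apply: contraR odd_n => /even_halfK <-.
  by rewrite -muln2 natrM mulfK// natr_nat.
rewrite (_ : _ / 2 = n./2%:R) ?natr_nat//.
have : n%:R = 1 + 2 * n./2%:R :> rat.
  by rewrite -{1}(odd_double_half n) nodd -mul2n natrD natrM.
rewrite -nE; lra.
Qed.

Definition Ap (j m1 : rat) : R :=
  qpow (m1 - 1) * Num.sqrt (qn (j + m1 + 1) * qn (j - m1 + 1)) /
  qn (2 * j + 2).

Definition A0 (j m1 : rat) : R :=
  qpow (- 2) * (qpow (j + m1 + 1) * qn 2 * qn (j - m1) - qn (2 * j)) /
  (qn (2 * j) * qn (2 * j + 2)).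

Definition Bp (j m1 : rat) : R :=
  qpow (- j + m1 - 1 / 2) * Num.sqrt (qn (j + m1 + 1) * qn (j + m1 + 2)) /
  qn (2 * j + 2).

Definition B0 (j m1 : rat) : R :=
  (1 + q ^+ 2) * qpow (m1 - 1 / 2) *
  Num.sqrt (qn (j - m1) * qn (j + m1 + 1)) / (qn (2 * j) * qn (2 * j + 2)).

Definition Bm (j m1 : rat) : R :=
  - qpow (j + m1 + 1 / 2) * Num.sqrt (qn (j - m1) * qn (j - m1 - 1)) /
  qn (2 * j).

Definition Cp (l j m2 : rat) : R :=
  let e := eps l j m2 in
  - qpow (m2 - 1 - e) *
  Num.sqrt (qn (l + j + m2 + 3 + e) * qn (l + j - m2 + 3 - e)) /
  qn (2 * l + 4).

Definition C0 (l j m2 : rat) : R :=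
  let e := eps l j m2 in
  qn (4 * e) * qpow (2 * e * l + m2 - 1 + 3 * e) *
  Num.sqrt (qn (l + 1 / 2 + j - 2 * e * m2 + 2) *
            qn (l + 1 / 2 - j - 2 * e * m2)) /
  (qn (2 * l + 2) * qn (2 * l + 4)).

Definition Cm (l j m2 : rat) : R :=
  let e := eps l j m2 in
  - qpow (m2 - 1 + e) *
  Num.sqrt (qn (l - j + m2 - e) * qn (l - j - m2 + e)) / qn (2 * l + 2).

Definition Hp (l j m2 : rat) : R :=
  let e := eps l j m2 in
  qpow (m2 - 1 + e * (2 * j + 1)) *
  Num.sqrt (qn (l + 2 * e * j - m2 + 2 + e) *
            qn (l - 2 * e * j + m2 + 2 - e)) / qn (2 * l + 4).

Definition H0 (l j m2 : rat) : R :=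
  let e := eps l j m2 in
  (qn (l - e * (2 * j + 1) - m2 + 1) * qn (l - e * (2 * j + 1) + m2 + 2) -
   qpow (- 2) *
   qn (l + e * (2 * j + 1) - m2 + 2) * qn (l + e * (2 * j + 1) + m2 + 1)) /
  (qn (2 * l + 2) * qn (2 * l + 4)).

Definition Dp (l j m2 : rat) : R :=
  let e := eps l j m2 in
  qpow (- l + m2 - 3 / 2) *
  Num.sqrt (qn (l + j + m2 + 3 + e) * qn (l - j + m2 + 2 - e)) /
  qn (2 * l + 4).

Definition D0 (l j m2 : rat) : R :=
  let e := eps l j m2 in
  qn 2 * qpow (m2 + 1 / 2) *
  Num.sqrt (qn (l - 2 * e * j - m2 + 1 - e) *
            qn (l - 2 * e * j + m2 + 2 - e)) /
  (qn (2 * l + 2) * qn (2 * l + 4)).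

Definition Dm (l j m2 : rat) : R :=
  let e := eps l j m2 in
  - qpow (l + m2 + 3 / 2) *
  Num.sqrt (qn (l - j - m2 + e) * qn (l + j - m2 + 1 - e)) / qn (2 * l + 2).

Local Notation ket := (@ket R).

Definition sg (c : bool) : R := if c then 1 else - 1.

Definition x0_ket (c : bool) (l m1 m2 j : rat) : hilbert R :=
  (Ap j m1)%:C *:
    ((Cp l j m2)%:C *: ket c (l + 1) m1 m2 (j + 1)
     - (sg c * C0 l j m2)%:C *: ket c l m1 m2 (j + 1)
     + (Cm l j m2)%:C *: ket c (l - 1) m1 m2 (j + 1)) +
  (A0 j m1)%:C *:
    ((Hp l j m2)%:C *: ket c (l + 1) m1 m2 j
     + (sg c * H0 l j m2)%:C *: ket c l m1 m2 j
     + (Hp (l - 1) j m2)%:C *: ket c (l - 1) m1 m2 j) +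
  (Ap (j - 1) m1)%:C *:
    ((Cm (l + 1) (j - 1) m2)%:C *: ket c (l + 1) m1 m2 (j - 1)
     - (sg c * C0 l (j - 1) m2)%:C *: ket c l m1 m2 (j - 1)
     + (Cp (l - 1) (j - 1) m2)%:C *: ket c (l - 1) m1 m2 (j - 1)).

Definition x1_ket (c : bool) (l m1 m2 j : rat) : hilbert R :=
  (Bp j m1)%:C *:
    ((Cp l j m2)%:C *: ket c (l + 1) (m1 + 1) m2 (j + 1)
     - (sg c * C0 l j m2)%:C *: ket c l (m1 + 1) m2 (j + 1)
     + (Cm l j m2)%:C *: ket c (l - 1) (m1 + 1) m2 (j + 1)) +
  (B0 j m1)%:C *:
    ((Hp l j m2)%:C *: ket c (l + 1) (m1 + 1) m2 j
     + (sg c * H0 l j m2)%:C *: ket c l (m1 + 1) m2 j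
     + (Hp (l - 1) j m2)%:C *: ket c (l - 1) (m1 + 1) m2 j) +
  (Bm j m1)%:C *:
    ((Cm (l + 1) (j - 1) m2)%:C *: ket c (l + 1) (m1 + 1) m2 (j - 1)
     - (sg c * C0 l (j - 1) m2)%:C *: ket c l (m1 + 1) m2 (j - 1)
     + (Cp (l - 1) (j - 1) m2)%:C *: ket c (l - 1) (m1 + 1) m2 (j - 1)).

Definition x2_ket (c : bool) (l m1 m2 j : rat) : hilbert R :=
  (Dp l j m2)%:C *: ket c (l + 1) m1 (m2 + 1) j
  + (sg c * D0 l j m2)%:C *: ket c l m1 (m2 + 1) j
  + (Dm l j m2)%:C *: ket c (l - 1) m1 (m2 + 1) j.

Definition chiral_representation
    (rho : sphere q -> hilbert R -> hilbert R) : Prop :=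
  star_representation rho /\
  forall (c : bool) (l m1 m2 j : rat), in_range (l, m1, m2, j) ->
    [/\ rho x0 (ket c l m1 m2 j) = x0_ket c l m1 m2 j,
        rho x1 (ket c l m1 m2 j) = x1_ket c l m1 m2 j &
        rho x2 (ket c l m1 m2 j) = x2_ket c l m1 m2 j].

End ChiralRepresentation.

(* Main.v *)
(* In the coordinates a = l+1/2-j+m2, b = l+1/2-j-m2, c = j+m1, d = j-m1 the
   generators act, up to coefficients O(q^(a+c)) that are moreover invariant
   under the exchange of the two chiralities up to O(q^(a+b+c+d)), as follows: x0
   as 0, x1 as c -> c + 2 with the coefficient -q^(2 floor(a/2)), x2 as a -> a + 2
   with the coefficient sqrt(1 - q^(4 floor(a/2) + 4)) = 1 + O(q^a). Operators of
   this form (tame, below) are closed under sums, products, adjoints, [|D|, .] and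
   [D, .], so they contain Psi^0. The diagonal of a tame operator is
   kappa + g(a) + O(th^(a+c)) with 0 < th < 1,
   where kappa is the mean over the circle of its symbol. The eigenvalue N of |D|
   has multiplicity 4/3 (N^3 - N), and 2 N^2 + O(N) points with a given a, so that
   the partial traces are 4/3 kappa N^3 + 2 (sum g) N^2 + O(N). The zeta function
   is then a combination of the shifted Riemann zeta functions of s - 3 and s - 2,
   with poles at 4 and 3, and of a series that is holomorphic for Re s > 2. The
   identity has a pole at 4; for x1^* x1 the symbol is 0 and g is nonnegative and
   not 0, whence a pole at 3. *)

Require Import Defs.
From mathcomp Require Import all_boot all_order all_algebra.
From mathcomp Require Import all_classical all_reals all_analysis.
From mathcomp Require Import complex.
From mathcomp Require Import ring lra zify.
Import Order.TTheory GRing.Theory Num.Theory.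
Import numFieldNormedType.Exports.
Local Open Scope classical_set_scope.
Local Open Scope complex_scope.
Local Open Scope ring_scope.
Set Implicit Arguments.
Unset Strict Implicit.
Unset Printing Implicit Defensive.

(** The obstacle is the commutator with D. It exchanges the chiralities, so from a term with
    coefficient psi it makes N times the difference of the two values of psi. Decay in $a+c$ cannot
    absorb N, since b and d are free; hence that difference has to decay in $a+b+c+d$, which
    determines N. These commutators are odd, so a symbol has a second argument, a character of the
    group of order 2 generated by the exchange. A main term that moves c must have limit coefficient
    0: otherwise its truncation near $c = 0$ would not be an error term. The continuation rests on
    $(N+1/2)^w - (N-1/2)^w = w N^{w-1} + O(N^{Re w-3})$. The difference is centred, so there is no
    term in $N^{w-2}$, and the left side telescopes in N. Thus $w \sum N^{w-1}$ extends to $Re w <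
    2$, which is $Re s > 2$ for $w = 4 - s$, and its value at $w = 0$ gives the residue. Taylor
    remainders with explicit constants take the place of general theorems on series of holomorphic
    functions and on removable singularities. *)

Local Notation normc := Normc.normc.
Local Notation Re := complex.Re.
Local Notation Im := complex.Im.

(** * Absolutely summable families *)

Section RealSums.
Variables (R : realType) (I : choiceType).
Implicit Types f g : I -> R.

Definition total g : \bar R := (\esum_(i in [set: I]) (g i)%:E)%E.
Definition rsummable g : Prop := (total (fun i => `|g i|%R) < +oo)%E.

Lemma total_ge0 g : (forall i, 0 <= g i) -> (0 <= total g)%E.
Proof. by move=> g0; apply: esum_ge0 => i _; rewrite lee_fin. Qed.

Lemma le_total f g : (forall i, f i <= g i) -> (total f <= total g)%E.
Proof. by move=> fg; apply: le_esum => i _; rewrite lee_fin. Qed.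

Lemma totalD f g : (forall i, 0 <= f i) -> (forall i, 0 <= g i) ->
  total (fun i => f i + g i) = (total f + total g)%E.
Proof.
by move=> f0 g0; rewrite -esumD// => i _; rewrite lee_fin.
Qed.

Lemma rsummable_le f g : (forall i, `|f i| <= g i) -> rsummable g ->
  rsummable f.
Proof.
move=> fg; apply: le_lt_trans; apply: le_total => i.
by rewrite (le_trans (fg i))// ler_norm.
Qed.

Lemma rsummable_le_norm f g : (forall i, `|f i| <= `|g i|) -> rsummable g ->
  rsummable f.
Proof. by move=> fg; apply: le_lt_trans; exact: le_total. Qed.

Lemma ge0_rsummable g : (forall i, 0 <= g i) -> rsummable g ->
  (total g < +oo)%E.
Proof.
by move=> g0; rewrite /rsummable; under [total _]eq_esum do rewrite ger0_norm//.
Qed.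

Lemma total_fin g : (forall i, 0 <= g i) -> rsummable g ->
  (fine (total g))%:E = total g.
Proof.
move=> g0 sg; rewrite fineK// ge0_fin_numE ?total_ge0//.
exact: ge0_rsummable.
Qed.

Lemma rsummableD f g : rsummable f -> rsummable g ->
  rsummable (fun i => f i + g i).
Proof.
move=> sf sg; apply: (@rsummable_le _ (fun i => `|f i| + `|g i|)).
  by move=> i; exact: ler_normD.
rewrite /rsummable; under [total _]eq_esum do rewrite ger0_norm ?addr_ge0//.
by rewrite -/(total _) totalD// lte_add_pinfty.
Qed.

Lemma rsummable_norm f : rsummable f -> rsummable (fun i => `|f i|).
Proof. by apply: rsummable_le_norm => i; rewrite normr_id. Qed.

Lemma rsummable0 : rsummable (fun=> 0).
Proof. by rewrite /rsummable [total _]esum1 ?ltry// => i _; rewrite normr0. Qed.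

(** Any splitting into nonnegative summable parts computes [rsum]: if [f1] and [f2] are the positive
    and negative parts, then $f1 + m = f2 + p$ pointwise, and [total] is additive on nonnegative
    families. Linearity and summation by fibres rest on this, because the canonical parts are not
    additive in f. *)
Lemma rsumE f (p m : I -> R) : (forall i, f i = p i - m i) ->
  (forall i, 0 <= p i) -> (forall i, 0 <= m i) ->
  rsummable p -> rsummable m ->
  rsum f = fine (total p) - fine (total m).
Proof.
move=> fE p0 m0 sp sm.
pose f1 i := Num.max (f i) 0; pose f2 i := Num.max (- f i) 0.
have f10 i : 0 <= f1 i by rewrite /f1 le_max lexx orbT.
have f20 i : 0 <= f2 i by rewrite /f2 le_max lexx orbT.
have s1 : rsummable f1.
  apply: rsummable_le sp => i; rewrite ger0_norm// /f1 ge_max p0 andbT fE.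
  by rewrite lerBlDr lerDl.
have s2 : rsummable f2.
  apply: rsummable_le sm => i; rewrite ger0_norm// /f2 ge_max m0 andbT fE.
  by rewrite opprB lerBlDr lerDl.
have : (total (fun i => (f1 i + m i)%R) = total (fun i => (f2 i + p i)%R))%E.
  apply: eq_esum => i _; congr (_%:E).
  have -> : f1 i = f i + f2 i.
    rewrite /f1 /f2; have [h|h] := leP 0 (f i).
      by rewrite max_r ?oppr_le0// addr0.
    by rewrite max_l ?oppr_ge0 ?ltW// subrr.
  by rewrite fE; ring.
rewrite !totalD//.
rewrite -(total_fin f10 s1) -(total_fin f20 s2) -(total_fin p0 sp) -(total_fin m0 sm).
move=> -[]; rewrite /rsum -/(total f1) -/(total f2) => H.
lra.
Qed.

Definition ppart f i := Num.max (f i) 0.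
Definition npart f i := Num.max (- f i) 0.

Lemma ppart_ge0 f i : 0 <= ppart f i.
Proof. by rewrite /ppart le_max lexx orbT. Qed.
Lemma npart_ge0 f i : 0 <= npart f i.
Proof. by rewrite /npart le_max lexx orbT. Qed.
Lemma pnpartB f i : f i = ppart f i - npart f i.
Proof.
rewrite /ppart /npart; have [h|h] := leP 0 (f i).
  by rewrite max_r ?subr0// oppr_le0.
by rewrite max_l ?oppr_ge0 ?ltW// opprK add0r.
Qed.
Lemma ppart_le f i : ppart f i <= `|f i|.
Proof. by rewrite /ppart ge_max ler_norm normr_ge0. Qed.
Lemma npart_le f i : npart f i <= `|f i|.
Proof. by rewrite /npart ge_max ler_normr lexx orbT normr_ge0. Qed.

Lemma rsummable_ppart f : rsummable f -> rsummable (ppart f).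
Proof.
move=> sf; apply: rsummable_le (rsummable_norm sf) => i.
by rewrite ger0_norm ?ppart_ge0// ppart_le.
Qed.

Lemma rsummable_npart f : rsummable f -> rsummable (npart f).
Proof.
move=> sf; apply: rsummable_le (rsummable_norm sf) => i.
by rewrite ger0_norm ?npart_ge0// npart_le.
Qed.

Lemma rsumD f g : rsummable f -> rsummable g ->
  rsum (fun i => f i + g i) = rsum f + rsum g.
Proof.
move=> sf sg.
rewrite (@rsumE _ (fun i => ppart f i + ppart g i) (fun i => npart f i + npart g i)).
- rewrite !totalD//; do ?by [move=> i; exact: ppart_ge0|move=> i; exact: npart_ge0].
  rewrite !fineD; last first.
  + by rewrite -total_fin//; [exact: ppart_ge0|exact: rsummable_ppart].
  + by rewrite -total_fin//; [exact: ppart_ge0|exact: rsummable_ppart].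
  + by rewrite -total_fin//; [exact: npart_ge0|exact: rsummable_npart].
  + by rewrite -total_fin//; [exact: npart_ge0|exact: rsummable_npart].
  rewrite /rsum -/(total (ppart _)) -/(total (npart _)) -/(total (ppart _)).
  by rewrite -/(total (npart _)); ring.
- by move=> i; rewrite {1}(pnpartB f) {1}(pnpartB g); ring.
- by move=> i; rewrite addr_ge0 ?ppart_ge0.
- by move=> i; rewrite addr_ge0 ?npart_ge0.
- by apply: rsummableD; exact: rsummable_ppart.
- by apply: rsummableD; exact: rsummable_npart.
Qed.

Lemma rsumN f : rsum (fun i => - f i) = - rsum f.
Proof.
rewrite /rsum opprB; congr (_ - fine _); apply: eq_esum => i _.
by rewrite opprK.
Qed.

Lemma rsum_ge0E f : (forall i, 0 <= f i) -> rsummable f ->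
  rsum f = fine (total f).
Proof.
move=> f0 sf; rewrite (@rsumE _ f (fun=> 0))//; last exact: rsummable0.
  by rewrite [total (fun=> 0)]esum1//= subr0.
by move=> i; rewrite subr0.
Qed.

Lemma rsum_ge0 f : (forall i, 0 <= f i) -> 0 <= rsum f.
Proof.
move=> f0; rewrite /rsum [X in _ - X](_ : _ = 0) ?subr0.
  by rewrite fine_ge0//; apply: esum_ge0 => i _; rewrite lee_fin le_max lexx orbT.
by rewrite esum1// => i _; rewrite max_r// oppr_le0.
Qed.

Lemma ler_rsum f g : (forall i, f i <= g i) -> rsummable f -> rsummable g ->
  rsum f <= rsum g.
Proof.
move=> fg sf sg; rewrite -subr_ge0 -rsumN -rsumD//.
  by apply: rsum_ge0 => i; rewrite subr_ge0.
by rewrite /rsummable; under [total _]eq_esum do rewrite normrN.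
Qed.

Lemma ler_norm_rsum f g : (forall i, `|f i| <= g i) -> rsummable g ->
  `|rsum f| <= rsum g.
Proof.
move=> fg sg; have sf := rsummable_le fg sg.
rewrite ler_norml -rsumN !ler_rsum// => [i|i|].
- by have := fg i; rewrite ler_norml => /andP[].
- by have := fg i; rewrite ler_norml => /andP[].
- by rewrite /rsummable; under [total _]eq_esum do rewrite normrN.
Qed.

Lemma total_ge1 g i : (forall i, 0 <= g i) -> ((g i)%:E <= total g)%E.
Proof.
move=> g0; apply: esum_ge; exists [set i]; last by rewrite fsbig_set1.
by split => //; exact: finite_set1.
Qed.

Lemma rsum_ge1 g i : (forall i, 0 <= g i) -> rsummable g -> g i <= rsum g.
Proof.
by move=> g0 sg; rewrite rsum_ge0E// -lee_fin total_fin// total_ge1.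
Qed.

(** One inequality suffices: applied to the factor $k^{-1}$ and the family $k g$ it gives the
    reverse one. *)
Lemma totalZ (k : R) g : 0 < k -> (forall i, 0 <= g i) ->
  total (fun i => k * g i) = (k%:E * total g)%E.
Proof.
have le (h : R) f : 0 < h -> (forall i, 0 <= f i) ->
    (total (fun i => (h * f i)%R) <= h%:E * total f)%E.
  move=> h0 f0; apply: ge_ereal_sup => /= _ [A [fA _] <-].
  under eq_fsbigr do rewrite EFinM.
  rewrite -ge0_mule_fsumr; last by move=> i; rewrite lee_fin.
  rewrite lee_wpmul2l ?lee_fin; [by []|exact: ltW|].
  by apply: esum_ge; exists A.
move=> k0 g0; apply/eqP; rewrite eq_le le//=.
have := @le k^-1 (fun i => k * g i); rewrite invr_gt0 => /(_ k0).
under [total (fun i => k^-1 * _)]eq_esum do rewrite mulrA mulVf ?gt_eqF// mul1r.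
move=> /(_ (fun i => mulr_ge0 (ltW k0) (g0 i))) h.
rewrite -(@lee_pmul2l _ k^-1%:E) ?lte_fin ?invr_gt0//.
by rewrite muleA -EFinM mulVf ?gt_eqF// mul1e.
Qed.

Lemma rsummableZ (k : R) f : rsummable f -> rsummable (fun i => k * f i).
Proof.
move=> sf; apply: (@rsummable_le _ (fun i => (`|k| + 1) * `|f i|)).
  by move=> i; rewrite normrM ler_wpM2r// lerDl.
have k0 : 0 < `|k| + 1 by rewrite ltr_wpDl.
rewrite /rsummable; under [total _]eq_esum do rewrite ger0_norm ?mulr_ge0 ?(ltW k0)//.
by rewrite -/(total _) totalZ// lte_mul_pinfty// ?lee_fin ?(ltW k0).
Qed.

Lemma rsumZ (k : R) f : rsummable f -> rsum (fun i => k * f i) = k * rsum f.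
Proof.
have pos (h : R) g : 0 < h -> rsummable g -> rsum (fun i => h * g i) = h * rsum g.
  move=> h0 sg.
  rewrite (@rsumE _ (fun i => h * ppart g i) (fun i => h * npart g i)).
  - rewrite !totalZ//; [|exact: npart_ge0|exact: ppart_ge0].
    rewrite -(total_fin (@ppart_ge0 g) (rsummable_ppart sg)).
    rewrite -(total_fin (@npart_ge0 g) (rsummable_npart sg)).
    by rewrite -!EFinM /= -mulrBr.
  - by move=> i; rewrite {1}(pnpartB g) mulrBr.
  - by move=> i; rewrite mulr_ge0 ?ppart_ge0 ?ltW.
  - by move=> i; rewrite mulr_ge0 ?npart_ge0 ?ltW.
  - exact/rsummableZ/rsummable_ppart.
  - exact/rsummableZ/rsummable_npart.
move=> sf; have [k0|k0|->] := ltgtP k 0.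
- rewrite (_ : (fun i => k * f i) = (fun i => - ((- k) * f i))); last first.
    by apply/funext => i; rewrite mulNr opprK.
  by rewrite rsumN pos ?oppr_gt0// mulNr opprK.
- exact: pos.
- rewrite mul0r /rsum !esum1 ?subrr// => i _; by rewrite mul0r ?oppr0 maxxx.
Qed.

Lemma rsum_single f i : (forall j, j != i -> f j = 0) -> rsum f = f i.
Proof.
move=> f0; have tot g : (forall j, 0 <= g j) -> (forall j, j != i -> g j = 0) ->
    total g = (g i)%:E.
  move=> g0 gi; rewrite -(@esum_set1 _ _ i (fun i => (g i)%:E)) ?lee_fin//.
  rewrite /total [RHS]esum_mkcond; apply: eq_esum => j _.
  have [->|ji] := eqVneq j i; first by rewrite mem_set.
  by rewrite memNset ?gi//; exact/eqP.
rewrite /rsum -/(total (ppart _)) -/(total (npart _)) !tot /=.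
- by rewrite -pnpartB.
- exact: npart_ge0.
- by move=> j /f0 fj; rewrite /npart fj oppr0 maxxx.
- exact: ppart_ge0.
- by move=> j /f0 fj; rewrite /ppart fj maxxx.
Qed.

End RealSums.

Section RealSumsReindex.
Variables (R : realType) (I J : choiceType).

Variables (p : I -> nat) (s : nat -> seq I).
Hypotheses (s_uniq : forall n, uniq (s n))
  (mem_s : forall n i, (i \in s n) = (p i == n)).

(** [s n] lists the finite fibre of [p] over n. Later [p] is the level of a basis vector, so traces
    become series over the eigenvalues. *)
Lemma total_fiber (g : I -> R) : (forall i, 0 <= g i) ->
  total g = total (fun n => \sum_(i <- s n) g i).
Proof.
move=> g0; rewrite /total.
have -> : [set: I] = \bigcup_(k in [set: nat]) [set i | p i = k].
  by apply/seteqP; split => i // _; exists (p i).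
rewrite esum_bigcupT//; last first.
  by move=> m n _ _ [i [/= <- <-]].
apply: eq_esum => n _.
have -> : [set i | p i = n] = [set` s n].
  by apply/seteqP; split => i /=; rewrite mem_s => /eqP.
have fs : finite_set [set` s n] by exact: finite_seq.
rewrite esum_fset//; last by move=> i _; rewrite lee_fin.
by rewrite -fsbig_seq// sumEFin.
Qed.

Lemma rsummable_fiber (g : I -> R) : (forall i, 0 <= g i) ->
  rsummable (fun n => \sum_(i <- s n) g i) -> rsummable g.
Proof.
move=> g0 /ge0_rsummable; rewrite -total_fiber// /rsummable => h.
under [total _]eq_esum do rewrite ger0_norm//.
by apply: h => n; exact: sumr_ge0.
Qed.

Lemma fiber_rsummable (g : I -> R) : rsummable g ->
  rsummable (fun n => \sum_(i <- s n) `|g i|).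
Proof.
move=> sg; rewrite /rsummable; under [total _]eq_esum do rewrite ger0_norm ?sumr_ge0//.
by rewrite -/(total _) -total_fiber// => i; exact: normr_ge0.
Qed.

Lemma rsum_fiber (f : I -> R) : rsummable f ->
  rsum f = rsum (fun n => \sum_(i <- s n) f i).
Proof.
move=> sf; symmetry.
rewrite (@rsumE _ _ _ (fun n => \sum_(i <- s n) ppart f i)
                      (fun n => \sum_(i <- s n) npart f i)).
- by rewrite -!total_fiber//; [exact: npart_ge0|exact: ppart_ge0].
- by move=> n; rewrite -sumrB; apply: eq_bigr => i _; exact: pnpartB.
- by move=> n; apply: sumr_ge0 => i _; exact: ppart_ge0.
- by move=> n; apply: sumr_ge0 => i _; exact: npart_ge0.
- apply: rsummable_le (fiber_rsummable sf) => n.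
  rewrite ger0_norm ?sumr_ge0// => [|i _]; last exact: ppart_ge0.
  by apply: ler_sum => i _; exact: ppart_le.
- apply: rsummable_le (fiber_rsummable sf) => n.
  rewrite ger0_norm ?sumr_ge0// => [|i _]; last exact: npart_ge0.
  by apply: ler_sum => i _; exact: npart_le.
Qed.

End RealSumsReindex.

Section NatSums.
Variable R : realType.
Implicit Types f g : nat -> R.

Lemma ge0_series_total g : (forall n, 0 <= g n) -> rsummable g ->
  series g @ \oo --> fine (total g).
Proof.
move=> g0 sg; have ge n : (0 <= (g n)%:E)%E by rewrite lee_fin.
have := is_cvg_nneseries (fun n _ _ => ge n) : cvgn (fun n => \sum_(0 <= i < n) (g i)%:E)%E.
move/cvg_ex => [l hl]; have le : l = total g.
  by rewrite /total -nneseries_esumT// (cvg_lim _ hl).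
move: hl; rewrite le -(total_fin g0 sg) => /fine_cvgP[_].
rewrite (_ : _ \o _ = series g)//; apply/funext => n /=.
by rewrite /series /= sumEFin.
Qed.

Lemma series_rsum f : rsummable f -> series f @ \oo --> rsum f.
Proof.
move=> sf.
have -> : series f = series (ppart f) - series (npart f).
  apply/funext => n; rewrite /series /= fctE.
  by rewrite -sumrB; apply: eq_bigr => i _; exact: pnpartB.
apply: cvgB.
  by apply: ge0_series_total; [exact: ppart_ge0|exact: rsummable_ppart].
by apply: ge0_series_total; [exact: npart_ge0|exact: rsummable_npart].
Qed.

Lemma rsum_telescope f : rsummable (fun n => f n - f n.+1) ->
  f @ \oo --> 0 -> rsum (fun n => f n - f n.+1) = f 0%N.
Proof.
move=> sf f0; have := series_rsum sf.
have -> : series (fun n => f n - f n.+1) = cst (f 0%N) - f.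
  apply/funext => n; rewrite /series /= fctE /cst.
  elim: n => [|n ih]; first by rewrite big_nil subrr.
  by rewrite big_nat_recr//= ih /GRing.opp /= addrA subrK.
move=> h; have h' : cst (f 0%N) - f @ \oo --> f 0%N - 0.
  by apply: cvgB => //; exact: cvg_cst.
by rewrite subr0 in h'; exact: (cvg_unique _ h h').
Qed.

Lemma rsummable_series g M : (forall n, 0 <= g n) ->
  (forall n, series g n <= M) -> rsummable g.
Proof.
move=> g0 gM; have ge n : (0 <= (g n)%:E)%E by rewrite lee_fin.
rewrite /rsummable; under [total _]eq_esum do rewrite ger0_norm//.
rewrite -nneseries_esumT//; apply: (@le_lt_trans _ _ M%:E); last exact: ltry.
apply: lime_le; first by apply: is_cvg_nneseries => n _ _.
by near=> n; rewrite sumEFin lee_fin; exact: gM.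
Unshelve. all: by end_near. Qed.

(** The partial sums of g stay below $f(0) - f(n) \le f(0)$. This serves as an integral test. *)
Lemma rsummable_telescope f g : (forall n, 0 <= g n) -> (forall n, 0 <= f n) ->
  (forall n, g n <= f n - f n.+1) -> rsummable g.
Proof.
move=> g0 f0 gf; apply: (@rsummable_series _ (f 0%N)) => // n.
apply: (@le_trans _ _ (f 0%N - f n)); last by rewrite gerBl.
rewrite /series /=; elim: n => [|n ih]; first by rewrite big_nil subrr.
rewrite big_nat_recr//=; apply: le_trans (lerD ih (gf n)) _.
by rewrite addrA subrK.
Qed.

Lemma rsummable_geom (t : R) : 0 <= t < 1 -> rsummable (fun n => t ^+ n).
Proof.
move=> /andP[t0 t1]; apply: (@rsummable_telescope (fun n => (1 - t)^-1 * t ^+ n)) => n.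
- exact: exprn_ge0.
- by rewrite mulr_ge0 ?exprn_ge0// invr_ge0 subr_ge0 ltW.
- rewrite exprS -mulrBr -{2}[t ^+ n]mul1r -mulrBl mulrA mulVf ?mul1r//.
  by rewrite gt_eqF// subr_gt0.
Qed.

End NatSums.

(** * Complex absolute values and complex sums *)

Section ComplexNorm.
Variable R : realType.
Implicit Types z w : R[i].

Lemma normc_ge0 z : 0 <= normc z. Proof. by case: z => a b; exact: sqrtr_ge0. Qed.

Lemma normrE z : `|z| = (normc z)%:C. Proof. by case: z. Qed.

Lemma Re_le_normc z : `|Re z| <= normc z.
Proof.
case: z => a b /=; rewrite -sqrtr_sqr ler_sqrt ?addr_ge0 ?sqr_ge0//.
by rewrite lerDl sqr_ge0.
Qed.

Lemma Im_le_normc z : `|Im z| <= normc z.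
Proof.
case: z => a b /=; rewrite -sqrtr_sqr ler_sqrt ?addr_ge0 ?sqr_ge0//.
by rewrite lerDr sqr_ge0.
Qed.

Lemma normc_real (x : R) : normc x%:C = `|x|.
Proof. by rewrite /= expr0n addr0 sqrtr_sqr. Qed.

Lemma normc_le z : normc z <= `|Re z| + `|Im z|.
Proof.
case: z => a b.
have -> : a +i* b = a%:C + 'i%C * b%:C by simpc.
apply: le_trans (le_normcD _ _) _; rewrite Normc.normcM !normc_real.
rewrite (_ : normc 'i%C = 1) ?mul1r; first by simpc.
by rewrite /= expr0n add0r expr1n sqrtr1.
Qed.

Lemma normc0E : normc (0 : R[i]) = 0. Proof. exact: Normc.normc0. Qed.
Lemma normc1E : normc (1 : R[i]) = 1. Proof. exact: Normc.normc1. Qed.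

Lemma normcX z n : normc (z ^+ n) = normc z ^+ n.
Proof.
elim: n => [|n ih]; first by rewrite !expr0 normc1E.
by rewrite !exprS Normc.normcM ih.
Qed.

Lemma normc_conj z : normc z^*%C = normc z.
Proof. by case: z => a b /=; rewrite sqrrN. Qed.

Lemma normcB z w : normc (z - w) = normc (w - z).
Proof. by rewrite -normcN opprB. Qed.

Lemma le_normcB z w : normc (z - w) <= normc z + normc w.
Proof. by rewrite -(normcN w) le_normcD. Qed.

Lemma normc_sum (I : Type) (r : seq I) (F : I -> R[i]) :
  normc (\sum_(i <- r) F i) <= \sum_(i <- r) normc (F i).
Proof.
elim: r => [|i r ih]; first by rewrite !big_nil normc0E.
by rewrite !big_cons; apply: le_trans (le_normcD _ _) _; rewrite lerD2l.
Qed.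

Lemma ReM z w : Re (z * w) = Re z * Re w - Im z * Im w.
Proof. by case: z w => [? ?] [? ?]. Qed.
Lemma ImM z w : Im (z * w) = Re z * Im w + Im z * Re w.
Proof. by case: z w => [? ?] [? ?]. Qed.
Lemma ReD z w : Re (z + w) = Re z + Re w. Proof. by case: z w => [? ?] [? ?]. Qed.
Lemma ImD z w : Im (z + w) = Im z + Im w. Proof. by case: z w => [? ?] [? ?]. Qed.
Lemma ReN z : Re (- z) = - Re z. Proof. by case: z. Qed.
Lemma ImN z : Im (- z) = - Im z. Proof. by case: z. Qed.

End ComplexNorm.

Section ComplexSums.
Variables (R : realType) (I : choiceType).
Implicit Types f g : I -> R[i].

Lemma csummable_Re f : csummable f -> rsummable (fun i => Re (f i)).
Proof. by apply: rsummable_le => i; exact: Re_le_normc. Qed.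

Lemma csummable_Im f : csummable f -> rsummable (fun i => Im (f i)).
Proof. by apply: rsummable_le => i; exact: Im_le_normc. Qed.

Lemma csummable_le f (g : I -> R) : (forall i, normc (f i) <= g i) ->
  rsummable g -> csummable f.
Proof.
by move=> fg; apply: rsummable_le => i; rewrite ger0_norm ?normc_ge0.
Qed.

Lemma csummableD f g : csummable f -> csummable g ->
  csummable (fun i => f i + g i).
Proof.
move=> sf sg; apply: csummable_le (rsummableD sf sg) => i.
exact: le_normcD.
Qed.

Lemma csummableZ (c : R[i]) f : csummable f -> csummable (fun i => c * f i).
Proof.
move=> sf; apply: csummable_le (rsummableZ (normc c) sf) => i.
by rewrite Normc.normcM.
Qed.

Lemma csumD f g : csummable f -> csummable g ->
  csum (fun i => f i + g i) = csum f + csum g.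
Proof.
move=> sf sg; rewrite /csum.
under [X in rsum X +i* _]funext do rewrite ReD.
under [X in _ +i* rsum X]funext do rewrite ImD.
by rewrite !rsumD//; (exact: csummable_Re || exact: csummable_Im).
Qed.

Lemma csumZ (c : R[i]) f : csummable f -> csum (fun i => c * f i) = c * csum f.
Proof.
move=> sf; have sr := csummable_Re sf; have si := csummable_Im sf.
rewrite /csum; case: c => a b.
under [X in rsum X +i* _]funext do rewrite ReM /= -mulNr.
under [X in _ +i* rsum X]funext do rewrite ImM /=.
by rewrite !rsumD ?rsumZ//; (try exact: rsummableZ); rewrite mulNr.
Qed.

Lemma csumN f : csummable f -> csum (fun i => - f i) = - csum f.
Proof.
move=> sf; rewrite -mulN1r -csumZ//.
by congr csum; apply/funext => i; rewrite mulN1r.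
Qed.

Lemma csumB f g : csummable f -> csummable g ->
  csum (fun i => f i - g i) = csum f - csum g.
Proof.
move=> sf sg; rewrite csumD ?csumN//.
by apply: csummable_le sg => i; rewrite normcN.
Qed.

Lemma csum0 : csum (fun _ : I => 0 : R[i]) = 0.
Proof.
by rewrite /csum /rsum !esum1 ?subrr//= => i _; rewrite ?oppr0 maxxx.
Qed.

Lemma csummable0 : csummable (fun _ : I => 0 : R[i]).
Proof. by apply: csummable_le (@rsummable0 R I) => i; rewrite normc0E. Qed.

Lemma normc_csum f (g : I -> R) : (forall i, normc (f i) <= g i) ->
  rsummable g -> normc (csum f) <= 2 * rsum g.
Proof.
move=> fg sg; apply: le_trans (normc_le _) _.
by rewrite mulr_natl mulr2n lerD//= ler_norm_rsum// => i;
  rewrite (le_trans _ (fg i))// ?Re_le_normc ?Im_le_normc.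
Qed.

Lemma csum_single f i : (forall j, j != i -> f j = 0) -> csum f = f i.
Proof.
move=> f0; rewrite /csum (@rsum_single _ _ _ i); last by move=> j /f0 ->.
rewrite (@rsum_single _ _ _ i); last by move=> j /f0 ->.
by case: (f i).
Qed.

Lemma csum_fiber (p : I -> nat) (s : nat -> seq I) f :
  (forall n, uniq (s n)) -> (forall n i, (i \in s n) = (p i == n)) ->
  csummable f -> csum f = csum (fun n => \sum_(i <- s n) f i).
Proof.
move=> us ms sf; rewrite /csum; congr (_ +i* _).
  rewrite (rsum_fiber us ms); last exact: csummable_Re.
  by congr rsum; apply/funext => n; rewrite (raddf_sum (@Re R : Rcomplex R -> R)).
rewrite (rsum_fiber us ms); last exact: csummable_Im.
by congr rsum; apply/funext => n; rewrite (raddf_sum (@Im R : Rcomplex R -> R)).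
Qed.

End ComplexSums.

Lemma csum_telescope (R : realType) (f : nat -> R[i]) :
  csummable (fun n => f n - f n.+1) -> (fun n => normc (f n)) @ \oo --> (0 : R) ->
  csum (fun n => f n - f n.+1) = f 0%N.
Proof.
move=> sf f0; rewrite /csum.
have sr := csummable_Re sf; have si := csummable_Im sf.
under [X in rsum X +i* _]funext do rewrite ReD ReN.
under [X in _ +i* rsum X]funext do rewrite ImD ImN.
have N0 (g : nat -> R) : (forall n, `|g n| <= normc (f n)) -> g @ \oo --> 0.
  move=> gf; apply/norm_cvg0P; apply: squeeze_cvgr f0; last exact: cvg_cst.
  by near=> n; rewrite normr_ge0 /= gf.
rewrite !rsum_telescope.
- by case: (f 0%N).
- by under eq_fun do rewrite -ImN -ImD.
- by apply: N0 => n; exact: Im_le_normc.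
- by under eq_fun do rewrite -ReN -ReD.
- by apply: N0 => n; exact: Re_le_normc.
Unshelve. all: by end_near. Qed.

Ltac nonneg := repeat lazymatch goal with
  | |- is_true (0 <= GRing.mul _ _)%R => apply: mulr_ge0
  | |- is_true (0 <= GRing.add _ _)%R => apply: addr_ge0
  | |- is_true (0 <= GRing.exp _ 2)%R => exact: sqr_ge0
  | |- is_true (0 <= GRing.exp _ _)%R => apply: exprn_ge0
  | |- is_true (0 <= GRing.natmul 1 _)%R => exact: ler0n
  | |- is_true (0 <= GRing.inv _)%R => rewrite invr_ge0
  | |- is_true (0 <= expR _)%R => exact: expR_ge0
  | |- is_true (0 <= Num.sqrt _)%R => exact: sqrtr_ge0
  | |- is_true (0 <= Num.norm _)%R => exact: Num.Theory.normr_ge0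
  | |- is_true (0 <= Normc.normc _)%R => exact: normc_ge0
  | |- _ => first [assumption | done]
  end.

(** * Holomorphic functions and the complex exponential *)

Section ComplexNeighbourhoods.
Variable R : realType.
Implicit Types (P : R[i] -> Prop) (z s : R[i]).

Lemma nearcP P s : (\forall z \near (s : R[i]^o), P z) <->
  exists2 r : R, 0 < r & forall z, normc (z - s) < r -> P z.
Proof.
split.
  move=> /nbhs_normP[e /= e0 eP].
  move: (e0); rewrite ltcE /= => /andP[/eqP ie re].
  exists (Re e) => // z zs; apply: eP => /=.
  by rewrite normrE normcB ltcE /= ie eqxx.
move=> [r r0 rP]; apply/nbhs_normP; exists r%:C => /=; first by rewrite ltcR.
by move=> z /=; rewrite normrE ltcR normcB => /rP.
Qed.

Lemma dnearcP P s : (\forall z \near (s : R[i]^o)^', P z) <->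
  exists2 r : R, 0 < r & forall z, normc (z - s) < r -> z != s -> P z.
Proof.
split; first by move=> /nearcP.
by move=> h; apply/nearcP.
Qed.

End ComplexNeighbourhoods.

Section NumFieldDerivative.
Variable K : numFieldType.
Implicit Types f g : K^o -> K^o.

Lemma derivable_add f g (z : K^o) : derivable f z 1 -> derivable g z 1 ->
  derivable (fun z => f z + g z : K^o) z 1.
Proof. exact: derivableD. Qed.

Lemma derivable_mul f g (z : K^o) : derivable f z 1 -> derivable g z 1 ->
  derivable (fun z => (f z : K) * g z : K^o) z 1.
Proof. exact: derivableM. Qed.

Lemma derivable_subc (c z : K^o) : derivable (fun z => z - c : K^o) z 1.
Proof. exact: (derivableB (f := id) (g := cst c)). Qed.

Lemma derivable_inv f (z : K^o) : f z != 0 -> derivable f z 1 ->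
  derivable (fun z => (f z : K)^-1 : K^o) z 1.
Proof. exact: derivableV. Qed.

End NumFieldDerivative.

Section ComplexDerivative.
Variable R : realType.
Implicit Types (f g : R[i] -> R[i]) (z s : R[i]).

(** In this form, a quadratic bound on the remainder of the affine approximation, differentiability
    passes to series by summing the bounds. *)
Lemma derivable_quad f z d (M r : R) : 0 < r ->
  (forall h, normc h < r -> normc (f (z + h) - f z - h * d) <= M * normc h ^+ 2) ->
  derivable (f : R[i]^o -> R[i]^o) (z : R[i]^o) 1.
Proof.
move=> r0 fM; apply/cvg_ex; exists d; apply/cvgrPdist_le => /= e e0.
have [e' e'0 ->] : exists2 e', 0 < e' & e = e'%:C.
  exists (Re e); last by rewrite RRe_real// gtr0_real.
  by move: e0; rewrite ltcE /= => /andP[].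
have k0 : 0 < `|M| + 1 by rewrite ltr_wpDl.
apply/dnearcP; exists (Num.min r (e' / (`|M| + 1))).
  by rewrite lt_min r0 divr_gt0.
move=> h; rewrite subr0 lt_min => /andP[hr he] h0.
rewrite normrE lecR /= /GRing.scale /= mulr1.
have n0 : 0 < normc h.
  by rewrite lt0r normc_ge0 andbT; apply: contra_neq h0 => /Normc.eq0_normc.
have -> : d - h^-1 * (f (h + z) - f z) = - h^-1 * (f (z + h) - f z - h * d).
  rewrite [in RHS]mulrBr mulrA [- h^-1 * h]mulNr mulVf// mulN1r opprK mulNr.
  by rewrite addrC [z + h]addrC.
rewrite Normc.normcM normcN Normc.normcV mulrC ler_pdivrMr//.
apply: le_trans (fM _ hr) _; rewrite expr2 mulrA ler_wpM2r ?normc_ge0//.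
apply: (@le_trans _ _ ((`|M| + 1) * normc h)).
  by rewrite ler_wpM2r ?normc_ge0// (le_trans (ler_norm _))// lerDl.
by rewrite mulrC -ler_pdivlMr// ltW.
Qed.

Lemma derivable_cont f z :
  derivable (f : R[i]^o -> R[i]^o) (z : R[i]^o) 1 ->
  exists2 r : R, 0 < r & forall w, normc (w - z) < r -> normc (f w) <= normc (f z) + 1.
Proof.
move=> /derivable1_diffP /differentiable_continuous /cvgrPdist_lt /(_ 1 ltr01).
move=> /nearcP[r r0 rP]; exists r => // w /rP.
rewrite normrE ltcR normcB => h; rewrite -lerBlDl.
apply: le_trans (ltW h); rewrite lerBlDr.
by rewrite -{1}(subrK (f z) (f w)) le_normcD.
Qed.

Lemma derivable_near0 f z (e : R) : 0 < e ->
  derivable (f : R[i]^o -> R[i]^o) (z : R[i]^o) 1 ->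
  exists2 r : R, 0 < r & forall w, normc (w - z) < r -> normc (f w - f z) < e.
Proof.
move=> e0 /derivable1_diffP /differentiable_continuous /cvgrPdist_lt /(_ e%:C).
rewrite ltcR => /(_ e0) /nearcP[r r0 rP]; exists r => // w /rP.
by rewrite normrE ltcR normcB.
Qed.

Lemma holomorphicP f s : holomorphic_at f s <-> exists2 r : R, 0 < r &
  forall z, normc (z - s) < r -> derivable (f : R[i]^o -> R[i]^o) (z : R[i]^o) 1.
Proof. exact: nearcP. Qed.

Lemma holo_cst c s : holomorphic_at (fun=> c) s.
Proof. by apply/holomorphicP; exists 1 => // z _; exact: derivable_cst. Qed.

Lemma holo_sub c s : holomorphic_at (fun z => z - c) s.
Proof.
apply/holomorphicP; exists 1 => // z _; exact: (@derivable_subc R[i] c).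
Qed.

Lemma holoD f g s : holomorphic_at f s -> holomorphic_at g s ->
  holomorphic_at (fun z => f z + g z) s.
Proof.
move=> /holomorphicP[r r0 hf] /holomorphicP[t t0 hg]; apply/holomorphicP.
exists (Num.min r t) => [|z]; first by rewrite lt_min r0.
rewrite lt_min => /andP[zr zt].
have fz := hf _ zr; have gz := hg _ zt.
exact (@derivable_add R[i] f g z fz gz).
Qed.

Lemma holoM f g s : holomorphic_at f s -> holomorphic_at g s ->
  holomorphic_at (fun z => f z * g z) s.
Proof.
move=> /holomorphicP[r r0 hf] /holomorphicP[t t0 hg]; apply/holomorphicP.
exists (Num.min r t) => [|z]; first by rewrite lt_min r0.
rewrite lt_min => /andP[zr zt].
exact (@derivable_mul R[i] f g z (hf _ zr) (hg _ zt)).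
Qed.

Lemma holo_div f c s : s != c -> holomorphic_at f s ->
  holomorphic_at (fun z => f z / (z - c)) s.
Proof.
move=> sc hf; apply (@holoM f (fun z => (z - c)^-1) s hf).
apply/holomorphicP; exists (normc (s - c)).
  rewrite lt0r normc_ge0 andbT; apply: contra_neq sc => /Normc.eq0_normc /eqP.
  by rewrite subr_eq0 => /eqP.
move=> z zs; apply: (@derivable_inv R[i] (fun z => z - c)).
  by rewrite subr_eq0; apply: contraTneq zs => ->; rewrite normcB ltxx.
exact: (@derivable_subc R[i] c).
Qed.

(** If f is bounded near s and $f = g/(z-s)^n$ with $n > 0$, then $g = f (z-s)^n$ is small near s,
    against $g(s) \ne 0$ and the continuity of g. *)
Lemma holo_not_pole f s : holomorphic_at f s -> ~ is_pole f s.
Proof.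
move=> /holomorphicP[r1 r10 hf] [n n0 [g [/holomorphicP[r2 r20 hg] gs /dnearcP[r r0 fg]]]].
have ss (r' : R) : 0 < r' -> normc (s - s) < r' by rewrite subrr normc0E.
have [r3 r30 b3] := derivable_cont (hf s (ss _ r10)).
have h0 : 0 < normc (g s).
  by rewrite lt0r normc_ge0 andbT; apply: contra_neq gs => /Normc.eq0_normc.
have h20 : 0 < normc (g s) / 2 by rewrite divr_gt0.
have [r4 r40 b4] := derivable_near0 h20 (hg s (ss _ r20)).
pose K := normc (f s) + 1.
have K0 : 0 < K by rewrite ltr_wpDl ?normc_ge0.
(* Below all the radii, below 1 so that $t^n \le t$, and such that $K t < |g(s)|/2$. At $z = s + t$
   this contradicts $|g(z) - g(s)| < |g(s)|/2$. *)
pose t := Num.min (Num.min r r3) (Num.min r4 (Num.min 1 (normc (g s) / 2 / K))) / 2.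
have t0 : 0 < t by rewrite /t divr_gt0// !lt_min r0 r30 r40 ltr01 divr_gt0.
have lt2 (x : R) : 0 < x -> x / 2 < x by move=> x0; lra.
have tm : t < Num.min (Num.min r r3) (Num.min r4 (Num.min 1 (normc (g s) / 2 / K))).
  by apply: lt2; rewrite !lt_min r0 r30 r40 ltr01 divr_gt0.
move: tm; rewrite !lt_min => /andP[/andP[tr t3] /and3P[t4 t1 tK]].
pose z := s + t%:C.
have zs : z - s = t%:C by rewrite /z addrC addKr.
have nzs : normc (z - s) = t by rewrite zs normc_real gtr0_norm.
have zns : z != s.
  by rewrite -subr_eq0 zs; apply: contraTneq t0 => -[->]; rewrite ltxx.
have := fg z; rewrite nzs => /(_ tr zns) fz.
have gz : g z = f z * (z - s) ^+ n.
  by rewrite fz mulfVK// expf_neq0// subr_eq0.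
have := b3 z; rewrite nzs => /(_ t3) fK.
have := b4 z; rewrite nzs => /(_ t4) gg.
have : normc (g z) <= K * t.
  rewrite gz Normc.normcM normcX nzs; apply: ler_pM => //.
  - exact: normc_ge0.
  - by rewrite exprn_ge0// ltW.
  - by rewrite -[leRHS]expr1 ler_wiXn2l// ltW.
have : normc (g s) <= normc (g z) + normc (g z - g s).
  by rewrite normcB -{1}(subrK (g z) (g s)) addrC le_normcD.
move: tK; rewrite ltr_pdivlMr//; rewrite mulrC.
by move=> a b c; lra.
Qed.

End ComplexDerivative.

Section ComplexExp.
Variable R : realType.
Implicit Types (z w : R[i]).

Definition cexp z : R[i] :=
  (expR (Re z) * cos (Im z)) +i* (expR (Re z) * sin (Im z)).

Lemma cpowE (x : R) z : cpow x z = cexp (z * (ln x)%:C).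
Proof. by case: z => a b; rewrite /cpow /cexp /= !mulr0 subr0 add0r. Qed.

Lemma cexpD z w : cexp (z + w) = cexp z * cexp w.
Proof.
case: z w => [a b] [c d]; rewrite /cexp /= expRD cosD sinD.
by apply/eqP; rewrite eq_complex /=; apply/andP; split; apply/eqP; ring.
Qed.

Lemma cexp0 : cexp 0 = 1.
Proof. by rewrite /cexp /= expR0 cos0 sin0 mulr1 mulr0. Qed.

Lemma normc_cexp z : normc (cexp z) = expR (Re z).
Proof.
case: z => a b; rewrite /cexp /= !exprMn -mulrDr cos2Dsin2 mulr1.
by rewrite sqrtr_sqr ger0_norm ?expR_ge0.
Qed.

Lemma is_derive_ext (f g : R -> R) (t a b : R) : is_derive t 1 f a ->
  (forall x, f x = g x) -> a = b -> is_derive t 1 g b.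
Proof. by move=> h /funext <- <-. Qed.

Definition cder (f f' : R -> R[i]) := forall t : R,
  is_derive t 1 (fun t => Re (f t)) (Re (f' t)) /\
  is_derive t 1 (fun t => Im (f t)) (Im (f' t)).

(** The mean value theorem is applied to the real and the imaginary part separately, at the cost of
    the factor 2. *)
Lemma cder_mvt (f f' : R -> R[i]) (M : R) : cder f f' ->
  (forall t, 0 <= t <= 1 -> normc (f' t) <= M) ->
  normc (f 1 - f 0) <= 2 * M.
Proof.
move=> ff' fM.
have mvt (g g' : R -> R) : (forall t : R, is_derive t 1 g (g' t)) ->
    (forall t, 0 <= t <= 1 -> `|g' t| <= M) -> `|g 1 - g 0| <= M.
  move=> gg' gM.
  have cg : {within `[0, 1], continuous g}.
    by apply: derivable_within_continuous => x _; have [] := gg' x.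
  have [c c01 ->] := @MVT R g g' 0 1 ltr01 (fun x _ => gg' x) cg.
  rewrite subr0 mulr1 gM//.
  by move: c01; rewrite in_itv /= => /andP[/ltW -> /ltW ->].
apply: le_trans (normc_le _) _; rewrite mulr_natl mulr2n lerD//.
- rewrite ReD ReN; apply: (mvt (fun t => Re (f t)) (fun t => Re (f' t))) => [t|t t01].
    by have [] := ff' t.
  have h := fM _ t01.
  exact: le_trans (Re_le_normc _) h.
- rewrite ImD ImN; apply: (mvt (fun t => Im (f t)) (fun t => Im (f' t))) => [t|t t01].
    by have [] := ff' t.
  have h := fM _ t01.
  exact: le_trans (Im_le_normc _) h.
Qed.

Lemma cderD f f' g g' : cder f f' -> cder g g' ->
  cder (fun t => f t + g t) (fun t => f' t + g' t).
Proof.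
move=> hf hg t; have [f1 f2] := hf t; have [g1 g2] := hg t.
split.
  by apply: (is_derive_ext (is_deriveD f1 g1)) => [x|]; rewrite ReD.
by apply: (is_derive_ext (is_deriveD f2 g2)) => [x|]; rewrite ImD.
Qed.

Lemma cder_cst c : cder (fun=> c) (fun=> 0).
Proof. by move=> t; split; exact: is_derive_cst. Qed.

Lemma cder_pow z n : cder (fun t => (t ^+ n)%:C * z)
  (fun t => (n%:R * t ^+ n.-1)%:C * z).
Proof.
have h (t u : R) : is_derive t 1 (fun t : R => t ^+ n * u) (n%:R * t ^+ n.-1 * u).
  have H := is_deriveX n (is_derive_id t (1 : R)).
  apply: (is_derive_ext (is_deriveM H (is_derive_cst u t (1:R)))).
    by move=> x; rewrite exprfctE.
  by rewrite /GRing.scale /= mulr0 add0r mulr1 -mulr_natl mulrC.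
case: z => a b t; split.
  by apply: (is_derive_ext (h t a)) => [x|]; rewrite ReM /= mul0r subr0.
by apply: (is_derive_ext (h t b)) => [x|]; rewrite ImM /= mul0r addr0.
Qed.

Lemma cder_cexp z : cder (fun t => cexp (t%:C * z)) (fun t => z * cexp (t%:C * z)).
Proof.
case: z => a b t.
have E1 (u : R) : is_derive t 1 (fun t : R => t * u) u.
  apply: (is_derive_ext (is_deriveM (is_derive_id t (1:R)) (is_derive_cst u t (1:R)))) => //.
  by rewrite /GRing.scale /= mulr0 add0r mulr1.
have E (u : R) : is_derive t 1 (fun t : R => expR (t * u)) (u * expR (t * u)).
  have H := @is_derive1_comp R expR (fun t : R => t * u) t _ _ (is_derive_expR (t * u)) (E1 u).
  by move: H; rewrite mulrC.
have C (u : R) : is_derive t 1 (fun t : R => cos (t * u)) (- u * sin (t * u)).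
  have H := @is_derive1_comp R cos (fun t : R => t * u) t _ _ (is_derive_cos (t * u)) (E1 u).
  by move: H; rewrite mulrC mulrN -mulNr.
have S (u : R) : is_derive t 1 (fun t : R => sin (t * u)) (u * cos (t * u)).
  have H := @is_derive1_comp R sin (fun t : R => t * u) t _ _ (is_derive_sin (t * u)) (E1 u).
  by move: H; rewrite mulrC.
split.
  apply: (is_derive_ext (is_deriveM (E a) (C b))) => [x|].
    by rewrite /cexp /= !mul0r subr0 addr0.
  by rewrite /cexp /= /GRing.scale /= !mul0r subr0 addr0; ring.
apply: (is_derive_ext (is_deriveM (E a) (S b))) => [x|].
  by rewrite /cexp /= !mul0r subr0 addr0.
by rewrite /cexp /= /GRing.scale /= !mul0r subr0 addr0; ring.
Qed.

(** The remainders of the exponential series after one, two and three terms. The derivative of $t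
    \mapsto th_{i+1}(tz)$ is $z \, th_i(tz)$, so each bound below follows from the previous one,
    with twice its constant. *)
Definition th1 z := cexp z - 1.
Definition th2 z := cexp z - 1 - z.
Definition th3 z := cexp z - 1 - z - z ^+ 2 / 2.

Lemma Re_le_scale t z : 0 <= t <= 1 -> expR (Re (t%:C * z)) <= expR (normc z).
Proof.
move=> /andP[t0 t1]; rewrite ler_expR ReM /= mul0r subr0.
have := Re_le_normc z; rewrite ler_norml => /andP[_ h].
have := normc_ge0 z => n0; nra.
Qed.

Lemma normc_scale_le t z : 0 <= t <= 1 -> normc (t%:C * z) <= normc z.
Proof.
move=> /andP[t0 t1]; rewrite Normc.normcM normc_real ger0_norm//.
by rewrite ler_piMl ?normc_ge0.
Qed.

Lemma th1_le z : normc (th1 z) <= 2 * normc z * expR (normc z).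
Proof.
have := @cder_mvt _ _ (normc z * expR (normc z)) (cder_cexp z).
rewrite mul1r mul0r cexp0 mulrA; apply=> t t01.
rewrite Normc.normcM normc_cexp ler_wpM2l ?normc_ge0//.
exact: Re_le_scale.
Qed.

Lemma th2_le z : normc (th2 z) <= 4 * normc z ^+ 2 * expR (normc z).
Proof.
have D := cderD (cderD (cder_cexp z) (cder_cst (-1))) (cder_pow (- z) 1).
have := @cder_mvt _ _ (normc z * (2 * normc z * expR (normc z))) D.
rewrite expr1 expr1 !mul1r !mul0r cexp0 subrr addr0 subr0.
have -> : 4 * normc z ^+ 2 * expR (normc z) =
  2 * (normc z * (2 * normc z * expR (normc z))) by ring.
apply=> t t01 /=; rewrite expr0 mulr1 mul1r addr0.
rewrite (_ : _ - z = z * th1 (t%:C * z)); last by rewrite /th1; ring.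
rewrite Normc.normcM ler_wpM2l ?normc_ge0//; apply: le_trans (th1_le _) _.
apply: ler_pM; rewrite ?expR_ge0 ?mulr_ge0 ?normc_ge0//.
  by rewrite ler_wpM2l// normc_scale_le.
by rewrite ler_expR normc_scale_le.
Qed.

Lemma th3_le z : normc (th3 z) <= 8 * normc z ^+ 3 * expR (normc z).
Proof.
have D := cderD (cderD (cderD (cder_cexp z) (cder_cst (-1))) (cder_pow (- z) 1))
  (cder_pow (- (z ^+ 2 / 2)) 2).
have := @cder_mvt _ _ (normc z * (4 * normc z ^+ 2 * expR (normc z))) D.
rewrite !expr1n expr1 expr0n /= !mul1r !mul0r cexp0 subrr !addr0 subr0.
have -> : 8 * normc z ^+ 3 * expR (normc z) =
  2 * (normc z * (4 * normc z ^+ 2 * expR (normc z))) by ring.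
apply=> t t01 /=; rewrite expr0 expr1 mulr1 mul1r addr0.
rewrite (_ : _ + _ = z * th2 (t%:C * z)); last first.
  rewrite /th2 rmorphM /= (_ : (2:R)%:C = 2 :> R[i]); first by field.
  by rewrite rmorph_nat.
rewrite Normc.normcM ler_wpM2l ?normc_ge0//; apply: le_trans (th2_le _) _.
apply: ler_pM.
- by rewrite mulr_ge0// sqr_ge0.
- exact: expR_ge0.
- by rewrite ler_pM2l// !expr2 ler_pM ?normc_ge0 ?normc_scale_le.
- by rewrite ler_expR normc_scale_le.
Qed.

(** The right side is of order at least two in h: [th3] is differentiable with derivative [th2],
    with an explicit remainder. *)
Lemma th3D z h : th3 (z + h) - th3 z - h * th2 z = th1 z * th2 h + th3 h.
Proof. by rewrite /th3 /th2 /th1 cexpD; field. Qed.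

End ComplexExp.

(** * The series of n^-s near its pole *)

Section LogBounds.
Variable R : realType.
Implicit Types t x : R.

Lemma ln_ge1 x : 0 < x -> 1 - x^-1 <= ln x.
Proof.
move=> x0; have := @le_ln1Dx R (x^-1 - 1); rewrite subrKC lnV ?posrE//.
have : 0 < x^-1 by rewrite invr_gt0.
by move=> ? h; have := h _; lra.
Qed.

Lemma ln_le_sub1 x : 0 < x -> ln x <= x - 1.
Proof.
move=> x0; have := @le_ln1Dx R (x - 1); rewrite subrKC.
by move=> h; apply: h; lra.
Qed.

(** For $t = 1/(2N)$ these are $\ln((N+1/2)/N)$ and $\ln(N/(N-1/2))$, both positive and close to
    t. *)
Definition lnp t := ln (1 + t).
Definition lnm t := - ln (1 - t).

Lemma lnp_bounds t : 0 < t <= 1 / 4 -> 0 <= lnp t <= t.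
Proof.
move=> /andP[t0 t1]; rewrite /lnp ln_ge0 /=; last by lra.
by have := @ln_le_sub1 (1 + t); lra.
Qed.

Lemma lnm_bounds t : 0 < t <= 1 / 4 -> 0 <= lnm t <= 2 * t.
Proof.
move=> /andP[t0 t1]; rewrite /lnm oppr_ge0 ln_le0 /=; last by lra.
have := @ln_ge1 (1 - t) ltac:(lra).
have : (1 - t)^-1 <= 1 + 2 * t.
  by rewrite -div1r ler_pdivrMr; nra.
by lra.
Qed.

(** The difference of squares factors: [lnp t - lnm t] is $\ln(1-t^2)$, of order $t^2$, and the sum
    is at most $3t$. *)
Lemma lnpm_sqr t : 0 < t <= 1 / 4 -> `|lnp t ^+ 2 - lnm t ^+ 2| <= 6 * t ^+ 3.
Proof.
move=> tt; have /andP[a0 a1] := lnp_bounds tt; have /andP[b0 b1] := lnm_bounds tt.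
move: tt => /andP[t0 t1].
have E : lnp t - lnm t = ln (1 - t ^+ 2).
  rewrite /lnp /lnm opprK -lnM ?posrE; [|lra|lra].
  by congr ln; ring.
have t2 : 0 < 1 - t ^+ 2 by nra.
have h1 : ln (1 - t ^+ 2) <= 0 by rewrite ln_le0//; nra.
have h2 : - (2 * t ^+ 2) <= ln (1 - t ^+ 2).
  apply: le_trans (ln_ge1 t2).
  have : (1 - t ^+ 2)^-1 <= 1 + 2 * t ^+ 2.
    have x0 := sqr_ge0 t; have x1 : t ^+ 2 <= 1 / 4 by nra.
    rewrite -div1r ler_pdivrMr//; move: (t ^+ 2) x0 x1 => x x0 x1; nra.
  by lra.
rewrite subr_sqr normrM E ler0_norm// ger0_norm ?addr_ge0//.
have -> : 6 * t ^+ 3 = (2 * t ^+ 2) * (3 * t) by ring.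
apply: ler_pM.
- by rewrite oppr_ge0.
- by rewrite addr_ge0.
- by rewrite lerNl.
- by rewrite (_ : 3 * t = t + 2 * t) ?lerD//; ring.
Qed.

(** The sum is $\ln((1+t)/(1-t))$, odd in t, so it has no quadratic term. The derivative of its
    difference from $2t$ is $2t^2/(1-t^2)$, to which the mean value theorem is applied. *)
Lemma lnpm_sum t : 0 < t <= 1 / 4 -> `|lnp t + lnm t - 2 * t| <= 4 * t ^+ 3.
Proof.
move=> /andP[t0 t1].
pose f x : R := ln (1 + x) - ln (1 - x) - 2 * x.
pose df x : R := 2 * x ^+ 2 / (1 - x ^+ 2).
have D x : 0 <= x <= t -> is_derive x 1 f (df x).
  move=> /andP[x0 xt].
  have a1 : 0 < 1 + x by lra.
  have a2 : 0 < 1 - x by lra.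
  have A1 : is_derive x 1 (fun y : R => 1 + y) (0 + 1).
    exact: (is_deriveD (is_derive_cst (1:R) x (1:R)) (is_derive_id x (1:R))).
  have A2 : is_derive x 1 (fun y : R => 1 - y) (0 - 1).
    exact: (is_deriveB (is_derive_cst (1:R) x (1:R)) (is_derive_id x (1:R))).
  have B1 := @is_derive1_comp R (@ln R) (fun y : R => 1 + y) x _ _ (is_derive1_ln a1) A1.
  have B2 := @is_derive1_comp R (@ln R) (fun y : R => 1 - y) x _ _ (is_derive1_ln a2) A2.
  have C := is_deriveM (is_derive_cst (2:R) x (1:R)) (is_derive_id x (1:R)).
  apply: (is_derive_ext (is_deriveB (is_deriveB B1 B2) C)) => //.
  rewrite /df /GRing.scale /=; field.
  by rewrite !gt_eqF//; nra.
have D' x : x \in `]0, t[ -> is_derive x 1 f (df x).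
  by rewrite in_itv /= => /andP[x0 xt]; apply: D; rewrite (ltW x0) (ltW xt).
have cf : {within `[0, t], continuous f}.
  apply: derivable_within_continuous => x; rewrite in_itv /= => x0t.
  by have [] := D x x0t.
have [c c01] := @MVT R f df 0 t t0 D' cf.
rewrite {2}/f addr0 subr0 ln1 mulr0 !subr0 => fE.
have -> : lnp t + lnm t - 2 * t = f t by rewrite /f /lnp /lnm.
rewrite fE; move: c01; rewrite in_itv /= => /andP[c0 ct].
have d0 : 0 < 1 - c ^+ 2 by nra.
have : 0 <= df c <= 4 * t ^+ 2.
  rewrite /df divr_ge0 ?mulr_ge0 ?sqr_ge0 ?(ltW d0) ?(ltW c0)//=.
  have X0 := sqr_ge0 c; have XY : c ^+ 2 <= t ^+ 2 by nra.
  have Y1 : t ^+ 2 <= 1 / 4 by nra.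
  rewrite ler_pdivrMr//; move: (c ^+ 2) (t ^+ 2) X0 XY Y1 => X Y X0 XY Y1; nra.
move=> /andP[e0 e1]; rewrite (ger0_norm (mulr_ge0 e0 (ltW t0))).
have -> : 4 * t ^+ 3 = 4 * t ^+ 2 * t by ring.
by rewrite ler_wpM2r// ltW.
Qed.

End LogBounds.

Section DirichletSeries.
Variable R : realType.
Implicit Types (n : nat) (w h z : R[i]) (e d : R).

(* N = n + 2 is the eigenvalue of |D| with index n. *)
Definition lnN n : R := ln (n%:R + 2).

Lemma natD2_gt0 n : 0 < n%:R + 2 :> R.
Proof. by rewrite ltr_wpDl. Qed.

Lemma expR_lnN n : expR (lnN n) = n%:R + 2.
Proof. by rewrite /lnN lnK// posrE natD2_gt0. Qed.

Lemma lnN_ge0 n : 0 <= lnN n.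
Proof. by rewrite /lnN ln_ge0//; have := ler0n R n; lra. Qed.

Lemma lnN_le e n : 0 < e -> lnN n <= e^-1 * expR (e * lnN n).
Proof.
move=> e0; rewrite ler_pdivlMl//.
by apply: le_trans (expR_ge1Dx _); rewrite lerDr.
Qed.

Lemma lnN1_le e n : 0 < e -> 1 + lnN n <= (1 + e^-1) * expR (e * lnN n).
Proof.
move=> e0; rewrite mulrDl mul1r lerD ?lnN_le//.
by rewrite -expR0 ler_expR mulr_ge0 ?lnN_ge0// ltW.
Qed.

(** A discrete form of $\int x^{-1-e} dx = -x^{-e}/e$: the term $N^{-1-e}$ is at most
    $e^{-1}((N-1)^{-e} - N^{-e})$, by $\ln y \le y - 1$ and $1 + y \le \exp y$. *)
Lemma rsummable_expN e : 0 < e -> rsummable (fun n => expR (- (1 + e) * lnN n)).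
Proof.
move=> e0; pose f n := e^-1 * expR (- e * ln (n%:R + 1)).
apply: (@rsummable_telescope _ f) => n; first exact: expR_ge0.
  by rewrite /f mulr_ge0 ?expR_ge0// invr_ge0 ltW.
rewrite /f; have -> : n.+1%:R + 1 = n%:R + 2 :> R by rewrite -natr1 -addrA.
rewrite -/(lnN n) -mulrBr ler_pdivlMl//.
have -> : - (1 + e) * lnN n = - e * lnN n + - lnN n by ring.
rewrite expRD expRN expR_lnN.
pose N : R := n%:R + 2; have N0 : 0 < N := natD2_gt0 n.
have N1 : 0 < n%:R + 1 :> R by rewrite ltr_wpDl.
have -> : expR (- e * ln (n%:R + 1)) =
    expR (- e * lnN n) * expR (- e * ln ((n%:R + 1) / N)).
  rewrite -expRD -mulrDr; congr (expR (_ * _)).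
  rewrite /lnN -lnM ?posrE ?divr_gt0//; congr ln.
  by rewrite -/N; field; rewrite gt_eqF.
rewrite -[X in _ - X]mulr1 -mulrBr mulrCA ler_pM2l ?expR_gt0//.
rewrite lerBrDl; apply: le_trans (expR_ge1Dx _).
rewrite lerD2l mulNr -mulrN ler_pM2l// lerNr.
apply: le_trans (ln_le_sub1 _) _; first by rewrite divr_gt0.
by rewrite -/N le_eqVlt; apply/orP; left; apply/eqP; rewrite /N; field; rewrite gt_eqF.
Qed.

Definition powN w n : R[i] := cexp (w * (lnN n)%:C).

Lemma normc_powN w n : normc (powN w n) = expR (Re w * lnN n).
Proof. by rewrite /powN normc_cexp ReM /= mulr0 subr0. Qed.

Lemma powND w z n : powN (w + z) n = powN w n * powN z n.
Proof. by rewrite /powN mulrDl cexpD. Qed.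

(** A first order expansion with explicit radius and constant: for a series of functions the
    constants have to be summed. *)
Definition jet (r : R) (g : R[i] -> R[i]) z dz (M : R) := forall h,
  normc h <= r -> normc (g (z + h) - g z - h * dz) <= M * normc h ^+ 2.

Lemma csum_derivable (g : nat -> R[i] -> R[i]) z (r : R) (M : nat -> R) :
  0 < r -> rsummable M -> (forall n, normc (g n z) <= M n) ->
  (forall n, exists dz, normc dz <= M n /\ jet r (g n) z dz (M n)) ->
  derivable ((fun w => csum (g ^~ w)) : R[i]^o -> R[i]^o) (z : R[i]^o) 1.
Proof.
move=> r0 sM gM /choice [D Dj].
have M0 n : 0 <= M n := le_trans (normc_ge0 _) (gM n).
have sD : csummable D by apply: csummable_le sM => n; have [] := Dj n.
have sg : csummable (g ^~ z) by apply: csummable_le sM.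
apply: (@derivable_quad _ _ _ (csum D) (2 * rsum M) r) => // h hr.
have hr' := ltW hr.
have srem : csummable (fun n => g n (z + h) - g n z - h * D n).
  apply: csummable_le (rsummableZ (normc h ^+ 2) sM) => n.
  by rewrite [leRHS]mulrC; have [_] := Dj n; exact.
have -> : csum (g ^~ (z + h)) - csum (g ^~ z) - h * csum D =
    csum (fun n => g n (z + h) - g n z - h * D n).
  have E : g ^~ (z + h) = (fun n => (g n (z + h) - g n z - h * D n) + (g n z + h * D n)).
    by apply/funext => n; ring.
  have sZ := csummableZ h sD.
  by rewrite [in LHS]E (csumD srem (csummableD sg sZ)) (csumD sg sZ) csumZ//; ring.
apply: le_trans (normc_csum (g := fun n => normc h ^+ 2 * M n) _ _) _.
- by move=> n; rewrite [leRHS]mulrC; have [_] := Dj n; exact.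
- exact: rsummableZ.
- by rewrite rsumZ// le_eqVlt; apply/orP; left; apply/eqP; ring.
Qed.

Lemma jet_powN (r : R) w n :
  jet r (powN ^~ n) w (powN w n * (lnN n)%:C)
    (4 * (1 + lnN n) ^+ 2 * expR ((Re w + r) * lnN n)).
Proof.
move=> h hr; have L0 := lnN_ge0 n.
have -> : powN (w + h) n - powN w n - h * (powN w n * (lnN n)%:C) =
    powN w n * th2 (h * (lnN n)%:C).
  by rewrite powND /th2 /powN; ring.
rewrite Normc.normcM normc_powN.
have nh : normc (h * (lnN n)%:C) = normc h * lnN n.
  by rewrite Normc.normcM normc_real ger0_norm.
apply: (@le_trans _ _ (expR (Re w * lnN n) *
    (4 * (normc h * lnN n) ^+ 2 * expR (normc h * lnN n)))).
  by rewrite ler_wpM2l ?expR_ge0// -nh th2_le.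
have -> : expR ((Re w + r) * lnN n) = expR (Re w * lnN n) * expR (r * lnN n).
  by rewrite mulrDl expRD.
have h1 : expR (normc h * lnN n) <= expR (r * lnN n).
  by rewrite ler_expR ler_wpM2r.
have h2 : lnN n ^+ 2 <= (1 + lnN n) ^+ 2 by nra.
rewrite [leLHS](_ : _ = (4 * expR (Re w * lnN n) * normc h ^+ 2) *
  (lnN n ^+ 2 * expR (normc h * lnN n))); last by ring.
rewrite [leRHS](_ : _ = (4 * expR (Re w * lnN n) * normc h ^+ 2) *
  ((1 + lnN n) ^+ 2 * expR (r * lnN n))); last by ring.
have hn := normc_ge0 h.
apply: ler_wpM2l; first by nonneg.
by apply: ler_pM; rewrite ?sqr_ge0 ?expR_ge0.
Qed.

(** The roles differ: [a], [b], [c] bound the value, derivative and remainder of f, here $N^w$,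
    while a single m serves for g, a coefficient that is uniformly small on the disc. *)
Lemma jetM (r : R) (f g : R[i] -> R[i]) z df dg (a b c : R) : 0 <= r <= 1 ->
  0 <= a -> 0 <= b -> 0 <= c ->
  normc (f z) <= a -> normc df <= b -> jet r f z df c ->
  forall m, 0 <= m ->
  (forall h, normc h <= r -> normc (g (z + h)) <= m) -> normc dg <= m ->
  jet r g z dg m ->
  jet r (fun w => f w * g w) z (df * g z + f z * dg) (m * (c + a + 2 * b)).
Proof.
move=> /andP[r0 r1] a0 b0 c0 fa dfb fc m m0 gm dgm gj h hr.
have h0 := normc_ge0 h; have h1 := le_trans hr r1.
have -> : f (z + h) * g (z + h) - f z * g z - h * (df * g z + f z * dg) =
    (f (z + h) - f z - h * df) * g (z + h) +
    f z * (g (z + h) - g z - h * dg) + h ^+ 2 * df * dg +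
    h * df * (g (z + h) - g z - h * dg) by ring.
have B1 : normc ((f (z + h) - f z - h * df) * g (z + h)) <= c * normc h ^+ 2 * m.
  by rewrite Normc.normcM; apply: ler_pM (fc _ hr) (gm _ hr); exact: normc_ge0.
have B2 : normc (f z * (g (z + h) - g z - h * dg)) <= a * (m * normc h ^+ 2).
  by rewrite Normc.normcM; apply: ler_pM fa (gj _ hr); exact: normc_ge0.
have B3 : normc (h ^+ 2 * df * dg) <= normc h ^+ 2 * b * m.
  rewrite (Normc.normcM (h ^+ 2 * df)) (Normc.normcM (h ^+ 2)) normcX.
  apply: ler_pM dgm; [|exact: normc_ge0|by rewrite ler_wpM2l ?sqr_ge0].
  by nonneg.
have B4 : normc (h * df * (g (z + h) - g z - h * dg)) <= b * (m * normc h ^+ 2).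
  rewrite (Normc.normcM (h * df)) (Normc.normcM h).
  apply: ler_pM (gj _ hr); rewrite ?mulr_ge0 ?normc_ge0//.
  by rewrite -[leRHS]mul1r; apply: ler_pM; rewrite ?normc_ge0.
apply: le_trans (le_normcD _ _) _.
apply: le_trans (lerD (le_normcD _ _) (lexx _)) _.
apply: le_trans (lerD (lerD (le_normcD _ _) (lexx _)) (lexx _)) _.
apply: le_trans (lerD (lerD (lerD B1 B2) B3) B4) _.
by rewrite le_eqVlt; apply/orP; left; apply/eqP; ring.
Qed.

Definition cub n : R := expR (- 3 * lnN n).

(* Terms N^w X_n(w) with X_n, its derivative and its quadratic remainder
   of size N^-3 sum to a function that is holomorphic on Re w < 2. *)
Definition cubic (X : nat -> R[i] -> R[i]) w := exists2 K : R, 0 <= K &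
  forall n, (forall h, normc h <= 1 -> normc (X n (w + h)) <= K * cub n) /\
    exists dX, normc dX <= K * cub n /\ jet 1 (X n) w dX (K * cub n).

Lemma jet_le (r r' : R) (f : R[i] -> R[i]) z df (M M' : R) : r' <= r -> M <= M' ->
  jet r f z df M -> jet r' f z df M'.
Proof.
move=> rr MM fj h hr; apply: le_trans (fj h (le_trans hr rr)) _.
by rewrite ler_wpM2r// sqr_ge0.
Qed.

Lemma cub_powN_summable w K : Re w < 2 -> 0 <= K ->
  exists2 d : R, 0 < d <= 1 &
    rsummable (fun n => K * cub n * ((1 + lnN n) ^+ 2 * expR ((Re w + d) * lnN n))).
Proof.
move=> w2 K0; pose d := Num.min 1 ((2 - Re w) / 4).
have d0 : 0 < d by rewrite lt_min ltr01 divr_gt0 ?subr_gt0.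
have d1 : d <= 1 by rewrite ge_min lexx.
have d4 : 4 * d <= 2 - Re w.
  by rewrite mulrC -ler_pdivlMr// ge_min lexx orbT.
exists d; first by rewrite d0.
have := rsummableZ (K * (1 + d^-1) ^+ 2) (rsummable_expN d0).
apply: rsummable_le => n; have L0 := lnN_ge0 n.
rewrite ger0_norm; last by rewrite /cub; nonneg.
rewrite -(mulrA K) -(mulrA K) ler_wpM2l//.
have h1 : (1 + lnN n) ^+ 2 <= (1 + d^-1) ^+ 2 * expR (2 * d * lnN n).
  have -> : expR (2 * d * lnN n) = expR (d * lnN n) ^+ 2.
    by rewrite expr2 -expRD; congr expR; ring.
  by rewrite -exprMn !expr2; apply: ler_pM; rewrite ?addr_ge0// lnN1_le.
rewrite /cub.
have -> : expR (- 3 * lnN n) * ((1 + lnN n) ^+ 2 * expR ((Re w + d) * lnN n)) =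
  (1 + lnN n) ^+ 2 * expR ((- 3 + Re w + d) * lnN n).
  by rewrite mulrCA -expRD; congr (_ * expR _); ring.
apply: (@le_trans _ _ ((1 + d^-1) ^+ 2 * expR (2 * d * lnN n) *
    expR ((- 3 + Re w + d) * lnN n))).
  by rewrite ler_wpM2r ?expR_ge0.
rewrite -(mulrA _ (expR _)) -expRD ler_wpM2l ?sqr_ge0// ler_expR.
rewrite -mulrDl ler_wpM2r//; lra.
Qed.

Lemma cubic_summable X w : Re w < 2 -> cubic X w ->
  csummable (fun n => powN w n * X n w).
Proof.
move=> w2 [K K0 KX]; have [d /andP[d0 _] sd] := cub_powN_summable w2 K0.
apply: csummable_le sd => n; have L0 := lnN_ge0 n.
rewrite Normc.normcM normc_powN mulrC; apply: ler_pM; rewrite ?normc_ge0 ?expR_ge0//.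
  by have [/(_ 0) H _] := KX n; move: H; rewrite normc0E addr0; apply.
apply: (@le_trans _ _ (1 * expR ((Re w + d) * lnN n))).
  by rewrite mul1r ler_expR ler_wpM2r// lerDl ltW.
by rewrite ler_wpM2r ?expR_ge0//; nra.
Qed.

Lemma cubic_derivable X w : Re w < 2 -> cubic X w ->
  derivable ((fun w => csum (fun n => powN w n * X n w)) : R[i]^o -> R[i]^o)
    (w : R[i]^o) 1.
Proof.
(* 7 = 4 + 1 + 2 is the constant $c + a + 2b$ of [jetM] for $a = b = Q$ and $c = 4Q$ below. *)
move=> w2 [K K0 KX]; have K7 : 0 <= 7 * K by rewrite mulr_ge0.
have [d /andP[d0 d1] sd] := cub_powN_summable w2 K7.
apply: (@csum_derivable (fun n w => powN w n * X n w) w d _ d0 sd).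
  move=> n; have L0 := lnN_ge0 n.
  rewrite Normc.normcM normc_powN mulrC; apply: ler_pM; rewrite ?normc_ge0 ?expR_ge0//.
    have [/(_ 0) h _] := KX n; move: h; rewrite normc0E addr0 => /(_ ler01) h.
    by apply: le_trans h _; rewrite ler_wpM2r ?expR_ge0//; lra.
  apply: (@le_trans _ _ (1 * expR ((Re w + d) * lnN n))).
    by rewrite mul1r ler_expR ler_wpM2r// lerDl ltW.
  by rewrite ler_wpM2r ?expR_ge0//; nra.
move=> n; have L0 := lnN_ge0 n; have [KXn [dX [dXK jX]]] := KX n.
have C0 : 0 <= K * cub n by rewrite mulr_ge0 ?expR_ge0.
have Xw : normc (X n w) <= K * cub n by rewrite -[w]addr0 KXn// normc0E.
pose Q := (1 + lnN n) ^+ 2 * expR ((Re w + d) * lnN n).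
have Q0 : 0 <= Q by rewrite mulr_ge0 ?sqr_ge0 ?expR_ge0.
have eQ : expR (Re w * lnN n) <= expR ((Re w + d) * lnN n).
  by rewrite ler_expR ler_wpM2r// lerDl ltW.
have L1 : 1 <= (1 + lnN n) ^+ 2 by nra.
have L2 : lnN n <= (1 + lnN n) ^+ 2 by nra.
have a1 : normc (powN w n) <= Q.
  rewrite normc_powN /Q -[leLHS]mul1r; apply: ler_pM => //; exact: expR_ge0.
have a2 : normc (powN w n * (lnN n)%:C) <= Q.
  rewrite Normc.normcM normc_powN normc_real ger0_norm// mulrC /Q.
  by apply: ler_pM => //; exact: expR_ge0.
have jE : jet d (powN ^~ n) w (powN w n * (lnN n)%:C) (4 * Q).
  by rewrite /Q mulrA; exact: jet_powN.
have d01 : 0 <= d <= 1 by rewrite ltW.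
have Q40 : 0 <= 4 * Q by rewrite mulr_ge0.
have jP := @jetM d (powN ^~ n) _ _ _ _ _ _ _ d01 Q0 Q0 Q40 a1 a2 jE _ C0
  (fun h hd => KXn h (le_trans hd d1)) dXK (jet_le d1 (lexx _) jX).
exists (powN w n * (lnN n)%:C * X n w + powN w n * dX); split; last first.
  apply: jet_le jP => //.
  by rewrite -/Q le_eqVlt; apply/orP; left; apply/eqP; ring.
apply: le_trans (le_normcD _ _) _; rewrite !Normc.normcM -Normc.normcM.
apply: (@le_trans _ _ (Q * (K * cub n) + Q * (K * cub n))).
  by apply: lerD; apply: ler_pM; rewrite ?normc_ge0.
have : 0 <= Q * (K * cub n) by rewrite mulr_ge0.
rewrite -/Q (_ : 7 * K * cub n * Q = 7 * (Q * (K * cub n))); last by ring.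
by lra.
Qed.

End DirichletSeries.

Section ZetaContinuation.
Variable R : realType.
Implicit Types (n : nat) (w h z s : R[i]) (t : R).

Lemma jetD (r : R) (f g : R[i] -> R[i]) z df dg (M M' : R) :
  jet r f z df M -> jet r g z dg M' ->
  jet r (fun w => f w + g w) z (df + dg) (M + M').
Proof.
move=> fj gj h hr; have := lerD (fj h hr) (gj h hr); rewrite -mulrDl.
by apply: le_trans; apply: le_trans (le_normcD _ _); rewrite le_eqVlt; apply/orP;
  left; apply/eqP; congr normc; ring.
Qed.

Lemma jetN (r : R) (f : R[i] -> R[i]) z df (M : R) :
  jet r f z df M -> jet r (fun w => - f w) z (- df) M.
Proof.
move=> fj h hr; apply: le_trans (fj h hr); rewrite -normcN le_eqVlt; apply/orP.
by left; apply/eqP; congr normc; ring.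
Qed.

Section ScaledTh3.
Variables (a t W : R) (w : R[i]).
Hypotheses (t_ge0 : 0 <= t) (t_le : 2 * t <= 1) (a_le : `|a| <= 2 * t)
  (W_ge1 : 1 <= W) (w_le : normc w + 1 <= W).

Let E := expR W.

Let E_ge1 : 1 <= E.
Proof. by rewrite -expR0 ler_expR; exact: le_trans ler01 W_ge1. Qed.

Let normc_az z : normc (a%:C * z) <= 2 * t * normc z.
Proof. by rewrite Normc.normcM normc_real ler_wpM2r ?normc_ge0. Qed.

Let exp_az z : normc z <= W -> expR (normc (a%:C * z)) <= E.
Proof.
move=> zW; have t0 := t_ge0; have t1 := t_le; have W1 := W_ge1; have E1 := E_ge1.
rewrite ler_expR; apply: le_trans (normc_az z) _.
by have := normc_ge0 z; nra.
Qed.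

Let th1_az z : normc z <= W -> normc (th1 (a%:C * z)) <= 4 * t * normc z * E.
Proof.
move=> zW; have t0 := t_ge0; have t1 := t_le; have W1 := W_ge1; have E1 := E_ge1.
apply: le_trans (th1_le _) _; apply: ler_pM; rewrite ?expR_ge0 ?exp_az//.
  by nonneg.
have -> : 4 * t * normc z = 2 * (2 * t * normc z) by ring.
by rewrite ler_pM2l// normc_az.
Qed.

Let th2_az z : normc z <= W ->
  normc (th2 (a%:C * z)) <= 16 * t ^+ 2 * normc z ^+ 2 * E.
Proof.
move=> zW; have t0 := t_ge0; have t1 := t_le; have W1 := W_ge1; have E1 := E_ge1.
apply: le_trans (th2_le _) _; apply: ler_pM; rewrite ?expR_ge0 ?exp_az//.
  by nonneg.
have -> : 16 * t ^+ 2 * normc z ^+ 2 = 4 * (2 * t * normc z) ^+ 2 by ring.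
rewrite ler_pM2l// !expr2; apply: ler_pM; rewrite ?normc_ge0 ?normc_az//.
Qed.

Let th3_az z : normc z <= W ->
  normc (th3 (a%:C * z)) <= 64 * t ^+ 3 * normc z ^+ 3 * E.
Proof.
move=> zW; have t0 := t_ge0; have t1 := t_le; have W1 := W_ge1; have E1 := E_ge1.
have z0 := normc_ge0 z; have az0 := normc_ge0 (a%:C * z).
apply: le_trans (th3_le _) _; apply: ler_pM; rewrite ?expR_ge0 ?exp_az//.
  by nonneg.
have -> : 64 * t ^+ 3 * normc z ^+ 3 = 8 * (2 * t * normc z) ^+ 3 by ring.
by rewrite ler_pM2l// lerXn2r ?nnegrE ?normc_az//; nonneg.
Qed.

(** Meant for $t = 1/(2N)$ and $a = \ln((N \pm 1/2)/N)$: the cubic order of [th3] gives $t^3$, hence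
    $N^{-3}$, uniformly on the disc of radius [W], which contains the unit disc around w. *)
Lemma scaled_th3_le z : normc z <= W ->
  normc (th3 (a%:C * z)) <= 64 * W ^+ 3 * E ^+ 2 * t ^+ 3.
Proof.
move=> zW; have t0 := t_ge0; have t1 := t_le; have W1 := W_ge1; have E1 := E_ge1.
apply: le_trans (th3_az zW) _.
have z0 := normc_ge0 z; have W0 : 0 <= W by lra. have E0 : 0 <= E by lra.
have h1 : normc z ^+ 3 <= W ^+ 3 by rewrite lerXn2r ?nnegrE.
have h2 : E <= E ^+ 2 by nra.
have -> : 64 * t ^+ 3 * normc z ^+ 3 * E = 64 * t ^+ 3 * (normc z ^+ 3 * E) by ring.
have -> : 64 * W ^+ 3 * E ^+ 2 * t ^+ 3 = 64 * t ^+ 3 * (W ^+ 3 * E ^+ 2) by ring.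
apply: ler_wpM2l; first by nonneg.
by apply: ler_pM => //; nonneg.
Qed.

Lemma scaled_th3_cubic z : normc z <= W ->
  normc (th3 (a%:C * z)) <= 64 * W ^+ 3 * E ^+ 2 * t ^+ 3 * normc z ^+ 3.
Proof.
move=> zW; have t0 := t_ge0; have t1 := t_le; have W1 := W_ge1; have E1 := E_ge1.
apply: le_trans (th3_az zW) _.
have z0 := normc_ge0 z; have W0 : 0 <= W by lra. have E0 : 0 <= E by lra.
have h1 : 1 <= W ^+ 3 by rewrite exprn_ege1.
have h2 : E <= E ^+ 2 by nra.
have -> : 64 * t ^+ 3 * normc z ^+ 3 * E = 64 * t ^+ 3 * normc z ^+ 3 * (1 * E) by ring.
have -> : 64 * W ^+ 3 * E ^+ 2 * t ^+ 3 * normc z ^+ 3 =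
  64 * t ^+ 3 * normc z ^+ 3 * (W ^+ 3 * E ^+ 2) by ring.
apply: ler_wpM2l; first by nonneg.
by apply: ler_pM.
Qed.

Lemma scaled_th2_le : normc (a%:C * th2 (a%:C * w)) <= 32 * W ^+ 3 * E ^+ 2 * t ^+ 3.
Proof.
have t0 := t_ge0; have W1 := W_ge1; have E1 := E_ge1; have ww := w_le.
have wW : normc w <= W by lra.
have z0 := normc_ge0 w; have W0 : 0 <= W by lra. have E0 : 0 <= E by lra.
rewrite Normc.normcM normc_real.
apply: (@le_trans _ _ (2 * t * (16 * t ^+ 2 * normc w ^+ 2 * E))).
  by apply: ler_pM; rewrite ?normc_ge0 ?th2_az.
have h1 : normc w ^+ 2 <= W ^+ 3.
  apply: (@le_trans _ _ (W ^+ 2)); first by rewrite lerXn2r ?nnegrE.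
  by rewrite ler_weXn2l.
have h2 : E <= E ^+ 2 by nra.
have -> : 2 * t * (16 * t ^+ 2 * normc w ^+ 2 * E) =
  32 * t ^+ 3 * (normc w ^+ 2 * E) by ring.
have -> : 32 * W ^+ 3 * E ^+ 2 * t ^+ 3 = 32 * t ^+ 3 * (W ^+ 3 * E ^+ 2) by ring.
apply: ler_wpM2l; first by nonneg.
by apply: ler_pM => //; nonneg.
Qed.

Lemma scaled_th3_jet : jet 1 (fun z => th3 (a%:C * z)) w (a%:C * th2 (a%:C * w))
  (128 * W ^+ 3 * E ^+ 2 * t ^+ 3).
Proof.
move=> h h1.
have t0 := t_ge0; have W1 := W_ge1; have E1 := E_ge1; have ww := w_le.
have wW : normc w <= W by lra.
have hW : normc h <= W by lra.
have w0 := normc_ge0 w; have h0 := normc_ge0 h.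
have W0 : 0 <= W by lra.
have E0 : 0 <= E by lra.
rewrite mulrDr.
have -> : th3 (a%:C * w + a%:C * h) - th3 (a%:C * w) - h * (a%:C * th2 (a%:C * w)) =
    th1 (a%:C * w) * th2 (a%:C * h) + th3 (a%:C * h).
  by rewrite -th3D; ring.
apply: le_trans (le_normcD _ _) _.
have B1 : normc (th1 (a%:C * w) * th2 (a%:C * h)) <=
    64 * W ^+ 3 * E ^+ 2 * t ^+ 3 * normc h ^+ 2.
  rewrite Normc.normcM.
  apply: (@le_trans _ _ ((4 * t * normc w * E) * (16 * t ^+ 2 * normc h ^+ 2 * E))).
    by apply: ler_pM; rewrite ?normc_ge0 ?th1_az ?th2_az.
  have -> : 4 * t * normc w * E * (16 * t ^+ 2 * normc h ^+ 2 * E) =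
    64 * E ^+ 2 * t ^+ 3 * normc h ^+ 2 * normc w by ring.
  have -> : 64 * W ^+ 3 * E ^+ 2 * t ^+ 3 * normc h ^+ 2 =
    64 * E ^+ 2 * t ^+ 3 * normc h ^+ 2 * W ^+ 3 by ring.
  apply: ler_wpM2l; first by nonneg.
  by apply: le_trans wW _; rewrite -[leLHS]expr1 ler_weXn2l.
have B2 : normc (th3 (a%:C * h)) <= 64 * W ^+ 3 * E ^+ 2 * t ^+ 3 * normc h ^+ 2.
  apply: le_trans (scaled_th3_cubic hW) _.
  apply: ler_wpM2l; first by nonneg.
  by rewrite ler_wiXn2l.
by apply: le_trans (lerD B1 B2) _; rewrite le_eqVlt; apply/orP; left; apply/eqP; ring.
Qed.

End ScaledTh3.

Definition tn n : R := (2 * (n%:R + 2))^-1.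

Lemma tn_bounds n : 0 < tn n <= 1 / 4.
Proof.
have N0 := natD2_gt0 R n; rewrite /tn invr_gt0 mulr_gt0//=.
rewrite invf_ple ?posrE ?mulr_gt0//.
by have := ler0n R n; lra.
Qed.

Lemma cub_tn n : cub R n = 8 * tn n ^+ 3.
Proof.
have N0 := natD2_gt0 R n.
have -> : cub R n = expR (- lnN R n) ^+ 3.
  by rewrite /cub !exprS expr0 mulr1 -!expRD; congr expR; ring.
rewrite expRN expR_lnN /tn invfM exprMn exprVn; field.
by rewrite gt_eqF.
Qed.

Definition alpha n : R := lnp (tn n).
Definition beta n : R := lnm (tn n).

(* N^w rterm_n(w) = (N + 1/2)^w - (N - 1/2)^w - w N^(w-1), with N = n + 2:
   the first and second order terms of the expansion of the difference are
   collected, and the remainder is expressed by th3. *)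
Definition rterm n w : R[i] :=
  (alpha n + beta n - 2 * tn n)%:C * w +
  ((alpha n ^+ 2 - beta n ^+ 2) / 2)%:C * w ^+ 2 +
  (th3 ((alpha n)%:C * w) - th3 ((- beta n)%:C * w)).

Let alpha_le n : `|alpha n| <= 2 * tn n.
Proof.
have tb := tn_bounds n; have /andP[a0 a1] := lnp_bounds tb.
by rewrite ger0_norm// (le_trans a1)//; move: tb => /andP[t0 _]; lra.
Qed.

Let beta_le n : `|- beta n| <= 2 * tn n.
Proof.
have /andP[a0 a1] := lnm_bounds (tn_bounds n).
by rewrite normrN ger0_norm.
Qed.

Let tn2 n : 2 * tn n <= 1. Proof. by have /andP[_] := tn_bounds n; lra. Qed.
Let tn0 n : 0 <= tn n. Proof. by have /andP[/ltW] := tn_bounds n. Qed.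

Lemma rterm_lin n : `|alpha n + beta n - 2 * tn n| <= 4 * tn n ^+ 3.
Proof. exact: lnpm_sum (tn_bounds n). Qed.

Lemma rterm_sqr n : `|(alpha n ^+ 2 - beta n ^+ 2) / 2| <= 3 * tn n ^+ 3.
Proof.
rewrite normrM [`|2^-1|]ger0_norm// ler_pdivrMr//.
have -> : 3 * tn n ^+ 3 * 2 = 6 * tn n ^+ 3 by ring.
exact: lnpm_sqr (tn_bounds n).
Qed.

Lemma jet_lin_sqr (c d w : R[i]) :
  jet 1 (fun z => c * z + d * z ^+ 2) w (c + 2 * d * w) (normc d).
Proof.
move=> h h1; rewrite -normcX -Normc.normcM le_eqVlt; apply/orP; left; apply/eqP.
by congr normc; ring.
Qed.

(** The linear coefficient is $O(t^3)$ by [lnpm_sum], the quadratic one by [lnpm_sqr], and the rest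
    by the cubic order of [th3]. This gain of two powers of N over $N^{w-1}$ moves the boundary of
    convergence from $Re w = 0$ to $Re w = 2$. *)
Lemma cubic_rterm w : cubic rterm w.
Proof.
pose W := normc w + 1; have w0 := normc_ge0 w.
have W1 : 1 <= W by rewrite /W; lra.
have wW : normc w + 1 <= W by [].
pose E := expR W.
have E1 : 1 <= E by rewrite -expR0 ler_expR; lra.
pose C := W ^+ 3 * E ^+ 2.
have W3 : W ^+ 3 >= 1 by rewrite exprn_ege1.
have C1 : 1 <= C.
  rewrite /C; have : 1 <= E ^+ 2 by rewrite exprn_ege1.
  by move=> ?; nra.
have WC : W <= C.
  have : W <= W ^+ 3 by rewrite -[leLHS]expr1 ler_weXn2l.
  have : 1 <= E ^+ 2 by rewrite exprn_ege1.
  by rewrite /C; nra.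
have W2C : W ^+ 2 <= C.
  have : W ^+ 2 <= W ^+ 3 by rewrite ler_weXn2l.
  have : 1 <= E ^+ 2 by rewrite exprn_ege1.
  by rewrite /C; nra.
exists (300 * C); first by rewrite mulr_ge0//; lra.
move=> n; have t0 := tn0 n.
have t30 : 0 <= tn n ^+ 3 by exact: exprn_ge0.
have cubt : 300 * C * cub R n = 2400 * (C * tn n ^+ 3) by rewrite cub_tn; ring.
have Ct : tn n ^+ 3 <= C * tn n ^+ 3 by rewrite ler_peMl.
split.
  move=> h h1; have zW : normc (w + h) <= W.
    by apply: le_trans (le_normcD _ _) _; rewrite lerD2l.
  have z0 := normc_ge0 (w + h).
  rewrite cubt; set z := w + h in zW z0 *.
  have b1 : normc ((alpha n + beta n - 2 * tn n)%:C * z) <= 4 * tn n ^+ 3 * C.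
    rewrite Normc.normcM normc_real; apply: ler_pM => //; first exact: rterm_lin.
    exact: le_trans zW WC.
  have b2 : normc (((alpha n ^+ 2 - beta n ^+ 2) / 2)%:C * z ^+ 2) <= 3 * tn n ^+ 3 * C.
    rewrite Normc.normcM normc_real normcX; apply: ler_pM; rewrite ?sqr_ge0//.
      exact: rterm_sqr.
    by apply: le_trans W2C; rewrite lerXn2r ?nnegrE//; lra.
  have b3 := scaled_th3_le t0 (tn2 n) (alpha_le n) W1 zW.
  have b4 := scaled_th3_le t0 (tn2 n) (beta_le n) W1 zW.
  rewrite /rterm; apply: le_trans (le_normcD _ _) _.
  apply: le_trans (lerD (le_normcD _ _) (le_normcB _ _)) _.
  apply: le_trans (lerD (lerD b1 b2) (lerD b3 b4)) _.
  rewrite -/E (_ : _ + _ = 135 * (C * tn n ^+ 3)); last by rewrite /C; ring.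
  by lra.
have c3 := scaled_th2_le t0 (tn2 n) (alpha_le n) W1 wW.
have c4 := scaled_th2_le t0 (tn2 n) (beta_le n) W1 wW.
have j3 := scaled_th3_jet t0 (tn2 n) (alpha_le n) W1 wW.
have j4 := scaled_th3_jet t0 (tn2 n) (beta_le n) W1 wW.
have j := jetD (@jet_lin_sqr (alpha n + beta n - 2 * tn n)%:C
  ((alpha n ^+ 2 - beta n ^+ 2) / 2)%:C w) (jetD j3 (jetN j4)).
eexists; split; last first.
  apply: jet_le j => //; rewrite normc_real cubt.
  apply: le_trans (lerD (rterm_sqr n) (lexx _)) _.
  rewrite -/E.
  rewrite (_ : 128 * W ^+ 3 * E ^+ 2 * tn n ^+ 3 = 128 * (C * tn n ^+ 3)); last by rewrite /C; ring.
  by lra.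
rewrite cubt; apply: le_trans (le_normcD _ _) _.
have b1 : normc ((alpha n + beta n - 2 * tn n)%:C +
    2 * ((alpha n ^+ 2 - beta n ^+ 2) / 2)%:C * w) <= 10 * (C * tn n ^+ 3).
  apply: le_trans (le_normcD _ _) _; rewrite !Normc.normcM !normc_real.
  have -> : normc (2 : R[i]) = 2.
    by rewrite -[2]/(1 + 1) -(rmorph1 (real_complex R)) -rmorphD normc_real ger0_norm.
  have h1 := rterm_lin n; have h2 := rterm_sqr n.
  have h3 : `|(alpha n ^+ 2 - beta n ^+ 2) / 2| * normc w <= 3 * tn n ^+ 3 * C.
    by apply: ler_pM => //; lra.
  by rewrite -mulrA; lra.
apply: le_trans (lerD b1 (le_normcD _ _)) _; rewrite normcN.
apply: le_trans (lerD (lexx _) (lerD c3 c4)) _; rewrite -/E.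
rewrite (_ : 32 * W ^+ 3 * E ^+ 2 * tn n ^+ 3 = 32 * (C * tn n ^+ 3)); last by rewrite /C; ring.
by lra.
Qed.

End ZetaContinuation.

Section ReflectedDerivative.
Variable K : numFieldType.

Lemma derivable_reflect (f : K^o -> K^o) (c z : K^o) :
  derivable f (c - z) 1 -> derivable (fun z => f (c - z) : K^o) z 1.
Proof.
move=> /derivable1_diffP df; apply/derivable1_diffP.
apply: (@differentiable_comp _ _ _ _ (fun z : K^o => c - z : K^o) f) => //.
Qed.

End ReflectedDerivative.

Section ZetaFunction.
Variable R : realType.
Implicit Types (n : nat) (w h z s : R[i]).

Lemma holo_reflect (f : R[i] -> R[i]) (c s : R[i]) :
  holomorphic_at f (c - s) -> holomorphic_at (fun z => f (c - z)) s.
Proof.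
move=> /holomorphicP[r r0 hf]; apply/holomorphicP; exists r => // z zs.
apply (@derivable_reflect R[i] f c z); apply hf.
by rewrite (_ : c - z - (c - s) = s - z) 1?normcB//; ring.
Qed.

Lemma Re_near (s z : R[i]) (x : R) : normc (z - s) < x - Re s -> Re z < x.
Proof.
move=> h; have := Re_le_normc (z - s); rewrite ReD ReN ler_norml => /andP[_ h'].
by lra.
Qed.

Lemma holo_halfplane (f : R[i] -> R[i]) (x : R) s : Re s < x ->
  (forall z, Re z < x -> derivable (f : R[i]^o -> R[i]^o) (z : R[i]^o) 1) ->
  holomorphic_at f s.
Proof.
move=> sx hf; apply/holomorphicP; exists (x - Re s); first by rewrite subr_gt0.
by move=> z /Re_near zx; apply hf.
Qed.

Lemma cubic_holo (X : nat -> R[i] -> R[i]) w : Re w < 2 -> (forall z, cubic X z) ->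
  holomorphic_at (fun w => csum (fun n => powN w n * X n w)) w.
Proof.
move=> w2 cX; apply (@holo_halfplane _ 2 _ w2) => z z2.
exact: (cubic_derivable z2 (cX z)).
Qed.

Lemma cubic_cst (x : nat -> R[i]) (K : R) w :
  (forall n, normc (x n) <= K * cub R n) -> cubic (fun n _ => x n) w.
Proof.
move=> xK.
have K0 : 0 <= K.
  by rewrite -(pmulr_lge0 K (expR_gt0 (- 3 * lnN R 0))); exact: le_trans (normc_ge0 _) (xK 0%N).
exists K => // n; split=> [h _|]; first exact: xK.
exists 0; rewrite normc0E; split; first by rewrite mulr_ge0// expR_ge0.
by move=> h _; rewrite mulr0 subrr subr0 normc0E; rewrite /cub; nonneg.
Qed.

(** $\ln(N - 1/2)$ for $N = n + 2$: successive values are the logarithms of the ends of an interval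
    of length 1 centred at N. *)
Definition halfln n : R := ln (n%:R + 3 / 2).

Lemma halfln_succ n : halfln n.+1 = lnN R n + alpha R n.
Proof.
have N0 := natD2_gt0 R n; have /andP[t0 _] := tn_bounds R n.
rewrite /halfln /alpha /lnp /lnN -lnM ?posrE//; last by lra.
congr ln.
by rewrite mulrDr mulr1 /tn -natr1; field; rewrite gt_eqF.
Qed.

Lemma halfln_beta n : halfln n = lnN R n - beta R n.
Proof.
have N0 := natD2_gt0 R n; have /andP[t0 t1] := tn_bounds R n.
rewrite /halfln /beta /lnm /lnN opprK -lnM ?posrE//; last by lra.
by congr ln; rewrite mulrDr mulr1 mulrN /tn; field; rewrite gt_eqF.
Qed.

Lemma powN_rterm w n : powN w n * rterm n w =
  cexp (w * (halfln n.+1)%:C) - cexp (w * (halfln n)%:C) - w * powN (w - 1) n.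
Proof.
have N0 := natD2_gt0 R n.
have E1 : powN (-1 : R[i]) n = (2 * tn R n)%:C.
  rewrite /powN /cexp mulN1r -rmorphN /= cos0 sin0 mulr0 mulr1 expRN expR_lnN.
  by congr (_%:C); rewrite /tn; field; rewrite gt_eqF.
rewrite powND E1 halfln_succ halfln_beta !rmorphD !mulrDr !cexpD -/(powN w n).
rewrite /rterm /th3 ![_ * w]mulrC.
have -> : ((alpha R n ^+ 2 - beta R n ^+ 2) / 2)%:C =
  ((alpha R n)%:C ^+ 2 - (beta R n)%:C ^+ 2) / 2 :> R[i].
  by rewrite rmorphM rmorphB !rmorphXn fmorphV rmorph_nat.
by rewrite !(rmorphB, rmorphD, rmorphN) /=; field.
Qed.

Definition zsum w : R[i] := csum (fun n => powN w n * rterm n w).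
(** For $Re w < 0$ this is $-w \sum_{N \ge 2} N^{w-1}$, where $(3/2)^w$ is the boundary term of the
    telescoping sum at $N = 2$. The series [zsum] converges for $Re w < 2$ and so provides the
    continuation. *)
Definition zeta_num w : R[i] := cexp (w * (ln (3 / 2) : R)%:C) + zsum w.

Lemma powN_summable w : Re w < -1 -> csummable (powN w).
Proof.
move=> w1; have e0 : 0 < - Re w - 1 by lra.
apply: csummable_le (rsummable_expN e0) => n.
by rewrite normc_powN le_eqVlt; apply/orP; left; apply/eqP; congr expR; ring.
Qed.

Lemma halfln_ge (M : R) : exists n0, forall n, (n0 <= n)%N -> M <= halfln n.
Proof.
exists (Num.truncn (expR M)).+1 => n hn.
have n0 := ler0n R n; have p0 : 0 < n%:R + 3 / 2 :> R by lra.
rewrite -[M]expRK /halfln ler_ln ?posrE ?expR_gt0//.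
have h1 : expR M < (Num.truncn (expR M)).+1%:R by exact: truncnS_gt.
have h2 : (Num.truncn (expR M)).+1%:R <= n%:R :> R by rewrite ler_nat.
by lra.
Qed.

Lemma zeta_numE w : Re w < 0 -> zeta_num w = - w * csum (powN (w - 1)).
Proof.
move=> w0; have w1 : Re (w - 1) < -1 by rewrite ReD ReN /=; lra.
have w2 : Re w < 2 by lra.
have s1 := powN_summable w1; have s2 := cubic_summable w2 (cubic_rterm w).
pose f n : R[i] := cexp (w * (halfln n)%:C).
have fE n : f n - f n.+1 = - (powN w n * rterm n w + w * powN (w - 1) n).
  by rewrite powN_rterm /f; ring.
have sw := csummableZ w s1.
have sf : csummable (fun n => - (powN w n * rterm n w + w * powN (w - 1) n)).
  by apply: csummable_le (csummableD s2 sw) => n; rewrite normcN.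
have f0 : (fun n => normc (f n)) @ \oo --> (0 : R).
  apply/cvgrPdist_lt => e e0.
  have [n0 hn0] := halfln_ge ((- ln e + 1) / - Re w).
  exists n0 => // n hn'; have hn := hn0 n hn'; rewrite sub0r normrN ger0_norm ?normc_ge0//.
  rewrite normc_cexp ReM [Re _%:C]/= [Im _%:C]/= mulr0 subr0 -[ltRHS]lnK ?posrE// ltr_expR.
  move: hn; rewrite ler_pdivrMr ?oppr_gt0// mulrN [halfln n * _]mulrC.
  by move: (Re w * halfln n) => x; lra.
have T : csum (fun n => f n - f n.+1) = f 0%N.
  by apply: csum_telescope f0; under eq_fun do rewrite fE.
have T2 : csum (fun n => f n - f n.+1) = - (zsum w + w * csum (powN (w - 1))).
  under [X in csum X]eq_fun do rewrite fE.
  by rewrite csumN ?csumD ?csumZ//; exact: csummableD.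
rewrite /zeta_num -[cexp _](_ : f 0%N = _); last by rewrite /f /halfln add0r.
by rewrite -T T2; ring.
Qed.

Lemma zeta_num_holo w : Re w < 2 -> holomorphic_at zeta_num w.
Proof.
move=> w2; apply (@holoD _ (fun w => cexp (w * (ln (3 / 2) : R)%:C)) zsum w);
  last exact (@cubic_holo (@rterm R) w w2 (@cubic_rterm R)).
apply (@holo_halfplane _ (Re w + 1)); first by lra.
move=> z _; set l := ln _.
apply: (@derivable_quad _ _ _ (cexp (z * l%:C) * l%:C)
  (normc (cexp (z * l%:C)) * (4 * `|l| ^+ 2 * expR `|l|)) 1) => // h h1.
have -> : cexp ((z + h) * l%:C) - cexp (z * l%:C) - h * (cexp (z * l%:C) * l%:C) =
    cexp (z * l%:C) * th2 (h * l%:C) by rewrite mulrDl cexpD /th2; ring.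
rewrite Normc.normcM -[leRHS]mulrA ler_wpM2l ?normc_ge0//.
apply: le_trans (th2_le _) _; rewrite Normc.normcM normc_real exprMn.
have -> : 4 * `|l| ^+ 2 * expR `|l| * normc h ^+ 2 =
  4 * (normc h ^+ 2 * `|l| ^+ 2) * expR `|l| by ring.
apply: ler_wpM2l; first by nonneg.
by rewrite ler_expR ler_piMl// ltW.
Qed.

End ZetaFunction.

(** * The expansion at w = 0 and the residue *)

Section ZetaResidue.
Variable R : realType.
Implicit Types (n : nat) (w h z s : R[i]).

Let lnN_sqr n : [/\ lnN R n ^+ 2 <= (1 + lnN R n) ^+ 2, 1 + lnN R n <= (1 + lnN R n) ^+ 2
  & lnN R n <= (1 + lnN R n) ^+ 2].
Proof. by have L0 := lnN_ge0 R n; split; nra. Qed.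

(** The value at 0 is 1 because every [rterm n 0] vanishes. An expansion with cubic remainder is
    needed because [(zeta_num w - 1) / w] must have a quadratic one to be differentiable at 0. The
    series is expanded term by term; [c] and [e] are the first two coefficients of [rterm], and the
    logarithm comes from $N^h = 1 + h \ln N + \dots$ *)
Lemma zeta_num_taylor : exists p1 p2 (M r : R), 0 < r /\
  forall h, normc h <= r ->
  normc (zeta_num h - 1 - p1 * h - p2 * h ^+ 2) <= M * normc h ^+ 3.
Proof.
pose E : R := expR 1; have E1 : 1 <= E by rewrite /E -expR0 ler_expR.
have E2 : 1 <= E ^+ 2 by rewrite exprn_ege1.
(* The bounds [b1], [b2], [b3] contribute 3 + 128 + 540 multiples of [T]; [M n] offers 5600 = 8 *
   700 of them, as [cub] is $8 t^3$. *)
have K0 : 0 <= 700 * E ^+ 2 by lra.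
have z2 : Re (0 : R[i]) < 2 by rewrite /=; lra.
have [d /andP[d0 d1] sM] := cub_powN_summable z2 K0.
pose M n := 700 * E ^+ 2 * cub R n *
  ((1 + lnN R n) ^+ 2 * expR ((Re (0 : R[i]) + d) * lnN R n)).
pose c n : R := alpha R n + beta R n - 2 * tn R n.
pose e n : R := (alpha R n ^+ 2 - beta R n ^+ 2) / 2.
have cM n : normc (c n)%:C <= M n /\ normc (e n + c n * lnN R n)%:C <= M n.
  have L0 := lnN_ge0 R n; have c1 := rterm_lin R n; have e1 := rterm_sqr R n.
  rewrite -/(c n) in c1; rewrite -/(e n) in e1.
  have ME : 5600 * tn R n ^+ 3 * (1 + lnN R n) ^+ 2 <= M n.
    have -> : M n = 5600 * tn R n ^+ 3 * (1 + lnN R n) ^+ 2 *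
        (E ^+ 2 * expR ((Re (0 : R[i]) + d) * lnN R n)) by rewrite /M cub_tn; ring.
    have /andP[/ltW t0 _] := tn_bounds R n.
    apply: ler_peMr; first by nonneg.
    rewrite -[leLHS]mulr1; apply: ler_pM => //.
    by rewrite -expR0 ler_expR add0r; nonneg; exact: ltW.
  have /andP[/ltW t0 _] := tn_bounds R n.
  have t3 : 0 <= tn R n ^+ 3 by nonneg.
  have [_ L1 _] := lnN_sqr n.
  split; rewrite normc_real; apply: le_trans ME.
    apply: le_trans c1 _; have : tn R n ^+ 3 <= tn R n ^+ 3 * (1 + lnN R n) ^+ 2.
      by rewrite ler_peMr//; lra.
    by rewrite -mulrA; lra.
  apply: le_trans (ler_normD _ _) _; rewrite [`|c n * _|]normrM (ger0_norm L0).
  apply: (@le_trans _ _ (4 * tn R n ^+ 3 * (1 + lnN R n))).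
    have : `|c n| * lnN R n <= 4 * tn R n ^+ 3 * lnN R n by rewrite ler_wpM2r.
    by rewrite mulrDr mulr1; lra.
  have : tn R n ^+ 3 * (1 + lnN R n) <= tn R n ^+ 3 * (1 + lnN R n) ^+ 2.
    by rewrite ler_wpM2l.
  have : 0 <= tn R n ^+ 3 * (1 + lnN R n) ^+ 2 by nonneg.
  rewrite -[4 * _ * _]mulrA -[5600 * _ * _]mulrA.
  by move: (tn R n ^+ 3 * _) (tn R n ^+ 3 * _) => x y; lra.
have sc : csummable (fun n => (c n)%:C).
  by apply: csummable_le sM => n; have [] := cM n.
have se : csummable (fun n => (e n + c n * lnN R n)%:C).
  by apply: csummable_le sM => n; have [] := cM n.
have remM h n : normc h <= d -> normc (powN h n * rterm n h - h * (c n)%:C -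
    h ^+ 2 * (e n + c n * lnN R n)%:C) <= normc h ^+ 3 * M n.
  move=> hd; have h1 : normc h <= 1 by exact: le_trans hd d1.
  have h0 := normc_ge0 h; have L0 := lnN_ge0 R n.
  have /andP[/ltW t0 t4] := tn_bounds R n; have t2 : 2 * tn R n <= 1 by lra.
  have aL : `|alpha R n| <= 2 * tn R n.
    have /andP[a0 a1] := lnp_bounds (tn_bounds R n).
    by rewrite ger0_norm// (le_trans a1)//; lra.
  have bL : `|- beta R n| <= 2 * tn R n.
    have /andP[a0 a1] := lnm_bounds (tn_bounds R n).
    by rewrite normrN ger0_norm.
  pose Y := th3 ((alpha R n)%:C * h) - th3 ((- beta R n)%:C * h).
  pose T := tn R n ^+ 3 * E ^+ 2.
  have t3 : 0 <= tn R n ^+ 3 by nonneg.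
  have T0 : 0 <= T by rewrite /T; nonneg.
  have tT : tn R n ^+ 3 <= T by rewrite ler_peMr.
  have YM : normc Y <= 128 * T * normc h ^+ 3.
    apply: le_trans (le_normcB _ _) _.
    have y1 := scaled_th3_cubic t0 t2 aL (lexx 1) h1.
    have y2 := scaled_th3_cubic t0 t2 bL (lexx 1) h1.
    apply: le_trans (lerD y1 y2) _; rewrite expr1n mulr1 -/E /T.
    by rewrite le_eqVlt; apply/orP; left; apply/eqP; ring.
  have c1 : `|c n| <= 4 * T.
    by apply: le_trans (rterm_lin R n) _; rewrite ler_pM2l.
  have e1 : `|e n| <= 3 * T.
    by apply: le_trans (rterm_sqr R n) _; rewrite ler_pM2l.
  have h31 : normc h ^+ 3 <= normc h by rewrite -[leRHS]expr1 ler_wiXn2l.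
  have h21 : normc h ^+ 2 <= normc h by rewrite -[leRHS]expr1 ler_wiXn2l.
  have rM : normc (rterm n h) <= 135 * T * normc h.
    rewrite /rterm -/(c n) -/(e n) -/Y; apply: le_trans (le_normcD _ _) _.
    apply: le_trans (lerD (le_normcD _ _) YM) _.
    rewrite !Normc.normcM !normc_real -?Normc.normcM -?expr2 ?normcX.
    have b1 : `|c n| * normc h <= 4 * T * normc h by rewrite ler_wpM2r.
    have b2 : `|e n| * (normc h * normc h) <= 3 * T * normc h.
      by apply: ler_pM; rewrite ?mulr_ge0// -expr2.
    have b3 : 128 * T * normc h ^+ 3 <= 128 * T * normc h.
      by rewrite ler_wpM2l// mulr_ge0.
    apply: le_trans (lerD (lerD b1 b2) b3) _.
    by rewrite le_eqVlt; apply/orP; left; apply/eqP; ring.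
  have nL : normc (h * (lnN R n)%:C) = normc h * lnN R n.
    by rewrite Normc.normcM normc_real ger0_norm.
  pose X := expR (d * lnN R n).
  have X1 : 1 <= X by rewrite /X -expR0 ler_expR; nonneg; exact: ltW.
  have tL : normc (th2 (h * (lnN R n)%:C)) <= 4 * (normc h ^+ 2 * lnN R n ^+ 2) * X.
    apply: le_trans (th2_le _) _; rewrite nL exprMn; apply: ler_wpM2l; first by nonneg.
    by rewrite ler_expR ler_wpM2r.
  have -> : powN h n * rterm n h - h * (c n)%:C - h ^+ 2 * (e n + c n * lnN R n)%:C =
      (lnN R n * e n)%:C * h ^+ 3 + (1 + h * (lnN R n)%:C) * Y +
      th2 (h * (lnN R n)%:C) * rterm n h.
    have -> : (lnN R n * e n)%:C = (lnN R n)%:C * (e n)%:C by exact: rmorphM.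
    have -> : (e n + c n * lnN R n)%:C = (e n)%:C + (c n)%:C * (lnN R n)%:C.
      by rewrite -rmorphM -rmorphD.
    rewrite /th2 -/(powN h n).
    rewrite [in LHS]/rterm [in RHS]/rterm -/(c n) -/(e n) -/Y.
    by ring.
  have b1 : normc ((lnN R n * e n)%:C * h ^+ 3) <= normc h ^+ 3 * (3 * T * lnN R n).
    rewrite Normc.normcM normc_real normcX mulrC ler_wpM2l ?exprn_ge0//.
    by rewrite normrM (ger0_norm L0) mulrC ler_wpM2r.
  have b2 : normc ((1 + h * (lnN R n)%:C) * Y) <= normc h ^+ 3 * (128 * T * (1 + lnN R n)).
    rewrite Normc.normcM.
    have -> : normc h ^+ 3 * (128 * T * (1 + lnN R n)) =
      (1 + lnN R n) * (128 * T * normc h ^+ 3) by ring.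
    apply: ler_pM => //; rewrite ?normc_ge0//.
    apply: le_trans (le_normcD _ _) _; rewrite normc1E lerD2l nL.
    by rewrite ler_piMl.
  have b3 : normc (th2 (h * (lnN R n)%:C) * rterm n h) <=
      normc h ^+ 3 * (540 * T * lnN R n ^+ 2 * X).
    rewrite Normc.normcM.
    have -> : normc h ^+ 3 * (540 * T * lnN R n ^+ 2 * X) =
      (4 * (normc h ^+ 2 * lnN R n ^+ 2) * X) * (135 * T * normc h) by ring.
    by apply: ler_pM => //; rewrite normc_ge0.
  apply: le_trans (le_normcD _ _) _.
  apply: le_trans (lerD (le_normcD _ _) (lexx _)) _.
  apply: le_trans (lerD (lerD b1 b2) b3) _.
  rewrite -!mulrDr ler_wpM2l ?exprn_ge0//.
  have ME : M n = 5600 * T * ((1 + lnN R n) ^+ 2 * X).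
    by rewrite /M cub_tn /= add0r -/X /T; ring.
  rewrite ME; have [L2 L1 L3] := lnN_sqr n.
  pose S := (1 + lnN R n) ^+ 2 * X.
  have X0 : 0 <= X by exact: le_trans ler01 X1.
  have LX : (1 + lnN R n) ^+ 2 <= S by rewrite /S ler_peMr// sqr_ge0.
  have q1 := ler_wpM2l T0 (le_trans L3 LX).
  have q2 := ler_wpM2l T0 (le_trans L1 LX).
  have q3 := ler_wpM2l T0 (ler_wpM2r X0 L2); rewrite -/S in q3.
  have Q0 : 0 <= T * S by rewrite /S; nonneg.
  rewrite -/S -(mulrA 3) -(mulrA 128) -(mulrA 5600) -(mulrA 540 T) -(mulrA 540) -(mulrA T).
  move: (T * _) (T * _) (T * _) (T * _) q1 q2 q3 Q0; clear => x y z t *; lra.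
pose l : R := ln (3 / 2).
pose p1 := csum (fun n => (c n)%:C) + l%:C.
pose p2 := csum (fun n => (e n + c n * lnN R n)%:C) + l%:C ^+ 2 / 2.
pose M' := 2 * rsum M + 8 * `|l| ^+ 3 * expR `|l|.
exists p1, p2, M', d; split=> // h hd.
have h1 : normc h <= 1 := le_trans hd d1.
have h0 := normc_ge0 h.
have s2 := cubic_summable z2 (cubic_rterm 0).
have srem : csummable (fun n => powN h n * rterm n h - h * (c n)%:C -
    h ^+ 2 * (e n + c n * lnN R n)%:C).
  by apply: csummable_le (rsummableZ (normc h ^+ 3) sM) => n; exact: remM.
have zE : zsum h = csum (fun n => powN h n * rterm n h - h * (c n)%:C -
    h ^+ 2 * (e n + c n * lnN R n)%:C) + (h * csum (fun n => (c n)%:C) +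
    h ^+ 2 * csum (fun n => (e n + c n * lnN R n)%:C)).
  have sc' := csummableZ h sc; have se' := csummableZ (h ^+ 2) se.
  rewrite -csumZ// -csumZ// -csumD// -csumD//; last exact: csummableD.
  by congr csum; apply/funext => n; ring.
have -> : zeta_num h - 1 - p1 * h - p2 * h ^+ 2 =
    csum (fun n => powN h n * rterm n h - h * (c n)%:C -
    h ^+ 2 * (e n + c n * lnN R n)%:C) + th3 (h * l%:C).
  by rewrite /zeta_num zE -/l /p1 /p2 /th3; field.
apply: le_trans (le_normcD _ _) _; rewrite /M' mulrDl; apply: lerD.
  apply: le_trans (normc_csum (g := fun n => normc h ^+ 3 * M n) _ _) _.
  - by move=> n; exact: remM.
  - exact: rsummableZ.
  - by rewrite rsumZ// le_eqVlt; apply/orP; left; apply/eqP; ring.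
apply: le_trans (th3_le _) _; rewrite Normc.normcM normc_real exprMn.
have -> : 8 * `|l| ^+ 3 * expR `|l| * normc h ^+ 3 =
  8 * (normc h ^+ 3 * `|l| ^+ 3) * expR `|l| by ring.
apply: ler_wpM2l; first by nonneg.
by rewrite ler_expR ler_piMl.
Qed.

Lemma zeta_num0 : zeta_num 0 = 1 :> R[i].
Proof.
have [p1 [p2 [M [r [r0 /(_ 0)]]]]] := zeta_num_taylor.
rewrite normc0E => /(_ (ltW r0)); rewrite expr0n mulr0 mulr0 !expr0n !mulr0 !subr0.
move=> h; have : normc (zeta_num 0 - 1 : R[i]) = 0.
  by apply/eqP; rewrite eq_le h normc_ge0.
by move/Normc.eq0_normc/eqP; rewrite subr_eq0 => /eqP.
Qed.

Lemma zeta_num_quotient : exists G : R[i] -> R[i], holomorphic_at G 0 /\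
  forall w, zeta_num w = 1 + w * G w.
Proof.
have [p1 [p2 [M [r [r0 T]]]]] := zeta_num_taylor.
(* The value at 0 is the derivative of [zeta_num] there; differentiability at 0 is the cubic
   estimate divided by h. *)
pose G (w : R[i]) := if w == 0 then p1 else (zeta_num w - 1) / w.
exists G; split; last first.
  move=> w; rewrite /G; have [->|w0] := eqVneq w 0.
    by rewrite zeta_num0 mul0r addr0.
  by rewrite mulrC mulfVK// subrKC.
apply/holomorphicP; exists 1 => // z; rewrite subr0 => z1.
have [->|z0] := eqVneq z 0.
  apply: (@derivable_quad _ _ _ p2 M r) => // h hr.
  rewrite add0r {2}/G eqxx /G; have [->|h0] := eqVneq h 0.
    by rewrite mul0r subrr subr0 normc0E expr0n mulr0.
  have hn : 0 < normc h.
    by rewrite lt0r normc_ge0 andbT; apply: contra_neq h0 => /Normc.eq0_normc.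
  rewrite -(ler_pM2r hn) -Normc.normcM -mulrA -exprSr.
  apply: le_trans (T h (ltW hr)); rewrite le_eqVlt; apply/orP; left; apply/eqP.
  by congr normc; field.
have h2 : Re z < 2.
  by have := Re_le_normc z; rewrite ler_norml => /andP[_ h]; lra.
have /holomorphicP[r' r'0 hf] : holomorphic_at (fun w => (zeta_num w - 1) / (w - 0)) z.
  apply holo_div => //; apply (@holoD _ (@zeta_num R) (fun=> -1) z); first exact: zeta_num_holo.
  exact: holo_cst.
have zz : derivable ((fun w => (zeta_num w - 1) / (w - 0)) : R[i]^o -> R[i]^o)
    (z : R[i]^o) 1 by apply hf; rewrite subrr normc0E.
refine (@near_eq_derivable R[i] R[i]^o R[i]^o _ _ _ _ _ zz).
apply/nearcP; exists (normc z).
  by rewrite lt0r normc_ge0 andbT; apply: contra_neq z0 => /Normc.eq0_normc.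
move=> w wz; rewrite /G ifN ?subr0//.
by apply: contraTneq wz => ->; rewrite sub0r normcN ltxx.
Qed.

(* Re w < 2 becomes Re s > 2 under w = 4 - s. *)
Definition zeta3 s : R[i] := zeta_num (4 - s) / (s - 4).

Lemma zeta_num_holo4 s : 2 < Re s -> holomorphic_at (fun s => zeta_num (4 - s)) s.
Proof.
move=> s2; apply (@holo_reflect _ (@zeta_num R) 4 s); apply zeta_num_holo.
by rewrite ReD ReN /=; lra.
Qed.

Lemma zeta3E s : 4 < Re s -> zeta3 s = csum (powN (3 - s)).
Proof.
move=> s4; rewrite /zeta3 zeta_numE; last by rewrite ReD ReN /=; lra.
have -> : 4 - s - 1 = 3 - s by ring.
have sn : s - 4 != 0.
  by apply: contraTneq s4 => /eqP; rewrite subr_eq0 => /eqP -> /=; rewrite ltxx.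
by field.
Qed.

Lemma zeta3_residue : exists G : R[i] -> R[i], holomorphic_at G 4 /\
  forall s, s != 4 -> zeta3 s = 1 / (s - 4) + G s.
Proof.
have [G [hG GE]] := zeta_num_quotient.
exists (fun s => (-1) * G (4 - s)); split.
  apply (@holoM _ (fun=> -1) (fun s => G (4 - s))); first exact: holo_cst.
  by apply (@holo_reflect _ G 4 4); rewrite subrr.
move=> s s4; rewrite /zeta3 GE; have : s - 4 != 0 by rewrite subr_eq0.
by move=> ?; field.
Qed.

Lemma zeta3_shift_holo (c : R[i]) s : 2 < Re (s + c) -> s + c != 4 ->
  holomorphic_at (fun s => zeta3 (s + c)) s.
Proof.
move=> s2 s4; have h : holomorphic_at zeta3 (s + c).
  by apply (@holo_div _ (fun s => zeta_num (4 - s))) => //; exact: zeta_num_holo4.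
(* The translation by c is a composition of two reflections, under which holomorphy is already known
   to be stable. *)
have e y : c - (0 - y) = y + c by ring.
have -> : (fun s => zeta3 (s + c)) = (fun y => zeta3 (c - (0 - y))).
  by apply/funext => y; rewrite e.
apply (@holo_reflect _ (fun y => zeta3 (c - y)) 0 s).
by apply (@holo_reflect _ zeta3 c); rewrite e.
Qed.

End ZetaResidue.

(** * The lattice *)

Section Decay.
Variables (R : realType) (X : Type).
Implicit Types (w : X -> nat) (f g : X -> R[i]).

(** The rate [th] is existential: a sum takes the larger rate, a bounded change of the weight costs
    a factor $th^{-B}$, and a polynomial factor costs a slower rate. *)
Definition decays w f := exists K th : R,
  [/\ 0 <= K, 0 < th < 1 & forall x, normc (f x) <= K * th ^+ w x].

Definition cbounded f := exists2 K : R, 0 <= K & forall x, normc (f x) <= K.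

Lemma expr_weaken (th th' : R) m n : 0 < th -> th <= th' -> th' < 1 -> (m <= n)%N ->
  th ^+ n <= th' ^+ m.
Proof.
move=> t0 tt t1 mn; apply: (@le_trans _ _ (th' ^+ n)).
  by rewrite lerXn2r ?nnegrE ?(ltW t0) ?(le_trans (ltW t0) tt).
by rewrite ler_wiXn2l ?(ltW t1) ?(le_trans (ltW t0) tt).
Qed.

Lemma decays_ext w f g : (forall x, normc (g x) <= normc (f x)) ->
  decays w f -> decays w g.
Proof.
move=> gf [K [th [K0 th0 fK]]]; exists K, th; split=> // x.
exact: le_trans (gf x) (fK x).
Qed.

Lemma decays0 w : decays w (fun=> 0).
Proof.
exists 0, (1 / 2); split => [||x]; rewrite ?normc0E ?mul0r//.
by apply/andP; split; lra.
Qed.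

Lemma decays_bounded w f : decays w f -> cbounded f.
Proof.
move=> [K [th [K0 /andP[t0 t1] fK]]]; exists K => // x.
apply: le_trans (fK x) _; rewrite ler_piMr// exprn_ile1// ltW//.
Qed.

Lemma decaysD w f g : decays w f -> decays w g -> decays w (fun x => f x + g x).
Proof.
move=> [K [th [K0 /andP[t0 t1] fK]]] [L [ph [L0 /andP[p0 p1] gL]]].
exists (K + L), (Num.max th ph); split.
- exact: addr_ge0.
- by rewrite lt_max t0 gt_max t1 p1.
move=> x; apply: le_trans (le_normcD _ _) _; rewrite mulrDl lerD//.
- apply: le_trans (fK x) _; rewrite ler_wpM2l//.
  by rewrite expr_weaken ?le_max ?lexx// gt_max t1.
- apply: le_trans (gL x) _; rewrite ler_wpM2l//.
  by rewrite expr_weaken ?le_max ?lexx ?orbT// gt_max t1.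
Qed.

Lemma decays_mull w f g : cbounded f -> decays w g -> decays w (fun x => f x * g x).
Proof.
move=> [M M0 fM] [K [th [K0 t01 gK]]]; exists (M * K), th; split=> // [|x].
  exact: mulr_ge0.
by rewrite Normc.normcM -mulrA; apply: ler_pM; rewrite ?normc_ge0.
Qed.

Lemma decays_mulr w f g : decays w f -> cbounded g -> decays w (fun x => f x * g x).
Proof.
move=> df bg; have := decays_mull bg df.
by apply: decays_ext => x; rewrite mulrC.
Qed.

Lemma cbounded_cst (c : R[i]) : cbounded (fun=> c).
Proof. by exists (normc c) => //; exact: normc_ge0. Qed.

Lemma cboundedD f g : cbounded f -> cbounded g -> cbounded (fun x => f x + g x).
Proof.
move=> [M M0 fM] [K K0 gK]; exists (M + K); first exact: addr_ge0.
by move=> x; apply: le_trans (le_normcD _ _) _; exact: lerD.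
Qed.

Lemma decays_weaken w w' f (B : nat) : (forall x, f x != 0 -> (w' x <= w x + B)%N) ->
  decays w f -> decays w' f.
Proof.
move=> ww [K [th [K0 /andP[t0 t1] fK]]]; exists (K * th ^- B), th; split.
- by rewrite mulr_ge0// invr_ge0 exprn_ge0// ltW.
- by rewrite t0.
move=> x; have [->|fx] := eqVneq (f x) 0.
  by have th0 := ltW t0; rewrite normc0E; nonneg.
apply: le_trans (fK x) _; rewrite -mulrA ler_wpM2l//.
rewrite mulrC ler_pdivlMr ?exprn_gt0// -exprD.
by rewrite expr_weaken// ww.
Qed.

(** Each of the n copies of $t^n$ is at most a different $t^i$ with $i < n$. *)
Lemma geom_mul_bound (t : R) n : 0 < t < 1 -> n%:R * t ^+ n <= (1 - t)^-1.
Proof.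
move=> /andP[t0 t1].
have h : n%:R * t ^+ n <= \sum_(i < n) t ^+ i.
  have -> : n%:R * t ^+ n = \sum_(i < n) t ^+ n by rewrite sumr_const card_ord mulr_natl.
  apply: ler_sum => i _.
  exact: (expr_weaken t0 (lexx _) t1 (ltnW (ltn_ord i))).
apply: le_trans h _; have s0 : 0 < 1 - t by rewrite subr_gt0.
rewrite -[leRHS]mul1r ler_pdivlMr// mulrC.
have := subrX1 t n => e.
have -> : (1 - t) * \sum_(i < n) t ^+ i = 1 - t ^+ n.
  by rewrite -[LHS]opprK -mulNr opprB -e opprB.
by rewrite gerBl exprn_ge0// ltW.
Qed.

(** With $th = t^2$, one factor $t^w$ absorbs the polynomial growth and the other one remains. *)
Lemma decays_poly w f (g : X -> R) (A B : R) : 0 <= A -> 0 <= B ->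
  (forall x, `|g x| <= A * (w x)%:R + B) ->
  decays w f -> decays w (fun x => (g x)%:C * f x).
Proof.
move=> A0 B0 gA [K [th [K0 /andP[t0 t1] fK]]].
pose t := Num.sqrt th; have tt : t ^+ 2 = th by rewrite sqr_sqrtr// ltW.
have s0 : 0 < t by rewrite sqrtr_gt0.
have s1 : t < 1 by rewrite -sqrtr1 ltr_sqrt.
have i0 : 0 < (1 - t)^-1 by rewrite invr_gt0 subr_gt0.
exists ((A * (1 - t)^-1 + B) * K), t; split; [|by rewrite s0|].
  by rewrite mulr_ge0// addr_ge0// mulr_ge0// ltW.
move=> x; rewrite Normc.normcM normc_real.
apply: (@le_trans _ _ ((A * (w x)%:R + B) * (K * th ^+ w x))).
  by apply: ler_pM; rewrite ?normc_ge0.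
have e0 : 0 <= t ^+ w x by rewrite exprn_ge0// ltW.
have e1 : t ^+ w x <= 1 by rewrite exprn_ile1// ltW.
rewrite -tt -exprM mulnC exprM expr2.
have -> : (A * (w x)%:R + B) * (K * (t ^+ w x * t ^+ w x)) =
  (A * ((w x)%:R * t ^+ w x) + B * t ^+ w x) * (K * t ^+ w x) by ring.
rewrite -[leRHS]mulrA; apply: ler_wpM2r; first by rewrite mulr_ge0.
apply: lerD; first by rewrite ler_wpM2l// geom_mul_bound// s0.
by rewrite ler_piMr.
Qed.

End Decay.

Section LatticeCoordinates.
Implicit Types (p : lattice) (v : labels) (k : basis_index).

(* The lattice is the set of a, b, c, d in nat with a + b and c + d odd, where
   a = l + 1/2 - j + m2, b = l + 1/2 - j - m2, c = j + m1 and d = j - m1. *)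
Definition mk (a b c d : nat) : labels :=
  ((a%:R + b%:R + c%:R + d%:R - 1) / 2, (c%:R - d%:R) / 2, (a%:R - b%:R) / 2,
   (c%:R + d%:R) / 2).

Lemma in_range_mk a b c d : odd (a + b) -> odd (c + d) -> in_range (mk a b c d).
Proof.
have half m n : odd (m + n) -> exists x, (m%:R + n%:R = 2 * x%:R + 1 :> rat).
  move=> o; exists (m + n)./2; rewrite -natrD -{1}(odd_double_half (m + n)) o.
  by rewrite natrD -mul2n natrM addrC.
have nmin (m n : nat) : (((m%:R + n%:R) / 2 - `|(m%:R - n%:R) / 2| : rat) \is a Num.nat).
  have [mn|nm] := leqP m n.
    rewrite (_ : _ - _ = m%:R) ?natr_nat// ler0_norm; first by field.
    have : (m%:R <= n%:R :> rat) by rewrite ler_nat.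
    by lra.
  rewrite (_ : _ - _ = n%:R) ?natr_nat// ger0_norm; first by field.
  have : (n%:R <= m%:R :> rat) by rewrite ler_nat ltnW.
  by lra.
move=> /half[x xE] /half[y yE]; rewrite /in_range /mk; apply/and5P; split.
- by rewrite (_ : _ - _ = (x + y)%:R) ?natr_nat// natrD; lra.
- by rewrite (_ : _ - _ = y%:R) ?natr_nat//; lra.
- by rewrite (_ : _ - _ = x%:R) ?natr_nat//; lra.
- exact: nmin.
- rewrite (_ : (_ / 2 + _ - _ = (a%:R + b%:R) / 2)); first exact: nmin.
  by lra.
Qed.

(** [split_nat] is used for $(l + 1/2 - j, m_2)$ and for $(j, m_1)$: if s is a half-integer and $s -
    |m|$ a natural number, then $s + m$ and $s - m$ are natural numbers with the odd sum $2s$. *)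
Lemma in_rangeE v : in_range v ->
  exists a b c d, [/\ odd (a + b), odd (c + d) & v = mk a b c d].
Proof.
have split_nat (s : rat) (n : nat) (m : rat) : (s = n%:R + 1 / 2) ->
    ((s - `|m|) \is a Num.nat) ->
    exists a b, [/\ odd (a + b), (s + m = a%:R) & (s - m = b%:R)].
  move=> sE /natrP[k kE].
  have kn : (k <= (2 * n).+1)%N.
    rewrite -(@ler_nat rat) -natr1 natrM -kE; have := normr_ge0 m.
    by have := ler0n rat n; lra.
  have o : odd (k + ((2 * n).+1 - k)) by rewrite subnKC// /= mul2n odd_double.
  have E : ((((2 * n).+1 - k)%N)%:R = 2 * n%:R + 1 - k%:R :> rat).
    by rewrite natrB// -natr1 natrM.
  have [m0|m0] := leP 0%R m.
    rewrite ger0_norm// in kE; exists ((2 * n).+1 - k)%N, k; rewrite addnC; split=> //.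
    by rewrite E; lra.
  rewrite ltr0_norm// in kE; exists k, ((2 * n).+1 - k)%N; split=> //; first by lra.
  by rewrite E; lra.
case: v => [[[l m1] m2] j] /and5P[_ /natrP[y yE] /natrP[x xE] r1 r2].
have jE : (j = y%:R + 1 / 2) by lra.
have lE : (l + 2^-1 - j = x%:R + 1 / 2) by lra.
have [a [b [ab aE bE]]] := split_nat _ _ _ lE r2.
have [c [d [cd' cE dE]]] := split_nat _ _ _ jE r1.
exists a, b, c, d; split=> //; rewrite /mk; congr (_, _, _, _); lra.
Qed.

Definition ca p := Num.truncn ((val p).1.1.1 + 2^-1 - (val p).2 + (val p).1.2).
Definition cb p := Num.truncn ((val p).1.1.1 + 2^-1 - (val p).2 - (val p).1.2).
Definition cc p := Num.truncn ((val p).2 + (val p).1.1.2).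
Definition cd p := Num.truncn ((val p).2 - (val p).1.1.2).

Lemma coord_mk p a b c d : val p = mk a b c d ->
  [/\ ca p = a, cb p = b, cc p = c & cd p = d].
Proof.
move=> E; rewrite /ca /cb /cc /cd E /mk /=; split.
- by transitivity (Num.truncn (a%:R : rat)); [congr Num.truncn; lra|exact: natrK].
- by transitivity (Num.truncn (b%:R : rat)); [congr Num.truncn; lra|exact: natrK].
- by transitivity (Num.truncn (c%:R : rat)); [congr Num.truncn; lra|exact: natrK].
- by transitivity (Num.truncn (d%:R : rat)); [congr Num.truncn; lra|exact: natrK].
Qed.

Lemma coordE p : [/\ odd (ca p + cb p), odd (cc p + cd p) &
  val p = mk (ca p) (cb p) (cc p) (cd p)].
Proof.
have [a [b [c [d [ab cd' E]]]]] := in_rangeE (valP p).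
by have [-> -> -> ->] := coord_mk E.
Qed.

Lemma coordR p : [/\ ((ca p)%:R = (val p).1.1.1 + 2^-1 - (val p).2 + (val p).1.2),
  ((cb p)%:R = (val p).1.1.1 + 2^-1 - (val p).2 - (val p).1.2),
  ((cc p)%:R = (val p).2 + (val p).1.1.2) &
  ((cd p)%:R = (val p).2 - (val p).1.1.2)].
Proof.
have [_ _ E] := coordE p; rewrite E /mk /=; split; lra.
Qed.

Lemma l_ofE p : (l_of p = ((ca p)%:R + (cb p)%:R + (cc p)%:R + (cd p)%:R - 1) / 2).
Proof. by have [_ _ E] := coordE p; rewrite /l_of E. Qed.

End LatticeCoordinates.

Section Shifts.
Variable R : realType.
Implicit Types (p : lattice) (v : labels) (k : basis_index) (f : bool).

Definition addl (u v : labels) : labels :=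
  (u.1.1.1 + v.1.1.1, u.1.1.2 + v.1.1.2, u.1.2 + v.1.2, u.2 + v.2).
Definition negl (v : labels) : labels := (- v.1.1.1, - v.1.1.2, - v.1.2, - v.2).
Definition zl : labels := (0, 0, 0, 0).

Lemma addlA u v w : addl u (addl v w) = addl (addl u v) w.
Proof. by rewrite /addl /= !addrA. Qed.
Lemma addlK u v : addl (addl u v) (negl v) = u.
Proof. by case: u => [[[? ?] ?] ?]; rewrite /addl /= !addrK. Qed.
Lemma addlNK u v : addl (addl u (negl v)) v = u.
Proof. by case: u => [[[? ?] ?] ?]; rewrite /addl /= !subrK. Qed.
Lemma addl0 u : addl u zl = u.
Proof. by case: u => [[[? ?] ?] ?]; rewrite /addl /= !addr0. Qed.
Lemma addl_eq0 u v : addl u v = u -> v = zl.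
Proof.
case: u v => [[[? ?] ?] ?] [[[? ?] ?] ?]; rewrite /addl /= => -[] a b c d.
by congr (_, _, _, _); lra.
Qed.

Definition flip k : basis_index := (~~ k.1, k.2).

(** The shift is made on labels, where it is invertible, and only the result is tested for
    membership in the lattice. [None] stands for an omitted term, which [kt] turns into the zero
    vector. *)
Definition mv f v k : option basis_index :=
  omap (fun p => (k.1 (+) f, p)) (insub (addl (val k.2) v)).

Definition kt (o : option basis_index) : hilbert R := if o is Some k then Defs.basis R k else 0.

Lemma mvP f v k k' : mv f v k = Some k' <->
  k'.1 = k.1 (+) f /\ val k'.2 = addl (val k.2) v.
Proof.
rewrite /mv; case: insubP => [p ip pE|np] /=; split=> //.
- by move=> [<-].
- move=> [e1 e2]; congr Some; apply: injective_projections => //=.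
  by apply: val_inj; rewrite /= pE.
- by move=> [_ e]; move: np; rewrite -e (valP k'.2).
Qed.

Lemma mv_flip f v k : mv f v (flip k) = omap flip (mv f v k).
Proof.
by rewrite /mv /flip /=; case: insubP => //= p _ _; rewrite addNb.
Qed.

Lemma mv_negb f v k : mv (~~ f) v k = omap flip (mv f v k).
Proof.
by rewrite /mv /flip /=; case: insubP => //= p _ _; rewrite addbN.
Qed.

Lemma mv_mv f f' v v' k k' : mv f v k = Some k' ->
  mv f' v' k' = mv (f (+) f') (addl v v') k.
Proof. by move=> /mvP[e1 e2]; rewrite /mv e1 e2 addlA addbA. Qed.

Lemma mv_inv f v k k' : (mv f v k == Some k') = (mv f (negl v) k' == Some k).
Proof.
apply/eqP/eqP => /mvP[e1 e2]; apply/mvP.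
  by rewrite e1 e2 addlK addbK.
by rewrite e1 e2 addlNK addbK.
Qed.

Lemma mv_id f v k : (mv f v k == Some k) = ~~ f && (v == zl).
Proof.
apply/eqP/idP => [/mvP[e1 e2]|/andP[/negbTE -> /eqP ->]].
  rewrite (addl_eq0 (esym e2)) eqxx andbT.
  by move: e1; case: f; case: (k.1).
by apply/mvP; rewrite addbF addl0.
Qed.

Lemma kt_val o k : kt o k = (o == Some k)%:R.
Proof.
case: o => [k'|] //=; rewrite [k == k']eq_sym.
by have [->|ne] := eqVneq k' k; [rewrite eqxx|case: eqP => // -[e]; rewrite e eqxx in ne].
Qed.

Lemma ketE (c : bool) (l m1 m2 j : rat) k : ket R (k.1 (+) c)
    ((val k.2).1.1.1 + l) ((val k.2).1.1.2 + m1) ((val k.2).1.2 + m2) ((val k.2).2 + j) =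
  kt (mv c (l, m1, m2, j) k).
Proof. by rewrite /ket /mv; case: insub. Qed.

Definition sz k : nat := (ca k.2 + cb k.2 + cc k.2 + cd k.2)%N.
Definition ac k : nat := (ca k.2 + cc k.2)%N.

Lemma shift_coord f v k k' : mv f v k = Some k' ->
  [/\ (ca k'.2)%:R = (ca k.2)%:R + (v.1.1.1 - v.2 + v.1.2),
      (cb k'.2)%:R = (cb k.2)%:R + (v.1.1.1 - v.2 - v.1.2),
      (cc k'.2)%:R = (cc k.2)%:R + (v.2 + v.1.1.2) &
      (cd k'.2)%:R = (cd k.2)%:R + (v.2 - v.1.1.2)].
Proof.
move=> /mvP[_ e]; have [-> -> -> ->] := coordR k.2.
by have [-> -> -> ->] := coordR k'.2; rewrite e /=; split; ring.
Qed.

(** The bound depends on v only, so shifts change exponential weights by bounded factors. *)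
Lemma shift_bound v : exists B : nat, forall f k k', mv f v k = Some k' ->
  (ac k <= ac k' + B)%N /\ (sz k <= sz k' + B)%N.
Proof.
have ub (x : rat) : exists B : nat, x <= B%:R.
  by exists (Num.truncn x).+1; apply: ltW; exact: truncnS_gt.
have [B1 h1] := ub (- (v.1.1.1 - v.2 + v.1.2) - (v.2 + v.1.1.2)).
have [B2 h2] := ub (- (v.1.1.1 - v.2 - v.1.2) - (v.2 - v.1.1.2)).
exists (B1 + B2)%N => f k k' /shift_coord[e1 e2 e3 e4].
have p1 : 0 <= B1%:R :> rat by []; have p2 : 0 <= B2%:R :> rat by [].
by split; rewrite -(ler_nat rat) /ac /sz !natrD; lra.
Qed.

Lemma eigenvalue_coord p : Defs.eigenvalue R p = (sz (true, p))%:R / 2 + 1.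
Proof.
rewrite /Defs.eigenvalue l_ofE /sz /=.
have -> : ((ca p)%:R + (cb p)%:R + (cc p)%:R + (cd p)%:R - 1) / 2 + 3 / 2 =
  (ca p + cb p + cc p + cd p)%:R / 2 + 1 :> rat by rewrite !natrD; field.
by rewrite rmorphD rmorph1 fmorph_div !rmorph_nat.
Qed.

Lemma eigenvalue_shift f v k k' : mv f v k = Some k' ->
  Defs.eigenvalue R k'.2 = Defs.eigenvalue R k.2 + ratr v.1.1.1.
Proof.
move=> /mvP[_ e]; rewrite /Defs.eigenvalue /l_of e /= -[RHS]rmorphD; congr (ratr _).
by ring.
Qed.

(* The shift a += 2z, c += 2y, with b and d fixed. *)
Definition ms (z y : int) : labels := ((z + y)%:~R, y%:~R, z%:~R, y%:~R).

Lemma ms_coord f z y k k' : mv f (ms z y) k = Some k' ->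
  (ca k'.2)%:Z = (ca k.2)%:Z + 2 * z /\ (cc k'.2)%:Z = (cc k.2)%:Z + 2 * y.
Proof.
move=> /shift_coord[e1 _ e3 _]; split; apply: (@intr_inj rat).
  rewrite rmorphD rmorphM /= -[X in X = _]/((ca k'.2)%:R : rat) e1 /ms /= rmorphD /=.
  rewrite -[X in _ = X + _]/((ca k.2)%:R : rat).
  by ring.
rewrite rmorphD rmorphM /= -[X in X = _]/((cc k'.2)%:R : rat) e3 /ms /=.
rewrite -[X in _ = X + _]/((cc k.2)%:R : rat).
by ring.
Qed.

Lemma odd_shift (x y : nat) (z : int) : x%:Z = y%:Z + 2 * z -> odd x = odd y.
Proof.
case: z => n e.
  have -> : x = (y + n.*2)%N by lia.
  by rewrite oddD odd_double addbF.
have -> : y = (x + n.+1.*2)%N by lia.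
by rewrite oddD odd_double addbF.
Qed.

(** b and d are fixed and the parities of a and c are preserved, so the lattice is left only when a
    or c becomes negative. *)
Lemma ms_None f z y k : mv f (ms z y) k = None ->
  0 <= (ca k.2)%:Z + 2 * z -> (cc k.2)%:Z + 2 * y < 0.
Proof.
move=> mN a0; rewrite ltNge; apply/negP => c0.
have [par1 par2 E] := coordE k.2.
have [a aE] : exists a : nat, a%:Z = (ca k.2)%:Z + 2 * z.
  by exists (absz ((ca k.2)%:Z + 2 * z)); rewrite gez0_abs.
have [c cE] : exists c : nat, c%:Z = (cc k.2)%:Z + 2 * y.
  by exists (absz ((cc k.2)%:Z + 2 * y)); rewrite gez0_abs.
have odda : odd (a + cb k.2) by rewrite oddD (odd_shift aE) -oddD.
have oddc : odd (c + cd k.2) by rewrite oddD (odd_shift cE) -oddD.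
have caR : a%:R = (ca k.2)%:R + 2 * z%:~R :> rat.
  by have := congr1 (fun x : int => x%:~R : rat) aE; rewrite rmorphD rmorphM.
have ccR : c%:R = (cc k.2)%:R + 2 * y%:~R :> rat.
  by have := congr1 (fun x : int => x%:~R : rat) cE; rewrite rmorphD rmorphM.
have e : addl (val k.2) (ms z y) = mk a (cb k.2) c (cd k.2).
  by rewrite E /addl /ms /mk /= caR ccR rmorphD /=; congr (_, _, _, _); field.
move: mN; rewrite /mv e; case: insubP => //= np _.
by move/negP: np; apply; exact: in_range_mk.
Qed.

End Shifts.

(** * Tame operators *)

Section TameOperators.
Variable R : realType.
Implicit Types (v : labels) (k : basis_index) (f b : bool) (C : basis_index -> hilbert R).
Local Notation ebasis := (Defs.basis R).

Definition mainfun (kappa : R[i]) (phi : nat -> R[i]) :=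
  decays id (fun n => phi n - kappa).

(* Main terms change only a and c, with a coefficient phi(a) = kappa + O(th^a);
   error terms are O(th^(a+c)), and O(th^(a+b+c+d)) up to the exchange of the
   two chiralities. Both produce no vector outside of the lattice, and only
   this matters at b = 0 and d = 0. The second argument is the symbol, evaluated
   at the two characters b of the exchange of chiralities. *)
Inductive tame : (basis_index -> hilbert R) -> (bool -> R -> R[i]) -> Prop :=
| tame0 : tame (fun=> 0) (fun _ _ => 0)
| tameD C C' p p' : tame C p -> tame C' p' ->
    tame (fun k => C k + C' k) (fun b t => p b t + p' b t)
| tame_main f (z y : int) kappa phi : mainfun kappa phi -> (y <> 0 -> kappa = 0) ->
    tame (fun k => phi (ca k.2) *: kt R (mv f (ms z y) k))
      (fun b t => (-1) ^+ (b && f) * kappa * circle_u t ^ z)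
| tame_err f v psi : decays ac psi -> decays sz (fun k => psi k - psi (flip k)) ->
    tame (fun k => psi k *: kt R (mv f v k)) (fun _ _ => 0).

Lemma tame_eq C C' p p' : tame C p -> (forall k, C k = C' k) ->
  (forall b t, p b t = p' b t) -> tame C' p'.
Proof.
move=> h /funext <- e.
by have <- : p = p' by apply/funext => b; apply/funext => t.
Qed.

(** Where the shifted vector is outside of the lattice the coefficient may be replaced by 0.
    Estimates are then needed only where the target exists, which is also where the arguments of the
    square roots are under control. *)
Lemma tame_err_range f v psi :
  decays ac (fun k => if mv f v k is Some _ then psi k else 0) ->
  decays sz (fun k => if mv f v k is Some _ then psi k - psi (flip k) else 0) ->
  tame (fun k => psi k *: kt R (mv f v k)) (fun _ _ => 0).
Proof.
move=> h1 h2; apply: (tame_eq (tame_err f v h1 _)) => //.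
  apply: decays_ext h2 => k; rewrite mv_flip.
  by case: (mv f v k) => [?|] /=; rewrite ?subrr ?normc0E.
by move=> k; case: (mv f v k) => [?|] //=; rewrite !scaler0.
Qed.

(** What main and error coefficients have in common, and all that the chirality condition on a
    product requires. *)
Definition even_up_to_sz (psi : basis_index -> R[i]) :=
  cbounded psi /\ decays sz (fun k => psi k - psi (flip k)).

Lemma mainfun_bounded kappa phi : mainfun kappa phi -> cbounded phi.
Proof.
move=> /decays_bounded h; have := cboundedD h (cbounded_cst _ kappa).
by move=> [K K0 hK]; exists K => // n; have := hK n; rewrite subrK.
Qed.

Lemma main_even kappa phi : mainfun kappa phi ->
  even_up_to_sz (fun k => phi (ca k.2)).
Proof.
move=> /mainfun_bounded [K K0 hK]; split; first by exists K.
by apply: decays_ext (decays0 _ sz) => k; rewrite subrr.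
Qed.

Lemma err_even psi : decays ac psi -> decays sz (fun k => psi k - psi (flip k)) ->
  even_up_to_sz psi.
Proof. by move=> /decays_bounded. Qed.

Section Product.
Variables (f : bool) (v : labels) (psi psi' : basis_index -> R[i]).

(** It is 0 when the intermediate vector is outside of the lattice, even if the composed shift lands
    inside. *)
Definition prodcoef k := if mv f v k is Some k' then psi k * psi' k' else 0.

(** The usual splitting of a difference of products. The second factor is taken at the shifted
    index, which changes [sz] by a bounded amount. *)
Lemma prodcoef_even : even_up_to_sz psi -> even_up_to_sz psi' ->
  decays sz (fun k => prodcoef k - prodcoef (flip k)).
Proof.
move=> [b1 d1] [[K' K'0 hK'] d2]; have [B hB] := shift_bound v.
have D1 : decays sz (fun k => if mv f v k is Some k'
    then (psi k - psi (flip k)) * psi' k' else 0).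
  have bd : cbounded (fun k => if mv f v k is Some k' then psi' k' else 0).
    by exists K' => // k; case: (mv f v k) => [?|]; rewrite ?normc0E.
  apply: decays_ext (decays_mulr d1 bd) => k.
  by case: (mv f v k) => [?|]; rewrite ?mulr0.
have D2 : decays sz (fun k => if mv f v k is Some k'
    then psi (flip k) * (psi' k' - psi' (flip k')) else 0).
  have [K [th [K0 /andP[t0 t1] hK]]] := d2; have [M M0 hM] := b1.
  exists (M * (K * th ^- B)), th; have th0 := ltW t0; split; first by nonneg.
    by rewrite t0.
  move=> k; case E : (mv f v k) => [k'|]; last by rewrite normc0E; nonneg.
  rewrite Normc.normcM -mulrA; apply: ler_pM; rewrite ?normc_ge0//.
  apply: le_trans (hK k') _; rewrite -mulrA ler_wpM2l//.
  rewrite mulrC ler_pdivlMr ?exprn_gt0// -exprD expr_weaken//.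
  by have [] := hB _ _ _ E.
apply: decays_ext (decaysD D1 D2) => k; rewrite /prodcoef mv_flip.
case: (mv f v k) => [k'|] /=; last by rewrite subrr addr0.
by rewrite le_eqVlt; apply/orP; left; apply/eqP; congr normc; ring.
Qed.

Lemma prodcoef_decaysl : decays ac psi -> cbounded psi' -> decays ac prodcoef.
Proof.
move=> d1 [K' K'0 hK'].
have bd : cbounded (fun k => if mv f v k is Some k' then psi' k' else 0).
  by exists K' => // k; case: (mv f v k) => [?|]; rewrite ?normc0E.
apply: decays_ext (decays_mulr d1 bd) => k; rewrite /prodcoef.
by case: (mv f v k) => [?|]; rewrite ?mulr0.
Qed.

Lemma prodcoef_decaysr : cbounded psi -> decays ac psi' -> decays ac prodcoef.
Proof.
move=> [M M0 hM] [K [th [K0 /andP[t0 t1] hK]]]; have [B hB] := shift_bound v.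
exists (M * (K * th ^- B)), th; have th0 := ltW t0; split; first by nonneg.
  by rewrite t0.
move=> k; rewrite /prodcoef; case E : (mv f v k) => [k'|]; last by rewrite normc0E; nonneg.
rewrite Normc.normcM -mulrA; apply: ler_pM; rewrite ?normc_ge0//.
apply: le_trans (hK k') _; rewrite -mulrA ler_wpM2l//.
rewrite mulrC ler_pdivlMr ?exprn_gt0// -exprD expr_weaken//.
by have [] := hB _ _ _ E.
Qed.

End Product.

(** The image of a single term, with shift v and coefficient psi, under the operator with columns C;
    compositions are built from it. *)
Definition after C f v (psi : basis_index -> R[i]) k : hilbert R :=
  psi k *: (if mv f v k is Some k' then C k' else 0).

Lemma after_term f v psi f' v' psi' k :
  after (fun k => psi' k *: kt R (mv f' v' k)) f v psi k =
  prodcoef f v psi psi' k *: kt R (mv (f (+) f') (addl v v') k).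
Proof.
rewrite /after /prodcoef; case E : (mv f v k) => [k'|]; last by rewrite scale0r scaler0.
by rewrite scalerA (mv_mv _ _ E).
Qed.

Lemma afterD C C' f v psi k : after (fun k => C k + C' k) f v psi k =
  after C f v psi k + after C' f v psi k.
Proof.
by rewrite /after -scalerDr; case: (mv f v k) => [?|]; rewrite ?addr0.
Qed.

Lemma after_err C p f v psi : tame C p -> decays ac psi ->
  decays sz (fun k => psi k - psi (flip k)) ->
  tame (after C f v psi) (fun _ _ => 0).
Proof.
move=> tC d1 d2; have ev := err_even d1 d2; elim: tC.
- apply: (tame_eq tame0) => // k; rewrite /after.
  by case: (mv f v k) => [?|]; rewrite scaler0.
- move=> C1 C2 p1 p2 _ t1 _ t2; apply: (tame_eq (tameD t1 t2)) => [k|b t].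
    by rewrite afterD.
  by rewrite addr0.
- move=> f' z y kappa phi mphi _.
  have me := main_even mphi.
  have e1 := @prodcoef_decaysl f v _ _ d1 me.1.
  have e2 := @prodcoef_even f v _ _ ev me.
  apply: (tame_eq (tame_err (f (+) f') (addl v (ms z y)) e1 e2)) => // k.
  by rewrite after_term.
- move=> f' v' psi' d1' d2'.
  have me := err_even d1' d2'.
  have e1 := @prodcoef_decaysl f v _ _ d1 me.1.
  have e2 := @prodcoef_even f v _ _ ev me.
  apply: (tame_eq (tame_err (f (+) f') (addl v v') e1 e2)) => // k.
  by rewrite after_term.
Qed.

(* The intermediate vector of a product of main terms is outside of the lattice
   when a + 2z < 0. *)
Definition mainprod (z : int) (phi phi' : nat -> R[i]) (n : nat) : R[i] :=
  if 0 <= n%:Z + 2 * z then phi n * phi' (absz (n%:Z + 2 * z)) else 0.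

Lemma mainprod_main z kappa kappa' phi phi' : mainfun kappa phi ->
  mainfun kappa' phi' -> mainfun (kappa * kappa') (mainprod z phi phi').
Proof.
move=> m1 m2; have [M' M'0 hM'] := mainfun_bounded m2.
have [K2 [th [K20 /andP[t0 t1] hK2]]] := m2; have th0 := ltW t0.
pose B := (2 * absz z)%N.
have wk (m n : nat) : (n <= m + B)%N -> th ^+ m <= th ^- B * th ^+ n.
  by move=> mn; rewrite mulrC ler_pdivlMr ?exprn_gt0// -exprD expr_weaken// addnC.
have D1 : decays id (fun n => (phi n - kappa) *
    (if 0 <= n%:Z + 2 * z then phi' (absz (n%:Z + 2 * z)) else 0)).
  apply: decays_mulr m1 _; exists M' => // n.
  by case: ifP => _ //; rewrite normc0E.
have D2 : decays id (fun n => kappa *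
    ((if 0 <= n%:Z + 2 * z then phi' (absz (n%:Z + 2 * z)) else 0) - kappa')).
  apply: decays_mull; first exact: cbounded_cst.
  exists ((K2 + normc kappa') * th ^- B), th; split.
  - by rewrite mulr_ge0 ?invr_ge0 ?exprn_ge0// addr_ge0// normc_ge0.
  - by rewrite t0.
  move=> n; rewrite -mulrA [(K2 + _) * _]mulrDl; case: ifP => nz.
    apply: (@le_trans _ _ (K2 * (th ^- B * th ^+ n))).
      apply: le_trans (hK2 _) _; rewrite ler_wpM2l// wk//.
      by rewrite /B; lia.
    by rewrite lerDl; nonneg.
  (* Here $n < 2|z|$, so the constant [kappa'] is itself at most a multiple of $th^n$. *)
  rewrite sub0r normcN.
  apply: (@le_trans _ _ (normc kappa' * (th ^- B * th ^+ n))); last first.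
    by rewrite lerDr; nonneg.
  rewrite ler_peMr ?normc_ge0// -[1](expr0 th) wk//.
  by rewrite /B; lia.
apply: decays_ext (decaysD D1 D2) => n; rewrite /mainprod le_eqVlt; apply/orP; left.
by apply/eqP; congr normc; case: ifP => _; ring.
Qed.

Lemma sign_andb_addb (b f f' : bool) :
  (-1) ^+ (b && (f (+) f')) = (-1) ^+ (b && f) * (-1) ^+ (b && f') :> R[i].
Proof.
by case: b f f' => [] [] []; rewrite /= ?expr0 ?expr1 ?mulrNN ?mulr1 ?mul1r.
Qed.

Lemma circle_u_neq0 (t : R) : circle_u t != 0.
Proof.
apply/eqP => /eqP; rewrite eq_complex /= => /andP[/eqP c0 /eqP s0].
by have := cos2Dsin2 t; rewrite c0 s0 !expr0n /= addr0 => /esym /eqP; rewrite oner_eq0.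
Qed.

(** Two main terms compose to the main term with coefficient [mainprod], corrected by [e] where the
    intermediate vector leaves the lattice through $c + 2y < 0$. This does not occur for $y = 0$.
    For $y \ne 0$, c is bounded there, so decay in a is enough, and it holds because [kappa] is 0.
    The product of the limits is 0 unless both terms fix c, so the composed term satisfies the
    condition of [tame_main]. *)
Lemma after_main C p f (z y : int) kappa phi : tame C p -> mainfun kappa phi ->
  (y <> 0 -> kappa = 0) -> tame (after C f (ms z y) (fun k => phi (ca k.2)))
    (fun b t => (-1) ^+ (b && f) * kappa * circle_u t ^ z * p b t).
Proof.
move=> tC mphi y0; have me := main_even mphi; elim: tC.
- apply: (tame_eq tame0) => [k|b t]; last by rewrite mulr0.
  by rewrite /after; case: (mv f _ k) => [?|]; rewrite scaler0.
- move=> C1 C2 p1 p2 _ t1 _ t2; apply: (tame_eq (tameD t1 t2)) => [k|b t].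
    by rewrite afterD.
  by rewrite mulrDr.
- move=> f' z' y' kappa' phi' mphi' y0'.
  have mp := mainprod_main z mphi mphi'.
  have yy : y + y' <> 0 -> kappa * kappa' = 0.
    move=> yn; have [yE|/eqP/y0 ->] := eqVneq y 0; last by rewrite mul0r.
    have [yE'|/eqP/y0' ->] := eqVneq y' 0; last by rewrite mulr0.
    by case: yn; rewrite yE yE'.
  have T1 := tame_main (f (+) f') (z + z') mp yy.
  pose v := ms (z + z') (y + y').
  have vE : addl (ms z y) (ms z' y') = v.
    by rewrite /v /addl /ms /= !rmorphD /=; congr (_, _, _, _); ring.
  pose e k := if mv f (ms z y) k is Some _ then 0 else - mainprod z phi phi' (ca k.2).
  have e1 : decays ac e.
    have [y0E|/eqP yn] := eqVneq y 0.
      apply: decays_ext (decays0 _ ac) => k; rewrite normc0E /e.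
      case E : (mv f _ k) => [?|]; first by rewrite normc0E.
      rewrite /mainprod; case: ifP => [a0|_]; last by rewrite oppr0 normc0E.
      by have := ms_None E a0; rewrite y0E mulr0 addr0 ltNge.
    have [K [th [K0 /andP[t0 t1] hK]]] : mainfun 0 (mainprod z phi phi').
      by move: mp; rewrite y0// mul0r.
    have th0 := ltW t0; pose B := (2 * absz y)%N.
    exists (K * th ^- B), th; split; [by nonneg|by rewrite t0|move=> k].
    rewrite /e; case E : (mv f _ k) => [?|]; first by rewrite normc0E; nonneg.
    rewrite normcN; have [a0|a0] := boolP (0 <= (ca k.2)%:Z + 2 * z); last first.
      by rewrite /mainprod ifN// normc0E; nonneg.
    have c0 := ms_None E a0.
    have := hK (ca k.2); rewrite subr0 => /le_trans; apply.
    rewrite -mulrA ler_wpM2l// mulrC ler_pdivlMr ?exprn_gt0// -exprD.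
    by rewrite expr_weaken// /ac /B; lia.
  have e2 : decays sz (fun k => e k - e (flip k)).
    apply: decays_ext (decays0 _ sz) => k; rewrite /e mv_flip.
    by case: (mv f _ k) => [?|] /=; rewrite subrr.
  have T2 := tame_err (f (+) f') v e1 e2.
  apply: (tame_eq (tameD T1 T2)) => [k|b t].
    rewrite after_term vE -scalerDl; congr (_ *: _).
    rewrite /prodcoef /e; case E : (mv f _ k) => [k'|]; last by rewrite subrr.
    have [aE _] := ms_coord E.
    by rewrite addr0 /mainprod -aE /= .
  rewrite addr0 expfzDr ?circle_u_neq0//.
  by rewrite sign_andb_addb; ring.
- move=> f' v' psi' d1' d2'.
  have me' := err_even d1' d2'.
  have e1 := @prodcoef_decaysr f (ms z y) _ _ me.1 d1'.
  have e2 := @prodcoef_even f (ms z y) _ _ me me'.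
  apply: (tame_eq (tame_err (f (+) f') (addl (ms z y) v') e1 e2)) => [k|b t].
    by rewrite after_term.
  by rewrite mulr0.
Qed.

Lemma tame_comp (T : hilbert R -> hilbert R) C p p' : linear T ->
  tame (fun k => T (ebasis k)) p -> tame C p' ->
  tame (fun k => T (C k)) (fun b t => p' b t * p b t).
Proof.
move=> linT tT; have T0 : T 0 = 0.
  by have := linT (-1) 0 0; rewrite scaler0 addr0 scaleN1r addNr.
have TD u w : T (u + w) = T u + T w by have := linT 1 u w; rewrite !scale1r.
have TZ c u : T (c *: u) = c *: T u by have := linT c u 0; rewrite T0 !addr0.
have Tterm f v psi k : T (psi k *: kt R (mv f v k)) =
    after (fun k => T (ebasis k)) f v psi k.
  by rewrite TZ /after; case: (mv f v k) => [?|] //=; rewrite T0.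
elim.
- by apply: (tame_eq tame0) => [k|b t]; rewrite ?T0 ?mul0r.
- move=> C1 C2 p1 p2 _ t1 _ t2; apply: (tame_eq (tameD t1 t2)) => [k|b t].
    by rewrite TD.
  by rewrite mulrDl.
- move=> f z y kappa phi mphi y0.
  apply: (tame_eq (after_main f z tT mphi y0)) => // k.
  by rewrite (Tterm _ _ (fun k => phi (ca k.2))).
- move=> f v psi d1 d2.
  by apply: (tame_eq (after_err f v tT d1 d2)) => [k|b t]; rewrite ?Tterm ?mul0r.
Qed.

Lemma tameZ C p (c : R[i]) : tame C p -> tame (fun k => c *: C k) (fun b t => c * p b t).
Proof.
elim.
- by apply: (tame_eq tame0) => [k|b t]; rewrite ?scaler0 ?mulr0.
- move=> C1 C2 p1 p2 _ t1 _ t2; apply: (tame_eq (tameD t1 t2)) => [k|b t].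
    by rewrite scalerDr.
  by rewrite mulrDr.
- move=> f z y kappa phi mphi y0.
  have m' : mainfun (c * kappa) (fun n => c * phi n).
    have := decays_mull (cbounded_cst _ c) mphi.
    by apply: decays_ext => n; rewrite mulrBr.
  have y0' : y <> 0 -> c * kappa = 0 by move=> /y0 ->; rewrite mulr0.
  apply: (tame_eq (tame_main f z m' y0')) => [k|b t]; first by rewrite scalerA.
  by ring.
- move=> f v psi d1 d2.
  have e1 := decays_mull (cbounded_cst _ c) d1.
  have e2 : decays sz (fun k => c * psi k - c * psi (flip k)).
    have := decays_mull (cbounded_cst _ c) d2.
    by apply: decays_ext => k; rewrite mulrBr.
  apply: (tame_eq (tame_err f v e1 e2)) => [k|b t]; first by rewrite scalerA.
  by rewrite mulr0.
Qed.

End TameOperators.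

(** * Adjoints and commutators of tame operators *)

Section TameClosure.
Variable R : realType.
Implicit Types (v : labels) (k : basis_index) (f b : bool) (C : basis_index -> hilbert R).
Local Notation ebasis := (Defs.basis R).

Lemma hilbertDE (u w : hilbert R) k : (u + w) k = u k + w k. Proof. by []. Qed.
Lemma hilbertZE c (u : hilbert R) k : (c *: u) k = c * u k. Proof. by []. Qed.

Lemma circle_u_conj (t : R) : (circle_u t)^*%C = (circle_u t)^-1.
Proof.
apply: (mulfI (circle_u_neq0 t)); rewrite divff ?circle_u_neq0//.
apply/eqP; rewrite eq_complex /=; apply/andP; split; apply/eqP.
  by rewrite mulrN opprK -!expr2 cos2Dsin2.
by rewrite mulrN [sin t * _]mulrC addNr.
Qed.

(** The conjugate transpose of a term has the opposite shift, with the conjugate coefficient read at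
    the source. On the circle, conjugation inverts [circle_u], in agreement with the sign of z. *)
Lemma tame_adj C p : tame C p -> exists2 C', tame C' (fun b t => (p b t)^*%C) &
  forall k k', C' k k' = (C k' k)^*%C.
Proof.
elim.
- exists (fun=> 0) => [|k k']; last by rewrite rmorph0.
  by apply: (tame_eq (tame0 R)) => // b t; rewrite rmorph0.
- move=> C1 C2 p1 p2 _ [D1 t1 e1] _ [D2 t2 e2].
  exists (fun k => D1 k + D2 k) => [|k k'].
    by apply: (tame_eq (tameD t1 t2)) => // b t; rewrite rmorphD.
  by rewrite hilbertDE e1 e2 -rmorphD.
- move=> f z y kappa phi mphi y0.
  (* For $a - 2z < 0$ there is no source vector; the value [kappa] makes the difference from the
     limit vanish there. *)
  pose phi' (n : nat) := (if 0 <= n%:Z - 2 * z then phi (absz (n%:Z - 2 * z)%R)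
    else kappa)^*%C.
  have m' : mainfun (kappa^*%C) phi'.
    have [K [th [K0 /andP[t0 t1] hK]]] := mphi; have th0 := ltW t0.
    pose B := (2 * absz z)%N.
    exists (K * th ^- B), th; split; [by nonneg|by rewrite t0|move=> n].
    rewrite /phi' -rmorphB normc_conj; case: ifP => nz.
      apply: le_trans (hK _) _; rewrite -mulrA ler_wpM2l//.
      rewrite [leRHS]mulrC ler_pdivlMr ?exprn_gt0// -exprD expr_weaken//.
      by rewrite /B; lia.
    by rewrite subrr normc0E; nonneg.
  have y0' : - y <> 0 -> kappa^*%C = 0 by move=> yn; rewrite y0 ?rmorph0//; lia.
  exists (fun k => phi' (ca k.2) *: kt R (mv f (ms (- z) (- y)) k)).
    apply: (tame_eq (tame_main f (- z) m' y0')) => // b t.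
    rewrite !rmorphM /= rmorph_sign; congr (_ * _).
    by rewrite -exprz_inv -circle_u_conj fmorphXz.
  move=> k k'; rewrite !hilbertZE !kt_val rmorphM rmorph_nat mv_inv.
  have -> : negl (ms (- z) (- y)) = ms z y.
    by rewrite /negl /ms -opprD !mulrNz !opprK.
  case: eqP => [E|_]; last by rewrite !mulr0.
  have [aE _] := ms_coord E.
  rewrite !mulr1 /phi' ; congr (_^*%C).
  have -> : (ca k.2)%:Z - 2 * z = (ca k'.2)%:Z by rewrite aE addrK.
  by [].
- move=> f v psi d1 d2.
  pose psi' k := if mv f (negl v) k is Some k' then (psi k')^*%C else 0.
  exists (fun k => psi' k *: kt R (mv f (negl v) k)); last first.
    move=> k k'; rewrite !hilbertZE !kt_val rmorphM rmorph_nat [in RHS]mv_inv /psi'.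
    case: (mv f (negl v) k) => [k1|]; last by rewrite mul0r mulr0.
    by case: eqP => [[->]|_]; rewrite ?mulr0.
  have one_even : even_up_to_sz (fun=> 1 : R[i]).
    split; first exact: cbounded_cst.
    by apply: decays_ext (decays0 R sz) => k; rewrite subrr.
  have d1' : decays ac (fun k => (psi k)^*%C).
    by apply: decays_ext d1 => k; rewrite normc_conj.
  have d2' : decays sz (fun k => (psi k)^*%C - (psi (flip k))^*%C).
    by apply: decays_ext d2 => k; rewrite -rmorphB normc_conj.
  have P : psi' = prodcoef f (negl v) (fun=> 1) (fun k => (psi k)^*%C).
    by apply/funext => k; rewrite /psi' /prodcoef; case: mv => // ?; rewrite mul1r.
  have e1 := @prodcoef_decaysr R f (negl v) _ _ (cbounded_cst _ 1) d1'.
  have e2 := @prodcoef_even R f (negl v) _ _ one_even (err_even d1' d2').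
  rewrite -P in e1 e2.
  by apply: (tame_eq (tame_err f (negl v) e1 e2)) => // b t; rewrite rmorph0.
Qed.

Lemma tame_abs_comm C p : tame C p -> exists C' p', tame C' p' /\
  forall k k', C' k k' = (Defs.eigenvalue R k'.2)%:C * C k k' -
    (Defs.eigenvalue R k.2)%:C * C k k'.
Proof.
elim.
- exists (fun=> 0), (fun _ _ => 0); split; first exact: tame0.
  by move=> k k'; rewrite !mulr0 subrr.
- move=> C1 C2 p1 p2 _ [D1 [q1 [t1 e1]]] _ [D2 [q2 [t2 e2]]].
  exists (fun k => D1 k + D2 k), (fun b t => q1 b t + q2 b t).
  by split=> [|k k']; [exact: tameD|rewrite !hilbertDE e1 e2; ring].
- move=> f z y kappa phi mphi y0.
  have t := tameZ (ratr (ms z y).1.1.1 : R)%:C (tame_main f z mphi y0).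
  eexists; eexists; split; first exact: t.
  move=> k k'; rewrite !hilbertZE !kt_val; case: eqP => [E|_]; last by rewrite !mulr0 subrr.
  by rewrite (eigenvalue_shift R E) rmorphD; ring.
- move=> f v psi d1 d2.
  have t := tameZ (ratr v.1.1.1 : R)%:C (tame_err f v d1 d2).
  eexists; eexists; split; first exact: t.
  move=> k k'; rewrite !hilbertZE !kt_val; case: eqP => [E|_]; last by rewrite !mulr0 subrr.
  by rewrite (eigenvalue_shift R E) rmorphD; ring.
Qed.

Lemma eigenvalue_decays psi : decays sz psi ->
  decays sz (fun k => (Defs.eigenvalue R k.2)%:C * psi k).
Proof.
apply: (@decays_poly R _ sz psi (fun k => Defs.eigenvalue R k.2) (1 / 2) 1) => // k.
by rewrite eigenvalue_coord ger0_norm// ?addr_ge0 ?divr_ge0// mulrC mul1r.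
Qed.

(** A term acquires the coefficient $N' psi(k) - N psi(flip k) = r psi(k) + N (psi(k) - psi(flip
    k))$, where r is the constant change of the eigenvalue. The last difference decays in [sz], in
    which N is affine, so it survives the factor N; for a main term it is 0. *)
Lemma tame_dirac_comm C p : tame C p -> exists C' p', tame C' p' /\
  forall k k', C' k k' = (Defs.eigenvalue R k'.2)%:C * C k (flip k') -
    (Defs.eigenvalue R k.2)%:C * C (flip k) k'.
Proof.
have flipK k : flip (flip k) = k by case: k => [] [].
have ktN f v k k' : (mv f v k == Some (flip k')) = (mv (~~ f) v k == Some k').
  rewrite mv_negb; case: (mv f v k) => [k1|] //=.
  by apply/eqP/eqP => -[] => [->|<-]; rewrite flipK.
have ktF f v k k' : (mv f v (flip k) == Some k') = (mv (~~ f) v k == Some k').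
  by rewrite mv_flip mv_negb.
elim.
- exists (fun=> 0), (fun _ _ => 0); split; first exact: tame0.
  by move=> k k'; rewrite !mulr0 subrr.
- move=> C1 C2 p1 p2 _ [D1 [q1 [t1 e1]]] _ [D2 [q2 [t2 e2]]].
  exists (fun k => D1 k + D2 k), (fun b t => q1 b t + q2 b t).
  by split=> [|k k']; [exact: tameD|rewrite !hilbertDE e1 e2; ring].
- move=> f z y kappa phi mphi y0.
  have t := tameZ (ratr (ms z y).1.1.1 : R)%:C (tame_main (~~ f) z mphi y0).
  eexists; eexists; split; first exact: t.
  move=> k k'; rewrite !hilbertZE !kt_val ktN ktF.
  case: eqP => [E|_]; last by rewrite !mulr0 subrr.
  by rewrite (eigenvalue_shift R E) rmorphD; ring.
- move=> f v psi d1 d2.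
  pose lam k := (Defs.eigenvalue R k.2)%:C : R[i].
  pose r := (ratr v.1.1.1 : R)%:C.
  pose psi' k := r * psi k + lam k * (psi k - psi (flip k)).
  have d3 := eigenvalue_decays d2.
  have d3' : decays ac (fun k => lam k * (psi k - psi (flip k))).
    by apply: (@decays_weaken _ _ _ _ _ 0%N _ d3) => k _; rewrite /ac /sz; lia.
  have e1 : decays ac psi'.
    by apply: decaysD d3'; exact: decays_mull (cbounded_cst _ _) d1.
  have e2 : decays sz (fun k => psi' k - psi' (flip k)).
    have := decaysD (decays_mull (cbounded_cst _ r) d2) (decaysD d3 d3).
    apply: decays_ext => k; rewrite le_eqVlt; apply/orP; left; apply/eqP; congr normc.
    by rewrite /psi' flipK /lam /=; ring.
  exists (fun k => psi' k *: kt R (mv (~~ f) v k)), (fun _ _ => 0).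
  split; first exact: tame_err.
  move=> k k'; rewrite !hilbertZE !kt_val ktN ktF.
  case: eqP => [E|_]; last by rewrite !mulr0 subrr.
  by rewrite (eigenvalue_shift R E) rmorphD /psi' /lam /r; ring.
Qed.

End TameClosure.

(** * Integrals over the circle and diagonals of tame operators *)

Section CircleIntegral.
Variable R : realType.
Implicit Types (h F : R -> R[i]) (c I : R[i]) (z : int).

Lemma cderZ c F h : cder F h -> cder (fun t => c * F t) (fun t => c * h t).
Proof.
move=> Fh t; have [f1 f2] := Fh t; case: c => a b.
have m (x : R) (u : R -> R) (du : R) : is_derive t 1 u du ->
    is_derive t 1 (fun t : R => x * u t) (x * du).
  move=> hu; apply: (is_derive_ext (is_deriveM (is_derive_cst x t (1:R)) hu)) => //.
  by rewrite /GRing.scale /= mulr0 addr0.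
split.
  apply: (is_derive_ext (is_deriveB (m a _ _ f1) (m b _ _ f2))) => [x|]; by rewrite ReM.
apply: (is_derive_ext (is_deriveD (m a _ _ f2) (m b _ _ f1))) => [x|]; by rewrite ImM.
Qed.

(** The derivative [h'] is required only to make h continuous, so that the fundamental theorem of
    calculus applies to the primitive F. Such data can be added and scaled, unlike bare values of
    [circle_integral], whose additivity needs integrability. *)
Definition cprim h I := exists F h', [/\ cder F h, cder h h' & F (2 * pi) - F 0 = I].

Lemma cprimD h1 h2 I1 I2 : cprim h1 I1 -> cprim h2 I2 ->
  cprim (fun t => h1 t + h2 t) (I1 + I2).
Proof.
move=> [F1 [d1 [a1 b1 c1]]] [F2 [d2 [a2 b2 c2]]].
exists (fun t => F1 t + F2 t), (fun t => d1 t + d2 t).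
by split; [exact: cderD|exact: cderD|rewrite -c1 -c2; ring].
Qed.

Lemma cprimZ c h I : cprim h I -> cprim (fun t => c * h t) (c * I).
Proof.
move=> [F [d [a b e]]]; exists (fun t => c * F t), (fun t => c * d t).
by split; [exact: cderZ|exact: cderZ|rewrite -e mulrBr].
Qed.

Lemma cprim_integral h I : cprim h I -> circle_integral h = I.
Proof.
move=> [F [d [Fh hd <-]]].
have pi2 : 0 < 2 * pi :> R by rewrite mulr_gt0// pi_gt0.
have ftc (f u du : R -> R) : (forall t : R, is_derive t 1 f (u t)) ->
    (forall t : R, is_derive t 1 u (du t)) ->
    \int[lebesgue_measure]_(t in `[0, 2 * pi]) u t = f (2 * pi) - f 0.
  move=> fu uu.
  have cf x : {for x, continuous f}.
    by apply/differentiable_continuous/derivable1_diffP; have [] := fu x.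
  rewrite /Rintegral (@continuous_FTC2 R u f 0 (2 * pi))//.
  - apply: derivable_within_continuous => x _; by have [] := uu x.
  - split.
    + by move=> x _; have [] := fu x.
    + by apply: cvg_at_right_filter; exact: cf.
    + by apply: cvg_at_left_filter; exact: cf.
  - by move=> x _; rewrite derive1E; have [_ ->] := fu x.
rewrite /circle_integral.
rewrite (ftc _ (fun t => Re (h t)) _ (fun t => (Fh t).1) (fun t => (hd t).1)).
rewrite (ftc _ (fun t => Im (h t)) _ (fun t => (Fh t).2) (fun t => (hd t).2)).
by case: (F _) (F _) => [? ?] [? ?].
Qed.

Lemma cexp_nat (w : R[i]) n : cexp w ^+ n = cexp (n%:R * w).
Proof.
elim: n => [|n ih]; first by rewrite mul0r cexp0 expr0.
by rewrite exprS ih -cexpD -natr1 mulrDl mul1r addrC.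
Qed.

Lemma circle_u_exp (t : R) z : circle_u t ^ z = cexp (t%:C * (0 +i* z%:~R)).
Proof.
have uE : circle_u t = cexp (t%:C * (0 +i* 1)).
  by rewrite /circle_u /cexp /= !mul0r mulr0 mulr1 subrr addr0 expR0 !mul1r.
have inv w : (cexp w)^-1 = cexp (- w) :> R[i].
  have : cexp w * cexp (- w) = 1 :> R[i] by rewrite -cexpD subrr cexp0.
  move=> e; have w0 : cexp w != 0 by apply: contra_eqN e => /eqP ->; rewrite mul0r eq_sym oner_eq0.
  by apply: (mulfI w0); rewrite divff// e.
have nat n : circle_u t ^+ n = cexp (t%:C * (0 +i* n%:R)).
  rewrite uE cexp_nat; congr cexp.
  have -> : (0 +i* n%:R) = n%:R * (0 +i* 1) :> R[i].
    apply/eqP; rewrite eq_complex; apply/andP; split; apply/eqP.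
      by rewrite ReM /= mulr0 mulr1 -(rmorph_nat (real_complex R)) /= oppr0 add0r.
    by rewrite ImM /= mulr0 mulr1 -(rmorph_nat (real_complex R)) /= addr0.
  by ring.
case: z => n; first exact: nat.
rewrite NegzE -exprnN nat inv; congr cexp; rewrite -mulrN; congr (_ * _).
by rewrite mulrNz; apply/eqP; rewrite eq_complex /= oppr0 !eqxx.
Qed.

Lemma cprim_circle z : cprim (fun t => circle_u t ^ z) (if z == 0 then (2 * pi)%:C else 0).
Proof.
pose w : R[i] := 0 +i* z%:~R.
have -> : (fun t => circle_u t ^ z) = (fun t : R => cexp (t%:C * w)).
  by apply/funext => t; exact: circle_u_exp.
have D := cder_cexp w.
have D2 := cderZ w D.
case: eqP => [z0|zn].
  have D1 := cder_pow (1 : R[i]) 1.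
  exists (fun t : R => (t ^+ 1)%:C * 1), (fun t => w * cexp (t%:C * w)).
  split=> //.
    have -> : (fun t : R => cexp (t%:C * w)) = (fun t : R => (1%:R * t ^+ 0)%:C * 1).
      apply/funext => t; rewrite /w z0 expr0 !mulr1 (_ : 0 +i* 0%:~R = 0)//.
      by rewrite mulr0 cexp0.
    exact: D1.
  by rewrite !expr1 !mulr1 rmorph0 subr0.
have w0 : w != 0 by rewrite eq_complex /= negb_and intr_eq0; apply/orP; right; apply/eqP.
exists (fun t : R => w^-1 * cexp (t%:C * w)), (fun t => w * cexp (t%:C * w)); split=> //.
  have E : (fun t : R => w^-1 * (w * cexp (t%:C * w))) = (fun t : R => cexp (t%:C * w)).
    by apply/funext => t; rewrite mulrA mulVf// mul1r.
  by have := cderZ w^-1 D; rewrite E.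
rewrite -mulrBr -!circle_u_exp.
have -> : circle_u (2 * pi) = 1 :> R[i].
  by rewrite /circle_u mulrC mulr_natr cos2pi sin2pi.
have -> : circle_u 0 = 1 :> R[i] by rewrite /circle_u cos0 sin0.
by rewrite subrr mulr0.
Qed.

End CircleIntegral.

Section Diagonal.
Variable R : realType.
Implicit Types (k : basis_index) (C : basis_index -> hilbert R).

Lemma ms_eq0 (z y : int) : (ms z y == zl) = (z == 0) && (y == 0).
Proof.
apply/eqP/andP => [[_ h1 h2 _]|[/eqP -> /eqP ->]].
  by rewrite -!(intr_eq0 rat) h1 h2.
by rewrite /ms addr0.
Qed.

(** Only terms with neither shift nor exchange reach the diagonal. For the symbol, the sum over the
    two characters kills the terms with an exchange, the integral kills those with $z \ne 0$, and
    [kappa] is 0 for those with $y \ne 0$. The constant 4 pi is 2 pi for each character. *)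
Lemma tame_diag C p : tame C p -> exists (kappa : R[i]) (g : nat -> R[i])
    (e : basis_index -> R[i]),
  [/\ decays id g, decays ac e, forall k, C k k = kappa + g (ca k.2) + e k &
   cprim (fun t => p false t + p true t) ((4 * pi)%:C * kappa)].
Proof.
elim.
- exists 0, (fun=> 0), (fun=> 0); split; [exact: decays0|exact: decays0| |].
    by move=> k; rewrite !addr0.
  rewrite mulr0; exists (fun=> 0), (fun=> 0).
  have E : (fun _ : R => 0 + 0 : R[i]) = fun=> 0 by apply/funext => t; rewrite addr0.
  by rewrite E; split; [exact: cder_cst|exact: cder_cst|rewrite subrr].
- move=> C1 C2 p1 p2 _ [k1 [g1 [e1 [h1 d1 c1 i1]]]] _ [k2 [g2 [e2 [h2 d2 c2 i2]]]].
  exists (k1 + k2), (fun n => g1 n + g2 n), (fun k => e1 k + e2 k); split.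
  + exact: decaysD.
  + exact: decaysD.
  + by move=> k; rewrite hilbertDE c1 c2; ring.
  + have := cprimD i1 i2; rewrite -mulrDr.
    have -> : (fun t => p1 false t + p1 true t + (p2 false t + p2 true t)) =
      (fun t => p1 false t + p2 false t + (p1 true t + p2 true t)).
      by apply/funext => t; ring.
    by [].
- move=> f z y kappa phi mphi y0.
  have -> : (fun t : R => (-1) ^+ (false && f) * kappa * circle_u t ^ z +
      (-1) ^+ (true && f) * kappa * circle_u t ^ z) =
      (fun t => ((1 + (-1) ^+ f) * kappa) * circle_u t ^ z).
    by apply/funext => t; rewrite expr0; ring.
  have I := cprimZ ((1 + (-1) ^+ f) * kappa) (cprim_circle R z).
  have [/andP[nf /andP[/eqP z0 /eqP yE]]|np] := boolP (~~ f && ((z == 0) && (y == 0))).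
    exists kappa, (fun n => phi n - kappa), (fun=> 0); split => //.
    + exact: decays0.
    + move=> k; rewrite hilbertZE kt_val mv_id ms_eq0 nf z0 yE !eqxx mulr1 addr0.
      by ring.
    + move: I; rewrite z0 eqxx (negbTE nf) expr0.
      have -> : (1 + 1) * kappa * (2 * pi)%:C = (4 * pi)%:C * kappa.
        by rewrite !rmorphM /= !rmorph_nat; ring.
      by [].
  exists 0, (fun=> 0), (fun=> 0); split; [exact: decays0|exact: decays0| |].
    by move=> k; rewrite hilbertZE kt_val mv_id ms_eq0 (negbTE np) mulr0 !addr0.
  rewrite mulr0; move: I; set c := _ * kappa * _; suff -> : c = 0 by [].
  rewrite /c; move: np; rewrite !negb_and negbK => /or3P[->|/negbTE ->|/eqP/y0 ->].
  + by rewrite expr1 subrr !mul0r.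
  + by rewrite mulr0.
  + by rewrite mulr0 mul0r.
- move=> f v psi d1 d2.
  exists 0, (fun=> 0), (fun k => psi k * (mv f v k == Some k)%:R); split.
  + exact: decays0.
  + apply: decays_mulr d1 _; exists 1 => // k.
    by case: (_ == _); rewrite ?normc1E ?normc0E.
  + by move=> k; rewrite hilbertZE kt_val !add0r.
  + rewrite mulr0; exists (fun=> 0), (fun=> 0).
    have E : (fun _ : R => 0 + 0 : R[i]) = fun=> 0 by apply/funext => t; rewrite addr0.
    by rewrite E; split; [exact: cder_cst|exact: cder_cst|rewrite subrr].
Qed.

End Diagonal.

(** * The coefficients of the generators *)

Section QNumbers.
Variables (R : realType) (q : R).
Hypotheses (q_gt0 : 0 < q) (q_lt1 : q < 1).
Implicit Types (x y z E F : rat) (u w : R).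

Local Notation qpow := (qpow q).
Local Notation qn := (qn q).

Lemma qpow_gt0 x : 0 < qpow x. Proof. exact: powR_gt0. Qed.
Lemma qpow_ge0 x : 0 <= qpow x. Proof. exact: powR_ge0. Qed.

Lemma qpowD x y : qpow (x + y) = qpow x * qpow y.
Proof. by rewrite /Defs.qpow rmorphD /= powRD// (gt_eqF q_gt0) implybT. Qed.

Lemma qpow0 : qpow 0 = 1. Proof. by rewrite /Defs.qpow rmorph0 powRr0. Qed.

Lemma qpowN x : qpow (- x) = (qpow x)^-1.
Proof.
apply: (mulfI (lt0r_neq0 (qpow_gt0 x))); rewrite -qpowD subrr qpow0 divff//.
exact: lt0r_neq0 (qpow_gt0 x).
Qed.

Lemma qpow_nat (n : nat) : qpow n%:R = q ^+ n.
Proof. by rewrite /Defs.qpow rmorph_nat powR_mulrn// ltW. Qed.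

Lemma qpow_le x y : x <= y -> qpow y <= qpow x.
Proof.
move=> xy; rewrite /Defs.qpow -[y](subrK x) rmorphD /= powRD ?(gt_eqF q_gt0) ?implybT//.
rewrite ler_piMl ?powR_ge0// /powR gt_eqF// -expR0 ler_expR.
rewrite mulr_ge0_le0 ?ler0q ?subr_ge0// ln_le0// ltW//.
Qed.

Lemma qpow_le1 x : 0 <= x -> qpow x <= 1.
Proof. by move=> x0; rewrite -qpow0 qpow_le. Qed.

Definition iq : R := q^-1 - q.

Lemma iq_gt0 : 0 < iq.
Proof.
rewrite subr_gt0; apply: (lt_trans q_lt1).
by rewrite -[ltLHS]invr1 ltf_pV2 ?posrE.
Qed.

(** In $[x] = q^{-x} hq(x)$ the growth is isolated in the power of q: for $x \ge 1$ the other factor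
    lies between the positive constants [h1] and [iq^-1]. *)
Definition hq x : R := (1 - qpow (2 * x)) / iq.

Lemma qnE x : qn x = qpow (- x) * hq x.
Proof.
have i0 := lt0r_neq0 iq_gt0; have q0 := lt0r_neq0 q_gt0.
rewrite /Defs.qn /hq (_ : 2 * x = x + x); last by ring.
rewrite qpowD qpowN; have := lt0r_neq0 (qpow_gt0 x).
move: (qpow x) => X X0.
have -> : q - q^-1 = - iq by rewrite /iq opprB.
by field; rewrite i0 X0.
Qed.

Lemma hq_ge0 x : 0 <= x -> 0 <= hq x.
Proof.
move=> x0; rewrite /hq divr_ge0 ?(ltW iq_gt0)// subr_ge0 qpow_le1//.
by rewrite mulr_ge0.
Qed.

Lemma hq_le x : hq x <= iq^-1.
Proof.
rewrite /hq -[leRHS]mul1r ler_wpM2r ?invr_ge0 ?(ltW iq_gt0)//.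
by rewrite gerBl qpow_ge0.
Qed.

Definition h1 : R := (1 - q ^+ 2) / iq.

Lemma q2_lt1 : q ^+ 2 < 1. Proof. by rewrite exprn_ilt1// ltW. Qed.

Lemma h1_gt0 : 0 < h1.
Proof. by rewrite /h1 divr_gt0 ?iq_gt0// subr_gt0 q2_lt1. Qed.

Lemma hq_ge1 x : 1 <= x -> h1 <= hq x.
Proof.
move=> x1; rewrite /hq /h1 ler_wpM2r ?invr_ge0 ?(ltW iq_gt0)//.
rewrite lerD2l lerN2 -qpow_nat qpow_le//.
by rewrite -[leLHS]mulr1 ler_pM2l.
Qed.

Lemma qn_ge0 x : 0 <= x -> 0 <= qn x.
Proof. by move=> x0; rewrite qnE mulr_ge0 ?qpow_ge0 ?hq_ge0. Qed.

Lemma sqrt_qn x y : Num.sqrt (qn x * qn y) =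
  qpow (- (x + y) / 2) * Num.sqrt (hq x * hq y).
Proof.
have -> : qn x * qn y = qpow (- (x + y) / 2) ^+ 2 * (hq x * hq y).
  rewrite !qnE expr2 -qpowD (_ : - (x + y) / 2 + - (x + y) / 2 = - x - y); last by field.
  by rewrite qpowD; ring.
by rewrite sqrtrM ?sqr_ge0// sqrtr_sqr ger0_norm ?qpow_ge0.
Qed.

(** A single constant above 2 (for sums), above $1/iq$ (for $[x]$) and above $1/h1$ (for
    $1/[x]$). *)
Definition Kq : R := 2 + iq^-1 + h1^-1.

Lemma Kq_ge2 : 2 <= Kq.
Proof. by rewrite /Kq -addrA lerDl addr_ge0 ?invr_ge0 ?(ltW iq_gt0) ?(ltW h1_gt0). Qed.

Lemma Kq_ge1 : 1 <= Kq.
Proof. by apply: le_trans Kq_ge2; rewrite ler1n. Qed.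

(** Estimates become bookkeeping: products add both the power of [Kq] and the exponent of q, sums
    raise the former by one, and exponents are compared by linear arithmetic over [rat]. *)
Definition qbnd (n : nat) u E : Prop := `|u| <= Kq ^+ n * qpow E.
Local Notation bnd := qbnd.

Lemma bnd_le n n' u E E' : (n <= n')%N -> E' <= E -> bnd n u E -> bnd n' u E'.
Proof.
move=> nn EE; rewrite /qbnd => /le_trans; apply; apply: ler_pM.
- by rewrite exprn_ge0// (le_trans _ Kq_ge1).
- exact: qpow_ge0.
- by rewrite ler_weXn2l// Kq_ge1.
- exact: qpow_le.
Qed.

Lemma bndM n m u w E F : bnd n u E -> bnd m w F -> bnd (n + m) (u * w) (E + F).
Proof.
rewrite /qbnd normrM exprD qpowD => h1 h2.
have -> : Kq ^+ n * Kq ^+ m * (qpow E * qpow F) =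
  (Kq ^+ n * qpow E) * (Kq ^+ m * qpow F) by ring.
exact: ler_pM.
Qed.

Lemma bndN n u E : bnd n u E -> bnd n (- u) E.
Proof. by rewrite /qbnd normrN. Qed.

Lemma bndD n u w E : bnd n u E -> bnd n w E -> bnd n.+1 (u + w) E.
Proof.
move=> h1 h2; rewrite /bnd; apply: le_trans (ler_normD _ _) _.
apply: le_trans (lerD h1 h2) _.
have K0 : 0 <= Kq ^+ n * qpow E.
  by rewrite mulr_ge0 ?qpow_ge0// exprn_ge0// (le_trans _ Kq_ge1).
rewrite exprS -mulrA; have -> : Kq ^+ n * qpow E + Kq ^+ n * qpow E =
  2 * (Kq ^+ n * qpow E) by ring.
by rewrite ler_wpM2r// Kq_ge2.
Qed.

Lemma bnd_qpow E : bnd 0 (qpow E) E.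
Proof. by rewrite /qbnd mul1r ger0_norm ?qpow_ge0. Qed.

Lemma bnd_small u : `|u| <= 2 -> bnd 1 u 0.
Proof. by rewrite /qbnd qpow0 mulr1 expr1 => /le_trans; apply; exact: Kq_ge2. Qed.

Lemma iq_le_Kq : iq^-1 <= Kq.
Proof. by rewrite /Kq addrAC lerDr addr_ge0// invr_ge0 ltW// h1_gt0. Qed.

Lemma h1_le_Kq : h1^-1 <= Kq.
Proof. by rewrite /Kq lerDr addr_ge0// invr_ge0 ltW// iq_gt0. Qed.

Lemma bnd_qn x : 0 <= x -> bnd 1 (qn x) (- x).
Proof.
move=> x0; rewrite /qbnd ger0_norm ?qn_ge0// qnE mulrC expr1.
by rewrite ler_wpM2r ?qpow_ge0// (le_trans (hq_le x)) ?iq_le_Kq.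
Qed.

Lemma qnN x : qn (- x) = - qn x.
Proof. by rewrite /Defs.qn opprK -mulNr opprB. Qed.

Lemma bnd_qnV x : 1 <= x -> bnd 1 (qn x)^-1 x.
Proof.
move=> x1; have h := hq_ge1 x1; have h0 := lt_le_trans h1_gt0 h.
have x0 : 0 <= x by exact: le_trans x1.
rewrite /qbnd normfV ger0_norm ?qn_ge0// qnE qpowN invfM invrK mulrC expr1.
by rewrite ler_wpM2r ?qpow_ge0// (le_trans _ h1_le_Kq)// lef_pV2 ?posrE ?h1_gt0.
Qed.

Lemma bnd_sqrt x y : 0 <= x -> 0 <= y -> bnd 1 (Num.sqrt (qn x * qn y)) (- (x + y) / 2).
Proof.
move=> x0 y0; rewrite /qbnd ger0_norm ?sqrtr_ge0// sqrt_qn mulrC expr1.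
rewrite ler_wpM2r ?qpow_ge0// (le_trans _ iq_le_Kq)//.
have i0 : 0 <= iq^-1 by rewrite invr_ge0 ltW// iq_gt0.
rewrite -[leRHS]ger0_norm// -sqrtr_sqr ler_sqrt ?sqr_ge0// expr2.
by apply: ler_pM; rewrite ?hq_ge0 ?hq_le.
Qed.

Lemma bnd_frac e x y z : 0 <= x -> 0 <= y -> 1 <= z ->
  bnd 2 (qpow e * Num.sqrt (qn x * qn y) / qn z) (e - (x + y) / 2 + z).
Proof.
move=> x0 y0 z1; have := bndM (bndM (bnd_qpow e) (bnd_sqrt x0 y0)) (bnd_qnV z1).
by rewrite mulNr.
Qed.

Lemma bnd_frac2 n u F e x y z z' : bnd n u F -> 0 <= x -> 0 <= y -> 1 <= z -> 1 <= z' ->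
  bnd (n + 3) (u * qpow e * Num.sqrt (qn x * qn y) / (qn z * qn z'))
    (F + e - (x + y) / 2 + z + z').
Proof.
move=> hu x0 y0 z1 z1'.
have := bndM (bndM (bndM (bndM hu (bnd_qpow e)) (bnd_sqrt x0 y0)) (bnd_qnV z1)) (bnd_qnV z1').
move=> h; rewrite invfM mulrA; apply: bnd_le h; first by lia.
by lra.
Qed.

Lemma bnd_qn2 x : `|x| = 2 -> bnd 1 (qn x) (- 2).
Proof.
move=> x2; have h : bnd 1 (qn 2) (- 2) by exact: bnd_qn.
have [x0|x0] := leP 0 x; first by rewrite ger0_norm// in x2; rewrite x2.
rewrite ltr0_norm// in x2; rewrite -[x]opprK x2 qnN; exact: bndN.
Qed.

(** In terms of $a = l+1/2-j+m_2$ and $b = l+1/2-j-m_2$: the value 1/2 of [eps] means that a is odd,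
    -1/2 that b is odd, and the odd one is at least 1. These inequalities make the arguments of the
    square roots nonnegative and those of the denominators at least 1. *)
Definition ljm (l j m2 : rat) : Prop := 1 / 2 <= j /\
  ((eps l j m2 = 1 / 2 /\ 1 <= l + 1 / 2 - j + m2 /\ 0 <= l + 1 / 2 - j - m2) \/
   (eps l j m2 = - (1 / 2) /\ 0 <= l + 1 / 2 - j + m2 /\ 1 <= l + 1 / 2 - j - m2)).

Lemma eps_mk (a b c d : nat) : odd (a + b) -> let v := mk a b c d in
  eps v.1.1.1 v.2 v.1.2 = if odd a then 1 / 2 else - (1 / 2).
Proof.
move=> ab /=; rewrite /eps.
have -> : (a%:R + b%:R + c%:R + d%:R - 1) / 2 + 2^-1 - (c%:R + d%:R) / 2 -
  (a%:R - b%:R) / 2 = b%:R :> rat by field.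
have ob : odd a = ~~ odd b by move: ab; rewrite oddD; case: (odd a); case: (odd b).
rewrite ob; case: ifPn => [/natrP[n nE]|h].
  have -> : b = (n.*2)%N.
    by apply/eqP; rewrite -(eqr_nat rat) -mul2n natrM -nE; apply/eqP; field.
  by rewrite odd_double -div1r.
suff -> : odd b by rewrite div1r.
apply: contraNT h => hb; apply/natrP; exists b./2.
by rewrite -{1}(even_halfK hb) -mul2n natrM; field.
Qed.

Lemma in_range_ljm l m1 m2 j : in_range (l, m1, m2, j) -> ljm l j m2.
Proof.
move=> /in_rangeE[a [b [c [d [ab cd' E]]]]].
have := eps_mk c d ab; rewrite -E /= => eE.
move: E; rewrite /mk => -[lE _ mE jE].
have c1 : 1 <= c%:R + d%:R :> rat.
  by rewrite -natrD ler1n; case: (c + d)%N cd'.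
split; first by rewrite jE; lra.
have a0 : 0 <= a%:R :> rat by []. have b0 : 0 <= b%:R :> rat by [].
move: eE ab; rewrite oddD; have [oa|oa] := boolP (odd a); rewrite /= => -> ob.
  left; split=> //; have : 1 <= a%:R :> rat by rewrite ler1n; case: a oa {a0 lE mE}.
  by rewrite lE mE jE => ?; split; lra.
right; split=> //; have : 1 <= b%:R :> rat by rewrite ler1n; case: b ob {b0 lE mE}.
by rewrite lE mE jE => ?; split; lra.
Qed.

Section Coefficients.
Variables l j m2 : rat.
Hypothesis H : ljm l j m2.

Lemma Cp_bnd : bnd 2 (Cp q l j m2) (l + 1 / 2 - j + m2 - 1).
Proof.
have [hj hh] := H; rewrite /Cp !mulNr; apply: bndN.
by case: hh => -[-> [ha hb]]; apply: bnd_le (bnd_frac _ _ _ _); first [lra | by []].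
Qed.

Lemma Cm_bnd : bnd 2 (Cm q l j m2) (l + 1 / 2 + j + m2).
Proof.
have [hj hh] := H; rewrite /Cm !mulNr; apply: bndN.
by case: hh => -[-> [ha hb]]; apply: bnd_le (bnd_frac _ _ _ _); first [lra | by []].
Qed.

Lemma Hp_bnd : bnd 2 (Hp q l j m2) (l + 1 / 2 - j + m2).
Proof.
have [hj hh] := H; rewrite /Hp.
by case: hh => -[-> [ha hb]]; apply: bnd_le (bnd_frac _ _ _ _); first [lra | by []].
Qed.

Lemma Dm_bnd : bnd 2 (Dm q l j m2) (l + 1 / 2 + j + m2).
Proof.
have [hj hh] := H; rewrite /Dm !mulNr; apply: bndN.
by case: hh => -[-> [ha hb]]; apply: bnd_le (bnd_frac _ _ _ _); first [lra | by []].
Qed.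

Lemma D0_bnd : bnd 4 (D0 q l j m2) (2 * l).
Proof.
have [hj hh] := H; rewrite /D0; have q2 : bnd 1 (qn 2) (- 2) by exact: bnd_qn2.
by case: hh => -[-> [ha hb]]; apply: bnd_le (bnd_frac2 _ q2 _ _ _ _); first [lra | by []].
Qed.

Lemma C0_bnd : bnd 4 (C0 q l j m2) (2 * l).
Proof.
have [hj hh] := H; rewrite /C0; have q2 : bnd 1 (qn (4 * eps l j m2)) (- 2).
  by apply: bnd_qn2; case: hh => -[-> _].
move: (qn (4 * eps l j m2)) q2 => u q2.
by case: hh => -[-> [ha hb]]; apply: bnd_le (bnd_frac2 _ q2 _ _ _ _); first [lra | by []].
Qed.

Lemma H0_bnd : bnd 5 (H0 q l j m2) (2 * l - 2 * j).
Proof.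
have [hj hh] := H; rewrite /H0 invfM mulrA.
have l1 : 1 <= 2 * l + 2 by case: hh => -[_ [ha hb]]; lra.
have l2 : 1 <= 2 * l + 4 by lra.
have V : forall n u E, bnd n u E -> bnd (n + 1 + 1) (u / qn (2 * l + 2) / qn (2 * l + 4))
   (E + (2 * l + 2) + (2 * l + 4)).
  by move=> n u E hu; exact: bndM (bndM hu (bnd_qnV l1)) (bnd_qnV l2).
have P x y : 0 <= x -> 0 <= y -> bnd 2 (qn x * qn y) (- x - y).
  by move=> x0 y0; exact: bndM (bnd_qn x0) (bnd_qn y0).
have Q x y : 0 <= x -> 0 <= y -> bnd 2 (qpow (- 2) * qn x * qn y) (- 2 - x - y).
  by move=> x0 y0; have := bndM (bndM (bnd_qpow (- 2)) (bnd_qn x0)) (bnd_qn y0).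
case: hh => -[-> [ha hb]].
  apply: bnd_le (V 3 _ (- 2 - 2 * l - 2 * j - 4) _) => //; first by lra.
  apply: bndD; first by apply: bnd_le (P _ _ _ _); first [lra | by []].
  by apply: bndN; apply: bnd_le (Q _ _ _ _); first [lra | by []].
apply: bnd_le (V 3 _ (- 2 * l - 2 * j - 4) _) => //; first by lra.
apply: bndD; first by apply: bnd_le (P _ _ _ _); first [lra | by []].
by apply: bndN; apply: bnd_le (Q _ _ _ _); first [lra | by []].
Qed.

End Coefficients.

Section JCoefficients.
Variables j m1 : rat.
Hypotheses (hj : 1 / 2 <= j) (hc : 0 <= j + m1) (hd : 0 <= j - m1).

Lemma Ap_bnd : bnd 2 (Ap q j m1) (j + m1).
Proof.
have hj' := hj; have hc' := hc; have hd' := hd.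
by rewrite /Ap; apply: bnd_le (bnd_frac _ _ _ _); first [lra | by []].
Qed.

Lemma Ap_pred_bnd : bnd 2 (Ap q (j - 1) m1) (j + m1 - 1).
Proof.
have hj' := hj; have hc' := hc; have hd' := hd.
by rewrite /Ap; apply: bnd_le (bnd_frac _ _ _ _); first [lra | by []].
Qed.

Lemma Bp_bnd : bnd 2 (Bp q j m1) 0.
Proof.
have hj' := hj; have hc' := hc; have hd' := hd.
by rewrite /Bp; apply: bnd_le (bnd_frac _ _ _ _); first [lra | by []].
Qed.

Lemma Bm_bnd : 1 <= j - m1 -> bnd 2 (Bm q j m1) (j + m1).
Proof.
have hj' := hj; have hc' := hc; have hd' := hd.
move=> hd1; rewrite /Bm !mulNr; apply: bndN.
by apply: bnd_le (bnd_frac _ _ _ _); first [lra | by []].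
Qed.

Lemma B0_bnd : bnd 4 (B0 q j m1) (2 * j).
Proof.
have hj' := hj; have hc' := hc; have hd' := hd.
have q2 : bnd 1 (1 + q ^+ 2) 0.
  apply: bnd_small; rewrite ger0_norm ?addr_ge0 ?sqr_ge0//.
  by rewrite lerD2l ltW// q2_lt1.
by rewrite /B0; apply: bnd_le (bnd_frac2 _ q2 _ _ _ _); first [lra | by []].
Qed.

Lemma A0_bnd : bnd 6 (A0 q j m1) (2 * j - 1).
Proof.
have hj' := hj; have hc' := hc; have hd' := hd.
have z1 : 1 <= 2 * j by lra. have z2 : 1 <= 2 * j + 2 by lra.
have j0 : 0 <= 2 * j by lra.
have q2 : bnd 1 (qn 2) (- 2) by exact: bnd_qn2.
rewrite /A0 invfM mulrA.
have h1 := bndM (bndM (bnd_qpow (j + m1 + 1)) q2) (bnd_qn hd).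
have h2 : bnd 3 (qpow (j + m1 + 1) * qn 2 * qn (j - m1) - qn (2 * j)) (- (2 * j) - 1).
  apply: bndD; first by apply: bnd_le h1; first [lra | by []].
  by apply: bndN; apply: bnd_le (bnd_qn j0); first [lra | by []].
apply: bnd_le (bndM (bndM (bndM (bnd_qpow (- 2)) h2) (bnd_qnV z1)) (bnd_qnV z2));
  first [lra | by []].
Qed.

End JCoefficients.

End QNumbers.

(** * The generators as tame operators *)

Section Generators.
Variables (R : realType) (q : R).
Hypotheses (q_gt0 : 0 < q) (q_lt1 : q < 1).
Implicit Types (k : basis_index) (F : basis_index -> R) (v : labels).
Local Notation bnd := (qbnd q).
Local Notation qpow := (qpow q).

Definition kl k := (val k.2).1.1.1.
Definition km1 k := (val k.2).1.1.2.
Definition km2 k := (val k.2).1.2.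
Definition kj k := (val k.2).2.

Lemma val_lattice k : val k.2 = (kl k, km1 k, km2 k, kj k).
Proof. by rewrite /kl /km1 /km2 /kj; case: (val k.2) => [[[? ?] ?] ?]. Qed.

Lemma k_coords k : [/\ (ca k.2)%:R = kl k + 1 / 2 - kj k + km2 k,
  (cb k.2)%:R = kl k + 1 / 2 - kj k - km2 k, (cc k.2)%:R = kj k + km1 k,
  (cd k.2)%:R = kj k - km1 k & (sz k)%:R = 2 * kl k + 1 /\
   (ac k)%:R = (ca k.2)%:R + (cc k.2)%:R :> rat].
Proof.
have [ha hb hc hd] := coordR k.2; rewrite div1r; split=> //.
split; last by rewrite /ac natrD.
by rewrite /sz !natrD ha hb hc hd -/(kl k) -/(km1 k) -/(km2 k) -/(kj k); lra.
Qed.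

Lemma k_pos k : [/\ 0 <= kl k + 1 / 2 - kj k + km2 k, 0 <= kl k + 1 / 2 - kj k - km2 k,
  0 <= kj k + km1 k, 0 <= kj k - km1 k & 1 / 2 <= kj k].
Proof.
have [<- <- <- <- _] := k_coords k; split=> //.
have := valP k.2; rewrite val_lattice => /in_range_ljm h.
by have [] := h.
Qed.

Lemma k_ljm k : ljm (kl k) (kj k) (km2 k).
Proof. by have := valP k.2; rewrite val_lattice => /in_range_ljm. Qed.

Lemma mv_k f v k k' : mv f v k = Some k' ->
  [/\ kl k' = kl k + v.1.1.1, km1 k' = km1 k + v.1.1.2, km2 k' = km2 k + v.1.2
    & kj k' = kj k + v.2].
Proof. by move=> /mvP[_]; rewrite /kl /km1 /km2 /kj => ->. Qed.

Lemma bnd_shift n u (m : nat) (r : rat) : bnd n u (m%:R - r) ->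
  `|u| <= Kq q ^+ n * qpow (- r) * q ^+ m.
Proof. by rewrite /qbnd (qpowD q_gt0) (qpow_nat q_gt0) [_ * qpow (- r)]mulrC mulrA. Qed.

Lemma Kqn_ge0 n r : 0 <= Kq q ^+ n * qpow (- r).
Proof.
by rewrite mulr_ge0 ?qpow_ge0// exprn_ge0// (le_trans _ (Kq_ge1 q_gt0 q_lt1)).
Qed.

(** For coefficients that do not depend on the chirality: their difference under the exchange is 0,
    so decay in $a + c$ is enough. *)
Lemma tame_coefa v F n r : (forall k, F (flip k) = F k) ->
  (forall k k', mv false v k = Some k' -> bnd n (F k) ((ac k)%:R - r)) ->
  tame (fun k => (F k)%:C *: kt R (mv false v k)) (fun _ _ => 0).
Proof.
move=> Ff FB; have K0 := Kqn_ge0 n r; apply: tame_err_range.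
  exists (Kq q ^+ n * qpow (- r)), q; split=> //; first by rewrite q_gt0.
  move=> k; case E : mv => [k'|]; last first.
    by have q0 := ltW q_gt0; rewrite normc0E mulr_ge0// exprn_ge0.
  by rewrite normc_real; apply: bnd_shift; exact: FB E.
apply: decays_ext (decays0 R sz) => k; rewrite Ff subrr.
by case: mv.
Qed.

(** For coefficients with the sign [sg]: the exchange changes them to their opposites, so they must
    decay in all four coordinates themselves. *)
Lemma tame_coefs v F n r :
  (forall k k', mv false v k = Some k' -> bnd n (F k) ((sz k)%:R - r)) ->
  tame (fun k => (F k)%:C *: kt R (mv false v k)) (fun _ _ => 0).
Proof.
move=> FB; have K0 := Kqn_ge0 n r; have q0 := ltW q_gt0.
have hF k : mv false v k <> None ->
    `|F k| <= Kq q ^+ n * qpow (- r) * q ^+ sz k /\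
    `|F (flip k)| <= Kq q ^+ n * qpow (- r) * q ^+ sz k.
  case E : mv => [k'|] // _; split; apply: bnd_shift; first exact: FB E.
  by apply: (FB (flip k) (flip k')); rewrite mv_flip E.
apply: tame_err_range.
  exists (Kq q ^+ n * qpow (- r)), q; split=> //; first by rewrite q_gt0.
  move=> k; have := hF k; case: mv => [k'|] h; last first.
    by rewrite normc0E mulr_ge0// exprn_ge0.
  have [h1 _] : _ := h ltac:(discriminate); rewrite normc_real; apply: le_trans h1 _.
  rewrite ler_wpM2l// ler_wiXn2l// ?(ltW q_lt1)// /ac /sz.
  by rewrite -!addnA leq_add2l addnCA leq_addr.
exists (Kq q ^+ n * qpow (- r) * 2), q; split; [by rewrite mulr_ge0|by rewrite q_gt0|].
move=> k; have := hF k; case: mv => [k'|] h; last first.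
  by rewrite normc0E; apply: mulr_ge0; [exact: mulr_ge0|exact: exprn_ge0].
have [h1 h2] : _ := h ltac:(discriminate); rewrite -rmorphB normc_real.
apply: le_trans (ler_normB _ _) _; apply: le_trans (lerD h1 h2) _.
by move: (_ * qpow (- r)) (q ^+ sz k) => A B; rewrite mulrAC mulr_natr mulr2n.
Qed.

Lemma sg_bnd (c : bool) : bnd 0 (sg R c) 0.
Proof. by rewrite /qbnd (qpow0 q) expr0 mulr1 /sg; case: c; rewrite ?normrN normr1. Qed.

Section TwoFactors.
Variables (P Q S : rat -> rat -> R) (dm : rat).

(** The common form of $x_0$ ([dm] = 0) and $x_1$ ([dm] = 1), which share the factors C and H and
    differ in the factors that depend on j and m1. *)
Definition gen_ket (c : bool) (l m1 m2 j : rat) : hilbert R :=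
  (P j m1)%:C *:
    ((Cp q l j m2)%:C *: ket R c (l + 1) (m1 + dm) m2 (j + 1)
     - (sg R c * C0 q l j m2)%:C *: ket R c l (m1 + dm) m2 (j + 1)
     + (Cm q l j m2)%:C *: ket R c (l - 1) (m1 + dm) m2 (j + 1)) +
  (Q j m1)%:C *:
    ((Hp q l j m2)%:C *: ket R c (l + 1) (m1 + dm) m2 j
     + (sg R c * H0 q l j m2)%:C *: ket R c l (m1 + dm) m2 j
     + (Hp q (l - 1) j m2)%:C *: ket R c (l - 1) (m1 + dm) m2 j) +
  (S j m1)%:C *:
    ((Cm q (l + 1) (j - 1) m2)%:C *: ket R c (l + 1) (m1 + dm) m2 (j - 1)
     - (sg R c * C0 q l (j - 1) m2)%:C *: ket R c l (m1 + dm) m2 (j - 1)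
     + (Cp q (l - 1) (j - 1) m2)%:C *: ket R c (l - 1) (m1 + dm) m2 (j - 1)).

Hypothesis PB : forall k, bnd 2 (P (kj k) (km1 k)) 0.
Hypothesis QB : forall k, bnd 6 (Q (kj k) (km1 k)) (2 * kj k - 1).
Hypothesis SB : forall k, 1 + dm <= kj k - km1 k ->
  bnd 2 (S (kj k) (km1 k)) (kj k + km1 k - 1).

Let ket_mv (c : bool) (l m1 m2 j : rat) v k : c = k.1 ->
  addl (val k.2) v = (l, m1, m2, j) -> ket R c l m1 m2 j = kt R (mv false v k).
Proof. by move=> -> e; rewrite /ket /mv e; case: insub => //= p; rewrite addbF. Qed.

(** Eight of the nine terms are errors. The first one, which raises both l and j, is left as a
    hypothesis, since for $x_1$ it contains the main term. Coefficients at shifted labels are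
    estimated through the target [k'], which lies in the lattice; its coordinate $d - 1 - dm$ is
    nonnegative when j is lowered, whence the condition in [SB]. *)
Lemma gen_tame p :
  tame (fun k => (P (kj k) (km1 k) * Cp q (kl k) (kj k) (km2 k))%:C *:
    kt R (mv false (1, dm, 0, 1) k)) p ->
  tame (fun k => gen_ket k.1 (kl k) (km1 k) (km2 k) (kj k)) p.
Proof.
move=> T1.
have hP := PB; have hQ := QB; have hS := SB.
have T2 : tame (fun k => (- (P (kj k) (km1 k) * (sg R k.1 * C0 q (kl k) (kj k) (km2 k))))%:C
    *: kt R (mv false (0, dm, 0, 1) k)) (fun _ _ => 0).
  apply: (@tame_coefs _ _ 10 2) => k k' E; apply: bndN.
  have [_ _ _ _ [-> _]] := k_coords k.
  have B := bndM q_gt0 (hP k) (bndM q_gt0 (sg_bnd k.1) (C0_bnd q_gt0 q_lt1 (k_ljm k))).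
  by apply: (bnd_le q_gt0 q_lt1 _ _ B) => //; lra.
have T3 : tame (fun k => (P (kj k) (km1 k) * Cm q (kl k) (kj k) (km2 k))%:C
    *: kt R (mv false (-1, dm, 0, 1) k)) (fun _ _ => 0).
  apply: (@tame_coefa _ _ 10 2) => // k k' E.
  have [ha _ hc _ [_ ->]] := k_coords k; have [pa pb pc pd pj] := k_pos k.
  have B := bndM q_gt0 (hP k) (Cm_bnd q_gt0 q_lt1 (k_ljm k)).
  by apply: (bnd_le q_gt0 q_lt1 _ _ B) => //; rewrite ha hc; lra.
have T4 : tame (fun k => (Q (kj k) (km1 k) * Hp q (kl k) (kj k) (km2 k))%:C
    *: kt R (mv false (1, dm, 0, 0) k)) (fun _ _ => 0).
  apply: (@tame_coefa _ _ 10 2) => // k k' E.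
  have [ha _ hc _ [_ ->]] := k_coords k; have [pa pb pc pd pj] := k_pos k.
  have B := bndM q_gt0 (hQ k) (Hp_bnd q_gt0 q_lt1 (k_ljm k)).
  by apply: (bnd_le q_gt0 q_lt1 _ _ B) => //; rewrite ha hc; lra.
have T5 : tame (fun k => (Q (kj k) (km1 k) * (sg R k.1 * H0 q (kl k) (kj k) (km2 k)))%:C
    *: kt R (mv false (0, dm, 0, 0) k)) (fun _ _ => 0).
  apply: (@tame_coefs _ _ 12 2) => k k' E.
  have [_ _ _ _ [-> _]] := k_coords k.
  have B := bndM q_gt0 (hQ k) (bndM q_gt0 (sg_bnd k.1) (H0_bnd q_gt0 q_lt1 (k_ljm k))).
  by apply: (bnd_le q_gt0 q_lt1 _ _ B) => //; lra.
have T6 : tame (fun k => (Q (kj k) (km1 k) * Hp q (kl k - 1) (kj k) (km2 k))%:C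
    *: kt R (mv false (-1, dm, 0, 0) k)) (fun _ _ => 0).
  apply: (@tame_coefa _ _ 10 2) => // k k' E.
  have [ha _ hc _ [_ ->]] := k_coords k; have [pa pb pc pd pj] := k_pos k.
  have := k_ljm k'; have [-> _ -> ->] := mv_k E; rewrite /= !addr0 => H.
  have B := bndM q_gt0 (hQ k) (Hp_bnd q_gt0 q_lt1 H).
  by apply: (bnd_le q_gt0 q_lt1 _ _ B) => //; rewrite ha hc; lra.
have S' k k' l : mv false (l, dm, 0, -1) k = Some k' ->
    bnd 2 (S (kj k) (km1 k)) (kj k + km1 k - 1).
  move=> E; apply: hS; have [_ _ _ pd _] := k_pos k'; move: pd.
  by have [_ -> _ ->] := mv_k E => /= pd; lra.
have T7 : tame (fun k => (S (kj k) (km1 k) * Cm q (kl k + 1) (kj k - 1) (km2 k))%:C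
    *: kt R (mv false (1, dm, 0, -1) k)) (fun _ _ => 0).
  apply: (@tame_coefa _ _ 10 2) => // k k' E.
  have [ha _ hc _ [_ ->]] := k_coords k; have [pa pb pc pd pj] := k_pos k.
  have := k_ljm k'; have [-> _ -> ->] := mv_k E; rewrite /= !addr0 => H.
  have B := bndM q_gt0 (S' _ _ _ E) (Cm_bnd q_gt0 q_lt1 H).
  by apply: (bnd_le q_gt0 q_lt1 _ _ B) => //; rewrite ha hc /=; lra.
have T8 : tame (fun k => (- (S (kj k) (km1 k) * (sg R k.1 * C0 q (kl k) (kj k - 1) (km2 k))))%:C
    *: kt R (mv false (0, dm, 0, -1) k)) (fun _ _ => 0).
  apply: (@tame_coefs _ _ 12 2) => k k' E; apply: bndN.
  have [_ _ _ _ [-> _]] := k_coords k; have [pa pb pc pd pj] := k_pos k.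
  have := k_ljm k'; have [-> _ -> ->] := mv_k E; rewrite /= !addr0 => H.
  have B := bndM q_gt0 (S' _ _ _ E) (bndM q_gt0 (sg_bnd k.1) (C0_bnd q_gt0 q_lt1 H)).
  by apply: (bnd_le q_gt0 q_lt1 _ _ B) => //; rewrite /=; lra.
have T9 : tame (fun k => (S (kj k) (km1 k) * Cp q (kl k - 1) (kj k - 1) (km2 k))%:C
    *: kt R (mv false (-1, dm, 0, -1) k)) (fun _ _ => 0).
  apply: (@tame_coefa _ _ 10 2) => // k k' E.
  have [ha _ hc _ [_ ->]] := k_coords k; have [pa pb pc pd pj] := k_pos k.
  have := k_ljm k'; have [-> _ -> ->] := mv_k E; rewrite /= !addr0 => H.
  have B := bndM q_gt0 (S' _ _ _ E) (Cp_bnd q_gt0 q_lt1 H).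
  by apply: (bnd_le q_gt0 q_lt1 _ _ B) => //; rewrite ha hc /=; lra.
apply: (tame_eq (tameD (tameD (tameD T1 T2) T3) (tameD (tameD (tameD T4 T5) T6)
  (tameD (tameD T7 T8) T9)))) => [k|b t]; last by rewrite !addr0.
have kE (l j : rat) : kt R (mv false (l, dm, 0, j) k) =
    ket R k.1 (kl k + l) (km1 k + dm) (km2 k) (kj k + j).
  by symmetry; apply: ket_mv => //; rewrite val_lattice /addl /= addr0.
rewrite /gen_ket !kE !addr0 !scalerDr !scalerN !scalerA -!rmorphM.
by rewrite !rmorphN !scaleNr !addrA.
Qed.

End TwoFactors.

End Generators.

Section MainTerms.
Variables (R : realType) (q : R).
Hypotheses (q_gt0 : 0 < q) (q_lt1 : q < 1).
Implicit Types (k : basis_index) (x y z e E : rat).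
Local Notation bnd := (qbnd q).
Local Notation qpow := (qpow q).
Local Notation qn := (qn q).

(** What remains of $q^e \sqrt{[x][y]}/[z]$ after the power of q is taken out, in terms of $q^{2x}$,
    $q^{2y}$ and $q^{2z}$; it tends to 1 as these tend to 0. *)
Definition ratio (s t r : R) : R := Num.sqrt ((1 - s) * (1 - t)) / (1 - r).

Lemma frac_ratio e x y z : 1 <= z ->
  qpow e * Num.sqrt (qn x * qn y) / qn z = qpow (e - (x + y) / 2 + z) *
    ratio (qpow (2 * x)) (qpow (2 * y)) (qpow (2 * z)).
Proof.
move=> z1; have i0 := iq_gt0 q_gt0 q_lt1.
have hz := lt_le_trans (h1_gt0 q_gt0 q_lt1) (hq_ge1 q_gt0 q_lt1 z1).
rewrite (sqrt_qn q_gt0 q_lt1) (qnE q_gt0 q_lt1 z) (qpowN q_gt0).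
have -> : Num.sqrt (hq q x * hq q y) =
    Num.sqrt ((1 - qpow (2 * x)) * (1 - qpow (2 * y))) / iq q.
  have -> : hq q x * hq q y = (1 - qpow (2 * x)) * (1 - qpow (2 * y)) * (iq q)^-1 ^+ 2.
    by rewrite /hq expr2; ring.
  by rewrite mulrC sqrtrM ?sqr_ge0// sqrtr_sqr ger0_norm ?invr_ge0 ?(ltW i0)// mulrC.
rewrite mulNr !(qpowD q_gt0) /ratio.
have zn : 1 - qpow (2 * z) != 0.
  by apply: contraTneq hz => h; rewrite /hq h mul0r ltxx.
have := lt0r_neq0 (qpow_gt0 q_gt0 z); have := lt0r_neq0 i0; rewrite /hq.
move: (Num.sqrt _) (qpow z) (qpow (2 * z)) zn (iq q) (qpow e) (qpow _) => S Z Z2 zn i e' xy iN ZN.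
by field; rewrite iN ZN zn.
Qed.

(** With $d = q^E$, both the square root S and $1 - r$ lie between $1 - d$ and 1, so they differ by
    at most d. The lower bound is kept for the residue at 3. *)
Lemma ratio_bnd s t r E : 2 <= E -> 0 <= s <= qpow E -> 0 <= t <= qpow E ->
  0 <= r <= qpow E -> bnd 2 (ratio s t r - 1) E /\ 1 - q ^+ 2 <= ratio s t r.
Proof.
move=> E2 /andP[s0 s1] /andP[t0 t1] /andP[r0 r1].
set d := qpow E in s1 t1 r1.
have d0 : 0 <= d := qpow_ge0 _ _.
have dq : d <= q ^+ 2 by rewrite /d -(qpow_nat q_gt0) (qpow_le q_gt0 q_lt1).
have q21 := q2_lt1 q_gt0 q_lt1.
have d1 : d < 1 := le_lt_trans dq q21.
set S := Num.sqrt ((1 - s) * (1 - t)).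
have S1 : S <= 1.
  rewrite /S -[leRHS]sqrtr1 ler_sqrt// -[leRHS]mulr1; apply: ler_pM; lra.
have Sd : 1 - d <= S.
  rewrite /S -[leLHS]ger0_norm; last by lra.
  rewrite -sqrtr_sqr ler_sqrt; last by apply: mulr_ge0; lra.
  by rewrite expr2; apply: ler_pM; lra.
have r2 : 0 < 1 - r by lra.
have q2 : 0 < 1 - q ^+ 2 by lra.
split; last first.
  apply: le_trans (_ : S <= _); first by lra.
  have S0 : 0 <= S by lra.
  by rewrite ler_pdivlMr// ler_piMr//; lra.
have -> : ratio s t r - 1 = (S - (1 - r)) / (1 - r).
  by rewrite /ratio -/S; field; rewrite gt_eqF.
rewrite /qbnd normrM normfV (gtr0_norm r2).
apply: (@le_trans _ _ (d / (1 - q ^+ 2))).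
  apply: ler_pM; rewrite ?normr_ge0 ?invr_ge0 ?(ltW r2)//.
    by rewrite ler_norml; apply/andP; split; lra.
  by rewrite lef_pV2 ?posrE//; lra.
rewrite mulrC ler_wpM2r//.
have -> : (1 - q ^+ 2)^-1 = (h1 q)^-1 * (iq q)^-1.
  rewrite /h1 invf_div -mulrA mulrCA divff ?mulr1//.
  exact: lt0r_neq0 (iq_gt0 q_gt0 q_lt1).
rewrite expr2; apply: ler_pM; rewrite ?invr_ge0 ?(ltW (h1_gt0 _ _)) ?(ltW (iq_gt0 _ _))//.
  exact: h1_le_Kq.
exact: iq_le_Kq.
Qed.

Lemma eps_k k : eps (kl k) (kj k) (km2 k) =
  if odd (ca k.2) then 1 / 2 else - (1 / 2).
Proof.
have [odd1 _ E] := coordE k.2.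
by have := eps_mk (cc k.2) (cd k.2) odd1; rewrite -E.
Qed.

Lemma eps_half k : (ca k.2)%:R - 1 / 2 - eps (kl k) (kj k) (km2 k) =
  (2 * (ca k.2)./2)%:R :> rat.
Proof.
rewrite eps_k -{1}(odd_double_half (ca k.2)) natrD -mul2n.
by case: odd; rewrite /=; lra.
Qed.

Definition phi1 (n : nat) : R[i] := (- q ^+ (2 * n./2))%:C.
Definition phi2 (n : nat) : R[i] := (Num.sqrt (1 - q ^+ (4 * n./2 + 4)))%:C.

Lemma half_ge n : (n <= 2 * n./2 + 1)%N.
Proof. by rewrite -{1}(odd_double_half n) -mul2n addnC leq_add2l; case: odd. Qed.

Lemma phi1_main : mainfun 0 phi1.
Proof.
have q0 := ltW q_gt0.
exists q^-1, q; split; [by rewrite invr_ge0|by rewrite q_gt0|move=> n].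
rewrite subr0 /phi1 normc_real normrN ger0_norm ?exprn_ge0//.
rewrite mulrC ler_pdivlMr// -exprSr ler_wiXn2l// ?(ltW q_lt1)//.
by have := half_ge n; lia.
Qed.

Lemma phi2_main : mainfun 1 phi2.
Proof.
have q0 := ltW q_gt0; have q1 := ltW q_lt1.
exists 1, q; split; [by []|by rewrite q_gt0|move=> n].
rewrite /phi2 -(rmorph1 (real_complex R)) -rmorphB normc_real mul1r.
set x := q ^+ (4 * n./2 + 4).
have x0 : 0 <= x by rewrite exprn_ge0.
have x1 : x <= 1 by rewrite exprn_ile1.
have xn : x <= q ^+ n by rewrite ler_wiXn2l//; have := half_ge n; lia.
set S := Num.sqrt (1 - x).
have S1 : S <= 1 by rewrite /S -[leRHS]sqrtr1 ler_sqrt//; lra.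
have Sd : 1 - x <= S.
  rewrite /S -[leLHS]ger0_norm; last by lra.
  rewrite -sqrtr_sqr ler_sqrt; last by lra.
  by rewrite expr2 ler_piMr//; lra.
by rewrite ler_norml; apply/andP; split; lra.
Qed.

Lemma qpow_interval x E : E <= x -> 0 <= qpow x <= qpow E.
Proof. by move=> h; rewrite qpow_ge0 (qpow_le q_gt0 q_lt1). Qed.

(** The powers of q in [Bp] cancel, and those in [Cp] leave $q^{a - 1/2 - eps}$; the half-integer
    eps rounds a down to an even number, so the exponent is $2 \lfloor a/2 \rfloor$. *)
Lemma BpCp_ratios k : exists X1 X2 : R,
  [/\ Bp q (kj k) (km1 k) * Cp q (kl k) (kj k) (km2 k) =
        - (q ^+ (2 * (ca k.2)./2) * (X1 * X2)),
      bnd 2 (X1 - 1) (2 * (kj k + km1 k) + 2) /\ 1 - q ^+ 2 <= X1 &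
      bnd 2 (X2 - 1) (2 * (kj k + km1 k) + 2) /\ 1 - q ^+ 2 <= X2].
Proof.
have [ha hb hc hd [_ _]] := k_coords k; have [pa pb pc pd pj] := k_pos k.
have [_ he] := k_ljm k; have eh := eps_half k.
rewrite /Bp /Cp !mulNr frac_ratio; last by lra.
rewrite frac_ratio; last by case: he => -[_ [? ?]]; lra.
rewrite [X in qpow X * ratio _ _ _ * _](_ : _ = 0); last by lra.
rewrite (qpow0 q) mul1r -(qpow_nat q_gt0) -eh.
rewrite [X in qpow X * ratio _ _ _](_ : _ =
  (ca k.2)%:R - 1 / 2 - eps (kl k) (kj k) (km2 k)); last by rewrite ha; lra.
eexists; eexists; split; first by rewrite mulrN mulrCA.
- by apply: ratio_bnd; [lra|apply: qpow_interval; lra..].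
- by case: he => -[-> [? ?]]; apply: ratio_bnd;
    (lra || (apply: qpow_interval; lra)).
Qed.

Lemma BpCp_tame : tame (fun k => (Bp q (kj k) (km1 k) * Cp q (kl k) (kj k) (km2 k))%:C *:
    kt R (mv false (1, 1, 0, 1) k)) (fun _ _ => 0).
Proof.
have T1 := tame_main false 0 phi1_main (fun _ : 1%Z <> 0 => erefl).
pose F k := Bp q (kj k) (km1 k) * Cp q (kl k) (kj k) (km2 k) + q ^+ (2 * (ca k.2)./2).
have T2 : tame (fun k => (F k)%:C *: kt R (mv false (1, 1, 0, 1) k)) (fun _ _ => 0).
  apply: (@tame_coefa _ _ q_gt0 q_lt1 _ _ 12 2) => // k k' _.
  have [ha hb hc hd [_ ->]] := k_coords k; have [pa pb pc pd pj] := k_pos k.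
  rewrite /F; have [X1 [X2 [-> [B1 _] [B2 _]]]] := BpCp_ratios k.
  have BQ : bnd 0 (q ^+ (2 * (ca k.2)./2)) ((ca k.2)%:R - 1).
    rewrite -(qpow_nat q_gt0) -eps_half.
    apply: (bnd_le q_gt0 q_lt1 (leqnn 0) _ (bnd_qpow _ _)).
    by have [_ he] := k_ljm k; case: he => -[-> _]; lra.
  set Q := q ^+ _ in BQ *.
  have -> : - (Q * (X1 * X2)) + Q = Q * - ((X1 - 1) * (X2 - 1) + ((X1 - 1) + (X2 - 1))) by ring.
  have B12 : bnd 4 ((X1 - 1) * (X2 - 1)) (2 * (kj k + km1 k) + 2).
    by apply: (bnd_le q_gt0 q_lt1 _ _ (bndM q_gt0 B1 B2)) => //; lra.
  have B3 : bnd 4 ((X1 - 1) + (X2 - 1)) (2 * (kj k + km1 k) + 2).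
    have := bndD q_gt0 q_lt1 B1 B2.
    by move=> h; apply: (bnd_le q_gt0 q_lt1 _ _ h).
  have B := bndM q_gt0 BQ (bndN (bndD q_gt0 q_lt1 B12 B3)).
  by apply: (bnd_le q_gt0 q_lt1 _ _ B) => //; rewrite ha hc; lra.
apply: (tame_eq (tameD T1 T2)) => [k|b t]; last by rewrite mulr0 mul0r addr0.
have -> : ms 0 1 = (1, 1, 0, 1) by rewrite /ms add0r.
rewrite -scalerDl; congr (_ *: _).
by rewrite /phi1 /F -rmorphD /= addrC addrK.
Qed.

(** At $a = 0$ the power of q is 1 and the bound does not depend on c: this is what produces the
    pole at 3. *)
Lemma BpCp_lower k : ca k.2 = 0%N ->
  (1 - q ^+ 2) ^+ 2 <= `|Bp q (kj k) (km1 k) * Cp q (kl k) (kj k) (km2 k)|.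
Proof.
move=> a0; have [X1 [X2 [-> [_ h1] [_ h2]]]] := BpCp_ratios k.
have q21 := q2_lt1 q_gt0 q_lt1; have d0 : 0 <= 1 - q ^+ 2 by lra.
rewrite a0 expr0 mul1r normrN ger0_norm; last by apply: mulr_ge0; lra.
by rewrite expr2; apply: ler_pM.
Qed.

(** The power of q cancels. One factor under the root, $1 - q^{4\lfloor a/2\rfloor + 4}$, depends on
    a alone and gives [phi2] exactly; what remains is a ratio $1 + O(q^{a+c})$. *)
Lemma Dp_tame : tame (fun k => (Dp q (kl k) (kj k) (km2 k))%:C *:
    kt R (mv false (1, 0, 1, 0) k)) (fun _ t => circle_u t).
Proof.
have T1 := tame_main false 1 phi2_main (fun h : 0%Z <> 0 => False_ind _ (h erefl)).
pose F k := Dp q (kl k) (kj k) (km2 k) - Num.sqrt (1 - q ^+ (4 * (ca k.2)./2 + 4)).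
have T2 : tame (fun k => (F k)%:C *: kt R (mv false (1, 0, 1, 0) k)) (fun _ _ => 0).
  apply: (@tame_coefa _ _ q_gt0 q_lt1 _ _ 12 2) => // k k' _.
  have [ha hb hc hd [_ ->]] := k_coords k; have [pa pb pc pd pj] := k_pos k.
  have [_ he] := k_ljm k; have eh := eps_half k.
  pose E := (ca k.2)%:R + (cc k.2)%:R + 2 : rat.
  have aE : qpow (2 * (kl k - kj k + km2 k + 2 - eps (kl k) (kj k) (km2 k))) =
      q ^+ (4 * (ca k.2)./2 + 4).
    rewrite -(qpow_nat q_gt0); congr (Defs.qpow q _).
    rewrite natrD (_ : (4 * _)%:R = 2 * (2 * (ca k.2)./2)%:R :> rat); last by rewrite !natrM; ring.
    by rewrite -eh ha; lra.
  rewrite /F /Dp frac_ratio; last by case: he => -[_ [? ?]]; lra.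
  rewrite [X in qpow X * ratio _ _ _](_ : _ = 0); last by lra.
  rewrite (qpow0 q) mul1r aE; set t := q ^+ _.
  set s := qpow _; set r := qpow _.
  have rE : ratio s t r = Num.sqrt (1 - t) * ratio s 0 r.
    rewrite /ratio subr0 mulr1 mulrA; congr (_ / _).
    rewrite [_ * (1 - t)]mulrC sqrtrM//.
    by rewrite subr_ge0 /t exprn_ile1// ltW.
  rewrite rE -{2}[Num.sqrt (1 - t)]mulr1 -mulrBr.
  have a0 : 0 <= (ca k.2)%:R :> rat by []. have c0 : 0 <= (cc k.2)%:R :> rat by [].
  have B1 : bnd 2 (ratio s 0 r - 1) E.
    apply: (@ratio_bnd _ _ _ _ _ _ _ _).1.
    - by rewrite /E; lra.
    - by apply: qpow_interval; rewrite /E ha hc; case: he => -[-> _]; lra.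
    - by rewrite lexx qpow_ge0.
    - by apply: qpow_interval; rewrite /E ha hc; case: he => -[_ [? ?]]; lra.
  have B2 : bnd 1 (Num.sqrt (1 - t)) 0.
    apply: (bnd_small q_gt0 q_lt1); rewrite ger0_norm ?sqrtr_ge0//.
    apply: (@le_trans _ _ 1); last by rewrite ler1n.
    rewrite -[leRHS]sqrtr1 ler_sqrt// gerBl.
    by rewrite exprn_ge0// ltW.
  by apply: (bnd_le q_gt0 q_lt1 _ _ (bndM q_gt0 B2 B1)) => //; rewrite /E ha hc; lra.
apply: (tame_eq (tameD T1 T2)) => [k|b t]; last by rewrite andbF expr0 !mul1r expr1z addr0.
have -> : ms 1 0 = (1, 0, 1, 0) by rewrite /ms addr0.
rewrite -scalerDl; congr (_ *: _).
by rewrite /phi2 /F -rmorphD /= addrC subrK.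
Qed.

End MainTerms.

(** * Tameness of the algebra and of Psi^0 *)

Section Representation.
Variables (R : realType) (q : R).
Hypotheses (q_gt0 : 0 < q) (q_lt1 : q < 1).
Variable rho : sphere q -> hilbert R -> hilbert R.
Hypothesis rhoP : chiral_representation rho.
Implicit Types (k : basis_index) (T S : hilbert R -> hilbert R).
Local Notation ebasis := (Defs.basis R).

Lemma basisE k k' : ebasis k k' = (k' == k)%:R. Proof. by []. Qed.

Lemma hilbert_ext (u w : hilbert R) : (forall k, u k = w k) -> u = w.
Proof. by move=> h; apply: val_inj; apply/funext => k; exact: h. Qed.

Lemma inner_basisl k (u : hilbert R) : inner (ebasis k) u = u k.
Proof.
rewrite /inner (@csum_single _ _ _ k); first by rewrite basisE eqxx rmorph1 mul1r.
by move=> j jk; rewrite basisE (negbTE jk) rmorph0 mul0r.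
Qed.

Lemma inner_basisr k (u : hilbert R) : inner u (ebasis k) = (u k)^*%C.
Proof.
rewrite /inner (@csum_single _ _ _ k); first by rewrite basisE eqxx mulr1.
by move=> j jk; rewrite basisE (negbTE jk) mulr0.
Qed.

Lemma basis_ket k : ebasis k = ket R k.1 (kl k) (km1 k) (km2 k) (kj k).
Proof.
rewrite /ket -val_lattice valK.
by case: k.
Qed.

Lemma kt_basis k : kt R (mv false (ms 0 0) k) = ebasis k.
Proof.
by have /eqP -> : mv false (ms 0 0) k == Some k by rewrite mv_id ms_eq0.
Qed.

Lemma rho_linear a : linear (rho a).
Proof. by have [[h _ _ _ _] _] := rhoP; have [] := h a. Qed.

Lemma x0_tame : tame (fun k => rho x0 (ebasis k)) (fun _ _ => 0).
Proof.
have T1 : tame (fun k => (Ap q (kj k) (km1 k) * Cp q (kl k) (kj k) (km2 k))%:C *: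
    kt R (mv false (1, 0, 0, 1) k)) (fun _ _ => 0).
  apply: (@tame_coefa _ _ q_gt0 q_lt1 _ _ 10 2) => // k k' _.
  have [ha hb hc hd [_ ->]] := k_coords k; have [pa pb pc pd pj] := k_pos k.
  have B := bndM q_gt0 (Ap_bnd q_gt0 q_lt1 pj pc pd) (Cp_bnd q_gt0 q_lt1 (k_ljm k)).
  by apply: (bnd_le q_gt0 q_lt1 _ _ B) => //; rewrite ha hc; lra.
have := @gen_tame R q q_gt0 q_lt1 (Ap q) (A0 q) (fun j m1 => Ap q (j - 1) m1) 0 _ _ _ _ T1.
move=> h; apply: (tame_eq (h _ _ _)) => [k|k|k _|k|//].
- have [pa pb pc pd pj] := k_pos k.
  by apply: (bnd_le q_gt0 q_lt1 _ _ (Ap_bnd q_gt0 q_lt1 pj pc pd)).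
- by have [pa pb pc pd pj] := k_pos k; exact: A0_bnd.
- by have [pa pb pc pd pj] := k_pos k; exact: Ap_pred_bnd.
- have [_ /(_ k.1 (kl k) (km1 k) (km2 k) (kj k))] := rhoP.
  rewrite -val_lattice (valP k.2) => /(_ isT)[E _ _].
  by rewrite basis_ket E /gen_ket /x0_ket !addr0.
Qed.

Lemma x1_tame : tame (fun k => rho x1 (ebasis k)) (fun _ _ => 0).
Proof.
have T1 := BpCp_tame q_gt0 q_lt1.
have := @gen_tame R q q_gt0 q_lt1 (Bp q) (B0 q) (Bm q) 1 _ _ _ _ T1.
move=> h; apply: (tame_eq (h _ _ _)) => [k|k|k hk|k|//].
- by have [pa pb pc pd pj] := k_pos k; exact: Bp_bnd.
- have [pa pb pc pd pj] := k_pos k.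
  by apply: (bnd_le q_gt0 q_lt1 _ _ (B0_bnd q_gt0 q_lt1 pj pc pd)) => //; lra.
- have [pa pb pc pd pj] := k_pos k.
  have hk' : 1 <= kj k - km1 k by apply: le_trans hk; rewrite lerDl.
  by apply: (bnd_le q_gt0 q_lt1 _ _ (Bm_bnd q_gt0 q_lt1 pj pc pd hk')) => //; lra.
- have [_ /(_ k.1 (kl k) (km1 k) (km2 k) (kj k))] := rhoP.
  rewrite -val_lattice (valP k.2) => /(_ isT)[_ E _].
  by rewrite basis_ket E.
Qed.

Lemma x2_tame : tame (fun k => rho x2 (ebasis k)) (fun _ t => circle_u t).
Proof.
have T1 := Dp_tame q_gt0 q_lt1.
have T2 : tame (fun k => (sg R k.1 * D0 q (kl k) (kj k) (km2 k))%:C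
    *: kt R (mv false (0, 0, 1, 0) k)) (fun _ _ => 0).
  apply: (@tame_coefs _ _ q_gt0 q_lt1 _ _ 10 2) => k k' E.
  have [_ _ _ _ [-> _]] := k_coords k.
  have B := bndM q_gt0 (sg_bnd q k.1) (D0_bnd q_gt0 q_lt1 (k_ljm k)).
  by apply: (bnd_le q_gt0 q_lt1 _ _ B) => //; lra.
have T3 : tame (fun k => (Dm q (kl k) (kj k) (km2 k))%:C
    *: kt R (mv false (-1, 0, 1, 0) k)) (fun _ _ => 0).
  apply: (@tame_coefa _ _ q_gt0 q_lt1 _ _ 10 2) => // k k' E.
  have [ha _ hc _ [_ ->]] := k_coords k; have [pa pb pc pd pj] := k_pos k.
  have B := Dm_bnd q_gt0 q_lt1 (k_ljm k).
  by apply: (bnd_le q_gt0 q_lt1 _ _ B) => //; rewrite ha hc; lra.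
apply: (tame_eq (tameD (tameD T1 T2) T3)) => [k|b t]; last by rewrite !addr0.
have [_ /(_ k.1 (kl k) (km1 k) (km2 k) (kj k))] := rhoP.
rewrite -val_lattice (valP k.2) => /(_ isT)[_ _ E].
have kE (l : rat) : kt R (mv false (l, 0, 1, 0) k) =
    ket R k.1 (kl k + l) (km1 k) (km2 k + 1) (kj k).
  have := ketE R false l 0 1 0 k; rewrite addbF => <-.
  by rewrite -/(kl k) -/(km1 k) -/(km2 k) -/(kj k) !addr0.
by rewrite basis_ket E /x2_ket !kE addr0.
Qed.

(** Induction on terms, as the quotient has no induction principle of its own. The symbol is the
    same at both characters because the algebra preserves the chirality. The star is handled by the
    matrix of the adjoint, which [rho] determines on basis vectors. *)
Lemma rho_term_tame (t : sterm R) :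
  tame (fun k => rho (spi q t) (ebasis k)) (fun _ theta => classical_value theta t).
Proof.
have [[_ rho1 rholin rhoM rhostar] _] := rhoP.
elim: t => [i|c|a iha b ihb|a iha b ihb|a iha].
- have cg j (jlt : (j < 3)%N) : i = inord j -> SGen i = SGen (inord j) :> sterm R by move=> ->.
  have [i0|i0] := eqVneq (i : nat) 0%N.
    have -> : i = inord 0 by apply: val_inj; rewrite /= inordK.
    by apply: (tame_eq x0_tame) => // b t; rewrite /= /classical_gen inordK.
  have [i1|i1] := eqVneq (i : nat) 1%N.
    have -> : i = inord 1 by apply: val_inj; rewrite /= inordK.
    by apply: (tame_eq x1_tame) => // b t; rewrite /= /classical_gen inordK.
  have -> : i = inord 2.
    apply: val_inj; rewrite /= inordK//; have := ltn_ord i.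
    by case: (nat_of_ord i) i0 i1 => [|[|[|?]]].
  by apply: (tame_eq x2_tame) => // b t; rewrite /= /classical_gen inordK.
- have m : mainfun c (fun=> c) by apply: decays_ext (decays0 R id) => n; rewrite subrr.
  apply: (tame_eq (tame_main false 0 m (fun h : 0%Z <> 0 => False_ind _ (h erefl)))) => [k|b t].
    rewrite kt_basis.
    have -> : spi q (SConst c) = c *: (1 : sphere q) by rewrite -[LHS]sphere_mulr1.
    have := rholin c 1 0; rewrite addr0 => ->.
    have -> : rho 0 = 0.
      by have := rholin (-1) 0 0; rewrite scaler0 addr0 scaleN1r addNr.
    by rewrite rho1 /= addr0.
  by rewrite andbF expr0 mul1r expr0z mulr1.
- apply: (tame_eq (tameD iha ihb)) => // k.
  rewrite -spiD; have := rholin 1 (spi q a) (spi q b); rewrite !scale1r => h.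
  by rewrite -[sphere_add _ _]/(spi q a + spi q b) h.
- apply: (tame_eq (tame_comp (rho_linear (spi q a)) iha ihb)) => [k|b' t]; last by rewrite mulrC.
  by rewrite -spiM -[sphere_mul _ _]/(spi q a * spi q b) rhoM.
- have [C' tC' C'E] := tame_adj iha.
  apply: (tame_eq tC') => // k; apply: hilbert_ext => k'.
  rewrite C'E -spi_star; have := rhostar (spi q a) (ebasis k) (ebasis k').
  by rewrite inner_basisl inner_basisr => <-; rewrite conjcK.
Qed.

(** A morphism is determined by its values on the generators, so the given sigma agrees with the
    evaluation of terms, which is the symbol found above. *)
Lemma sigma_term (sigma : sphere q -> R -> R[i]) : classical_points sigma ->
  forall t theta, sigma (spi q t) theta = classical_value theta t.
Proof.
move=> [[_ s1 slin sM sstar] s0 sx1 sx2].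
elim=> [i|c|a iha b ihb|a iha b ihb|a iha] theta.
- have [i0|i0] := eqVneq (i : nat) 0%N.
    have -> : i = inord 0 by apply: val_inj; rewrite /= inordK.
    by rewrite -[spi q _]/(@x0 R q) s0 /= /classical_gen inordK.
  have [i1|i1] := eqVneq (i : nat) 1%N.
    have -> : i = inord 1 by apply: val_inj; rewrite /= inordK.
    by rewrite -[spi q _]/(@x1 R q) sx1 /= /classical_gen inordK.
  have -> : i = inord 2.
    apply: val_inj; rewrite /= inordK//; have := ltn_ord i.
    by case: (nat_of_ord i) i0 i1 => [|[|[|?]]].
  by rewrite -[spi q _]/(@x2 R q) sx2 /= /classical_gen inordK.
- have -> : spi q (SConst c) = c *: (1 : sphere q) by rewrite -[LHS]sphere_mulr1.
  have := slin c 1 0; rewrite addr0 => ->.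
  have -> : sigma 0 = 0.
    by have := slin (-1) 0 0; rewrite scaler0 addr0 scaleN1r addNr.
  rewrite s1 /= addr0.
  by rewrite /GRing.scale /= /GRing.scale /= mulr1.
- rewrite -spiD -[sphere_add _ _]/(spi q a + spi q b).
  by have := slin 1 (spi q a) (spi q b); rewrite !scale1r => ->; rewrite /= -iha -ihb.
- by rewrite -spiM -[sphere_mul _ _]/(spi q a * spi q b) sM /= -iha -ihb.
- by rewrite -spi_star sstar /= iha.
Qed.

Lemma rho_tame (sigma : sphere q -> R -> R[i]) a : classical_points sigma ->
  tame (fun k => rho a (ebasis k)) (fun _ theta => sigma a theta).
Proof.
move=> sP; rewrite -(sreprK a).
by apply: (tame_eq (rho_term_tame (srepr a))) => // b t; rewrite (sigma_term sP).
Qed.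

Definition tame_op T := linear T /\ exists p, tame (fun k => T (ebasis k)) p.

Lemma linearZ_op T (c : R[i]) u : linear T -> T (c *: u) = c *: T u.
Proof.
move=> linT; have T0 : T 0 = 0.
  by have := linT (-1) 0 0; rewrite scaler0 addr0 scaleN1r addNr.
by have := linT c u 0; rewrite T0 !addr0.
Qed.

(** A commutator is known only through its relation on the domain. Basis vectors belong to the
    domain and go to multiples of basis vectors, so the relation determines the matrix of the
    bounded extension. *)
Lemma delta_orbit_tame T : delta_orbit rho T -> tame_op T.
Proof.
have rt a : tame_op (rho a).
  split; first exact: rho_linear.
  exists (fun _ theta => classical_value theta (srepr a)).
  by rewrite -{1}(sreprK a); exact: rho_term_tame.
elim=> {T} [a|a S|T S _ [linT [p tT]]].
- exact: rt.
- move=> [[linS _] comm]; have [linT [p tT]] := rt a; split=> //.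
  have [C' [p' [tC' C'E]]] := tame_dirac_comm tT.
  exists p'; apply: (tame_eq tC') => // k; apply: hilbert_ext => k'; rewrite C'E.
  have dk : Defs.dirac (ebasis k) ((Defs.eigenvalue R k.2)%:C *: ebasis (flip k)).
    move=> c p0; rewrite hilbertZE !basisE /flip.
    case: k k' => [c1 p1] _ /=; rewrite !xpair_eqE.
    have [->|ne] := eqVneq p0 p1; last by rewrite !andbF !mulr0.
    by rewrite !andbT; congr (_ * _%:R); case: c c1 => [] [].
  have := comm _ _ dk k'.1 k'.2; rewrite hilbertDE (linearZ_op _ _ linT) hilbertZE.
  rewrite -[(k'.1, k'.2)]surjective_pairing -[(~~ k'.1, k'.2)]/(flip k').
  by move=> <-; rewrite addrK.
- move=> [[linS _] comm]; split=> //.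
  have [C' [p' [tC' C'E]]] := tame_abs_comm tT.
  exists p'; apply: (tame_eq tC') => // k; apply: hilbert_ext => k'; rewrite C'E.
  have dk : abs_dirac (ebasis k) ((Defs.eigenvalue R k.2)%:C *: ebasis k).
    move=> c p0; rewrite hilbertZE !basisE.
    have [<-|ne] := eqVneq (c, p0) k; first by [].
    by rewrite !mulr0.
  have := comm _ _ dk k'.1 k'.2; rewrite hilbertDE (linearZ_op _ _ linT) hilbertZE.
  rewrite -[(k'.1, k'.2)]surjective_pairing.
  by move=> <-; rewrite addrK.
Qed.

Lemma Psi0_tame T : Psi0 rho T -> tame_op T.
Proof.
elim=> {T} [T|c T _ [linT [p tT]]|T S _ [linT [p tT]] _ [linS [p' tS]]|
  T S _ [linT [p tT]] _ [linS [p' tS]]].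
- exact: delta_orbit_tame.
- split; first by move=> a u w; rewrite linT scalerDr !scalerA mulrC.
  by eexists; exact: tameZ tT.
- split; first by move=> a u w; rewrite linT linS scalerDr addrACA.
  by eexists; exact: tameD tT tS.
- split; first by move=> a u w; rewrite /= linS linT.
  by eexists; exact: tame_comp linT tT tS.
Qed.

End Representation.

(** * Traces and zeta functions *)

Section Levels.
Implicit Types (k : basis_index) (a c i j l m n : nat).

Lemma odd_pair a j : odd (a + (j.*2 + ~~ odd a)).
Proof. by rewrite !oddD odd_double /= oddb addbN addbb. Qed.

(** A parametrization without parity conditions: b and d are given by their halves j and l, their
    last bits being forced by a and c. *)
Definition lat a j c l : lattice :=
  Sub (mk a (j.*2 + ~~ odd a) c (l.*2 + ~~ odd c))
    (in_range_mk (odd_pair a j) (odd_pair c l)).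

Lemma lat_coord a j c l : [/\ ca (lat a j c l) = a,
  cb (lat a j c l) = (j.*2 + ~~ odd a)%N, cc (lat a j c l) = c
  & cd (lat a j c l) = (l.*2 + ~~ odd c)%N].
Proof. by apply: coord_mk; rewrite SubK. Qed.

Lemma lat_inv p : p = lat (ca p) (cb p)./2 (cc p) (cd p)./2.
Proof.
have [odd1 odd2 E] := coordE p.
have h m n : odd (m + n) -> n = (n./2.*2 + ~~ odd m)%N.
  rewrite oddD => o; have := odd_double_half n.
  by move: o; case: (odd m) (odd n) => [] [] //= _ <-; rewrite ?half_double ?uphalf_double; lia.
by apply: val_inj; rewrite SubK {1}E -(h _ _ odd1) -(h _ _ odd2).
Qed.

(** The index n of the eigenvalue $N = n + 2$; it is $\lfloor a/2\rfloor + j + \lfloor c/2\rfloor +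
    l$. *)
Definition level k := (sz k)./2.-1.

Lemma level_lat (x : bool) a j c l : level (x, lat a j c l) = (a./2 + j + c./2 + l)%N.
Proof.
rewrite /level /sz; have /= [-> -> -> ->] := lat_coord a j c l.
have := odd_double_half a; have := odd_double_half c.
have -> : (a + (j.*2 + ~~ odd a) + c + (l.*2 + ~~ odd c) =
  (a./2 + j + c./2 + l).+1.*2)%N.
  by have := odd_double_half a; have := odd_double_half c; case: odd; case: odd => /=; lia.
by rewrite doubleK.
Qed.

Lemma sz_level k : sz k = (level k).*2.+2.
Proof.
case: k => x p; rewrite (lat_inv p); rewrite level_lat.
set a := ca p; set j := (cb p)./2; set c := cc p; set l := (cd p)./2.
rewrite /sz; have /= [-> -> -> ->] := lat_coord a j c l.
by have := odd_double_half a; have := odd_double_half c; case: odd; case: odd => /=; lia.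
Qed.

(** The parameters (a, c, chirality, j) of points of level n, with l determined by the others. The
    ranges are those forced by [a./2], [c./2] and j being at most n. *)
Definition level_param n : finType := ('I_n.+1.*2 * 'I_n.+1.*2 * bool * 'I_n.+1)%type.
Definition level_ok n (x : level_param n) := (x.1.1.1./2 + x.1.1.2./2 + x.2 <= n)%N.
Definition level_point n (x : level_param n) : basis_index := (x.1.2,
  lat x.1.1.1 x.2 x.1.1.2 (n - (x.1.1.1./2 + x.1.1.2./2 + x.2))).
Definition level_seq n := [seq level_point x | x <- enum (@level_ok n)].

Lemma level_seq_uniq n : uniq (level_seq n).
Proof.
rewrite map_inj_in_uniq ?enum_uniq// => x y _ _.
case: x y => [[[a c] x] j] [[[a' c'] x'] j'] e.
have := congr1 fst e; rewrite /= => ->.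
move: (congr1 (fun k => (ca k.2, cb k.2, cc k.2)) e); rewrite /level_point /=.
have [-> -> -> _] := lat_coord a j c (n - (a./2 + c./2 + j)).
have [-> -> -> _] := lat_coord a' j' c' (n - (a'./2 + c'./2 + j')).
move=> [ea + ec]; rewrite -ea => /eqP; rewrite eqn_add2r => /eqP/double_inj ej.
by congr (_, _, _, _); apply: val_inj.
Qed.

Lemma mem_level_seq n k : (k \in level_seq n) = (level k == n).
Proof.
apply/mapP/eqP => [[x]|kn].
  rewrite mem_enum /in_mem /= /level_ok => h ->; rewrite level_lat -[in RHS](subnKC h).
  by lia.
case: k kn => x p; rewrite (lat_inv p) level_lat.
set a := ca p; set j := (cb p)./2; set c := cc p; set l := (cd p)./2 => E.
have b1 m : (m./2 <= n)%N -> (m < n.+1.*2)%N by rewrite -ltn_half_double ltnS.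
have la : (a < n.+1.*2)%N by apply: b1; lia.
have lc : (c < n.+1.*2)%N by apply: b1; lia.
have lj : (j < n.+1)%N by lia.
exists (Ordinal la, Ordinal lc, x, Ordinal lj).
  rewrite mem_enum /in_mem /= /level_ok /=.  lia.
by rewrite /level_point /=; congr (_, lat _ _ _ _); lia.
Qed.

Lemma sum_level (V : nmodType) n (F : basis_index -> V) :
  \sum_(k <- level_seq n) F k = \sum_(a < n.+1.*2) \sum_(c < n.+1.*2) \sum_(x : bool)
    \sum_(j < n.+1 | (a./2 + c./2 + j <= n)%N)
      F (x, lat a j c (n - (a./2 + c./2 + j))).
Proof.
rewrite big_map big_enum_cond /=.
by rewrite !pair_big_dep /=; apply: eq_big => // -[[[a c] x] j]; rewrite /= !andbT.
Qed.

(* The number of points at level n with a given first coordinate a. *)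
Definition mult n a := (2 * ((n.+1 - a./2) * (n.+1 - a./2).+1))%N.

(** Each value of [c./2] occurs twice, so this is twice a triangular number; the terms with [c./2]
    above m vanish by truncated subtraction. *)
Lemma sum_sub_half M m : (m <= M)%N ->
  (\sum_(c < M.*2) (m - c./2) = m * m.+1)%N.
Proof.
elim: M m => [|M ih] m; first by case: m => // _; rewrite big_ord0.
rewrite leq_eqVlt => /predU1P[->|mM].
  rewrite doubleS big_ord_recl big_ord_recl /=.
  under eq_bigr do rewrite /bump /= add0n subSS.
  by rewrite ih//; lia.
rewrite doubleS !big_ord_recr /= ih// uphalf_double doubleK.
by have -> : (m - M = 0)%N; lia.
Qed.

Lemma mult_count n a : (a < n.+1.*2)%N ->
  (\sum_(c < n.+1.*2) \sum_(x : bool) \sum_(j < n.+1 | a./2 + c./2 + j <= n) 1 =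
  mult n a)%N.
Proof.
move=> an; rewrite /mult -(@sum_sub_half n.+1) ?leq_subr// big_distrr /=.
apply: eq_bigr => c _; rewrite sum_nat_const card_bool; congr (_ * _)%N.
have le : (n.+1 - a./2 - c./2 <= n.+1)%N by lia.
rewrite -[RHS]mul1n -[X in (_ * X)%N](card_ord (n.+1 - a./2 - c./2)) mulnC -sum_nat_const.
rewrite (big_ord_widen_cond n.+1 xpredT (fun=> 1%N))//=.
by apply: eq_bigl => j; lia.
Qed.

(** The induction removes a = 0 and a = 1, since [mult n.+1 a.+2] is [mult n a]. The right side is
    $4(N^3 - N)$ with $N = n + 2$. *)
Lemma sum_mult n : (3 * \sum_(a < n.+1.*2) mult n a = 4 * (n.+1 * n.+2 * n.+3))%N.
Proof.
elim: n => [|n ih]; first by rewrite !big_ord_recr big_ord0.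
rewrite doubleS big_ord_recl big_ord_recl /=.
rewrite (eq_bigr (fun i : 'I_n.+1.*2 => mult n i)); last first.
  by move=> i _; rewrite /bump /mult /= add0n subSS.
by rewrite !mulnDr ih /mult /=; lia.
Qed.

End Levels.

(** * Asymptotics of the partial traces *)

Section TraceAsymptotics.
Variable R : realType.
Implicit Types (k : basis_index) (g : nat -> R[i]) (e : basis_index -> R[i]) (n : nat).

Lemma decays_csummable g : decays id g -> csummable g.
Proof.
move=> [K [th [K0 /andP[t0 t1] gK]]]; apply: (csummable_le gK).
by apply/rsummableZ/rsummable_geom; rewrite ltW.
Qed.

Lemma csum_finite g M : (forall a, (M <= a)%N -> g a = 0) ->
  csummable g /\ csum g = \sum_(a < M) g a.
Proof.
elim: M g => [|M ih] g gM.
  have -> : g = fun=> 0 by apply/funext => a; exact: gM.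
  by rewrite csum0 big_ord0; split=> //; exact: csummable0.
pose g1 a := if a == M then g M else 0; pose g2 a := if a == M then 0 else g a.
have gE : g = fun a => g2 a + g1 a.
  by apply/funext => a; rewrite /g1 /g2; case: eqVneq => [->|_]; rewrite ?add0r ?addr0.
have [a Ma|s2 E2] := ih g2.
  by rewrite /g2; case: eqVneq => // ne; apply: gM; rewrite ltn_neqAle eq_sym ne.
have s1 : csummable g1.
  apply: (@csummable_le _ _ _ (fun a => normc (g M) * 2 ^+ M * (1 / 2) ^+ a)); last first.
    by apply/rsummableZ/rsummable_geom; apply/andP; split; lra.
  move=> a; rewrite /g1; case: eqP => [->|_].
    by rewrite -mulrA -exprMn (_ : 2 * (1 / 2) = 1) ?expr1n ?mulr1//; field.
  by rewrite normc0E !mulr_ge0 ?normc_ge0 ?exprn_ge0//; lra.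
rewrite {1 2}gE csumD//; split; first exact: csummableD.
rewrite E2 (@csum_single _ _ g1 M); last by move=> j; rewrite /g1 => /negbTE ->.
rewrite big_ord_recr /= /g1 eqxx; congr (_ + _).
by apply: eq_bigr => i _; rewrite /g2 ltn_eqF.
Qed.

(** An error linear in N is obtained at the price of the factor $a + 1$, which the decay of g
    absorbs. The bound also covers the a that do not occur at level n, where [mult] is 0. *)
Lemma mult_bound n a : `|(mult n a)%:R - 2 * (n%:R + 2) ^+ 2| <=
  4 * (n%:R + 2) * (a%:R + 1) :> R.
Proof.
have n0 := ler0n R n; have a0 := ler0n R a; rewrite /mult.
have h0 := ler0n R a./2.
have ha : 2 * (a./2)%:R <= a%:R :> R.
  by rewrite -natrM ler_nat mul2n -[leqRHS](odd_double_half a) leq_addl.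
have [le|lt] := leqP a./2 n.+1.
  rewrite !natrM -[(_ - _).+1%:R]natr1 natrB// -[(n.+1)%:R]natr1.
  have hn : (a./2)%:R <= n%:R + 1 :> R by rewrite natr1 ler_nat.
  move: (a./2)%:R h0 ha hn => h h0 ha hn.
  have p1 : 0 <= (n%:R + 2) * (a%:R - 2 * h) by apply: mulr_ge0; lra.
  have p2 : 0 <= (n%:R + 1 - h) * (h + 1) by apply: mulr_ge0; lra.
  have p3 : 0 <= n%:R * h by apply: mulr_ge0.
  have p4 : 0 <= h * h by apply: mulr_ge0.
  have p5 : 0 <= n%:R * a%:R :> R by apply: mulr_ge0.
  by rewrite ler_norml expr2; apply/andP; split; nra.
have -> : (n.+1 - a./2 = 0)%N by apply/eqP; rewrite subn_eq0 ltnW.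
have hn : n%:R + 1 <= (a./2)%:R :> R by rewrite natr1 ler_nat ltnW.
rewrite mul0n muln0 sub0r normrN ger0_norm; last by nonneg.
have N0 : 0 <= (n%:R + 2) * (a%:R - (n%:R + 2)) :> R by apply: mulr_ge0; lra.
by nra.
Qed.

Lemma sum_level_cst n (kappa : R[i]) : \sum_(k <- level_seq n) kappa =
  (4 / 3) * kappa * ((n%:R + 2) ^+ 3 - (n%:R + 2)).
Proof.
have -> : \sum_(k <- level_seq n) kappa = kappa *+ \sum_(a < n.+1.*2) mult n a.
  rewrite -(eq_bigr _ (fun a _ => mult_count (ltn_ord a))) -sumrMnr sum_level.
  apply: eq_bigr => a _; rewrite -sumrMnr; apply: eq_bigr => c _; rewrite -sumrMnr.
  by apply: eq_bigr => x _; rewrite -sumrMnr; apply: eq_bigr.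
have E : 3 * (\sum_(a < n.+1.*2) mult n a)%:R =
    4 * ((n%:R + 1) * (n%:R + 2) * (n%:R + 3)) :> R[i].
  by rewrite -natrM sum_mult !natrM -(addn3 n) -(addn2 n) -(addn1 n) !natrD.
rewrite -[LHS]mulr_natr; have -> : (\sum_(a < n.+1.*2) mult n a)%:R =
    4 * ((n%:R + 1) * (n%:R + 2) * (n%:R + 3)) / 3 :> R[i].
  by rewrite -E mulrC mulKf.
by field.
Qed.

(** The finite sum is written as an infinite one, so that it can be compared term by term with $2
    N^2 \sum g$. *)
Lemma sum_level_first n g : csummable (fun a => g a * (mult n a)%:R) /\
  \sum_(k <- level_seq n) g (ca k.2) = csum (fun a => g a * (mult n a)%:R).
Proof.
have [|sm ->] := @csum_finite (fun a => g a * (mult n a)%:R) n.+1.*2.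
  move=> a an; rewrite /mult (_ : n.+1 - a./2 = 0)%N ?mulr0//.
  by apply/eqP; rewrite subn_eq0 -(doubleK n.+1) half_leq.
split=> //; rewrite sum_level; apply: eq_bigr => a _; rewrite mulr_natr -mult_count//.
rewrite -sumrMnr; apply: eq_bigr => c _; rewrite -sumrMnr.
apply: eq_bigr => x _; rewrite -sumrMnr; apply: eq_bigr => j _.
by have [-> _ _ _] := lat_coord a j c (n - (a./2 + c./2 + j)).
Qed.

(** At most $2(n+1)$ points of level n have given a and c, and the geometric series in a and c are
    bounded. *)
Lemma sum_level_decays e : decays ac e -> exists2 K : R, 0 <= K &
  forall n, normc (\sum_(k <- level_seq n) e k) <= K * (n%:R + 2).
Proof.
move=> [K [th [K0 /andP[t0 t1] eK]]].
have i0 : 0 < (1 - th)^-1 by rewrite invr_gt0 subr_gt0.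
exists (2 * K * (1 - th)^-1 ^+ 2) => [|n]; first by nonneg; lra.
have geo M : \sum_(c < M) th ^+ c <= (1 - th)^-1.
  rewrite -[leRHS]mul1r ler_pdivlMr ?subr_gt0// mulrC.
  by rewrite -[leLHS]opprK -mulNr opprB -subrX1 opprB gerBl exprn_ge0// ltW.
have th0 M : 0 <= th ^+ M by rewrite exprn_ge0// ltW.
apply: le_trans (normc_sum _ _) _.
apply: (@le_trans _ _ (\sum_(k <- level_seq n) K * th ^+ ac k)); first exact: ler_sum.
rewrite sum_level; apply: (@le_trans _ _ (\sum_(a < n.+1.*2) \sum_(c < n.+1.*2)
    (2 * K * (n%:R + 2)) * (th ^+ a * th ^+ c))).
  apply: ler_sum => a _; apply: ler_sum => c _.
  apply: (@le_trans _ _ (\sum_(x : bool) \sum_(j < n.+1) K * (th ^+ a * th ^+ c))).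
    apply: ler_sum => x _; rewrite big_mkcond; apply: ler_sum => j _.
    case: ifP => _; last by rewrite !mulr_ge0.
    rewrite /ac; have /= [-> _ -> _] := lat_coord a j c (n - (a./2 + c./2 + j)).
    by rewrite exprD.
  rewrite sumr_const card_bool sumr_const card_ord -!mulrnA -[leLHS]mulr_natr natrM.
  have -> : 2 * K * (n%:R + 2) * (th ^+ a * th ^+ c) =
    K * (th ^+ a * th ^+ c) * ((n%:R + 2) * 2) by ring.
  rewrite ler_wpM2l ?mulr_ge0// ler_wpM2r// -natr1.
  lra.
under eq_bigr do rewrite -mulr_sumr -mulr_sumr.
rewrite -mulr_sumr -mulr_suml.
have -> : 2 * K * (1 - th)^-1 ^+ 2 * (n%:R + 2) =
  2 * K * (n%:R + 2) * ((1 - th)^-1 * (1 - th)^-1) by ring.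
rewrite ler_wpM2l ?mulr_ge0//.
by apply: ler_pM; rewrite ?sumr_ge0.
Qed.

Lemma trace_asymptotics kappa g e : decays id g -> decays ac e ->
  exists2 K : R, 0 <= K & forall n,
    normc (\sum_(k <- level_seq n) (kappa + g (ca k.2) + e k) -
      (4 / 3 * kappa * (n%:R + 2) ^+ 3 + 2 * csum g * (n%:R + 2) ^+ 2)) <= K * (n%:R + 2).
Proof.
move=> dg /sum_level_decays[Ke Ke0 hKe]; have sg := decays_csummable dg.
have dg1 : decays id (fun a => (a%:R + 1 : R)%:C * g a).
  apply: (@decays_poly _ _ _ _ _ 1 1) => // a.
  by rewrite mul1r ger0_norm// addr_ge0.
pose h a := normc ((a%:R + 1 : R)%:C * g a).
have sh : rsummable h := decays_csummable dg1.
have h0 : 0 <= rsum h by apply: rsum_ge0 => a; exact: normc_ge0.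
have k0 := normc_ge0 kappa.
exists (4 / 3 * normc kappa + 8 * rsum h + Ke) => [|n]; first by nonneg; lra.
have N0 := natD2_gt0 R n.
have NE : (n%:R + 2)%:C = n%:R + 2 :> R[i] by rewrite rmorphD !rmorph_nat.
have [s1 sE] := sum_level_first n g.
rewrite 2!big_split /= sum_level_cst sE -!NE.
set N := n%:R + 2 in N0 *; set S := \sum_(k <- _) e k.
have gN a : normc (g a * ((mult n a)%:R - (2 * N ^+ 2)%:C)) <= 4 * N * h a.
  rewrite -(rmorph_nat (real_complex R)) -rmorphB /h mulrC !Normc.normcM !normc_real.
  rewrite [leRHS]mulrA ler_wpM2r ?normc_ge0// [`|_ + 1|]ger0_norm ?addr_ge0//.
  exact: mult_bound.
have T2 : normc (csum (fun a => g a * (mult n a)%:R) - (2 * N ^+ 2)%:C * csum g) <=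
    2 * (4 * N * rsum h).
  rewrite -csumZ// -csumB//; last exact: csummableZ.
  rewrite -rsumZ//; apply: normc_csum; last exact: rsummableZ.
  by move=> a; rewrite [_%:C * g a]mulrC -mulrBr.
have -> : (4 / 3) * kappa * (N%:C ^+ 3 - N%:C) + csum (fun a => g a * (mult n a)%:R) + S -
    (4 / 3 * kappa * N%:C ^+ 3 + 2 * csum g * N%:C ^+ 2) =
    (- (4 / 3 * N)%:C * kappa) +
    (csum (fun a => g a * (mult n a)%:R) - (2 * N ^+ 2)%:C * csum g) + S.
  have -> : (2 * N ^+ 2)%:C = 2 * N%:C ^+ 2 by rewrite rmorphM rmorphXn rmorph_nat.
  have -> : (4 / 3 * N)%:C = 4 / 3 * N%:C by rewrite rmorphM fmorph_div !rmorph_nat.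
  by ring.
apply: le_trans (le_normcD _ _) _; rewrite [leRHS]mulrDl; apply: lerD; last exact: hKe.
rewrite [leRHS]mulrDl; apply: le_trans (le_normcD _ _) _. apply: lerD.
  rewrite Normc.normcM normcN normc_real ger0_norm; last by nonneg; lra.
  by rewrite [leLHS]mulrAC.
by apply: le_trans T2 _; rewrite le_eqVlt; apply/orP; left; apply/eqP; ring.
Qed.

(** The zeta functions are built from expansions that are only known to exist; uniqueness lets their
    coefficients be read off from any explicit expansion of the same trace. *)
Lemma asymptotics_unique (a b : R[i]) (K : R) :
  (forall n, normc (a * (n%:R + 2) ^+ 3 + b * (n%:R + 2) ^+ 2) <= K * (n%:R + 2)) ->
  a = 0 /\ b = 0.
Proof.
move=> hK.
have NE n : (n%:R + 2)%:C = n%:R + 2 :> R[i] by rewrite rmorphD !rmorph_nat.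
have arch (x y : R) : 0 <= x -> (forall n, x * (n%:R + 2) <= y) -> x = 0.
  move=> x0 hy; apply/eqP; rewrite eq_le x0 andbT leNgt; apply/negP => x1.
  have y0 : 0 <= y by apply: le_trans (hy 0%N); rewrite mulr_ge0 ?addr_ge0.
  have := hy (Num.truncn (y / x)).+1; apply/negP; rewrite -ltNge.
  rewrite mulrC -ltr_pdivrMr//; apply: lt_le_trans (truncnS_gt _) _.
  by rewrite lerDl.
have hN n : normc a * (n%:R + 2) ^+ 2 <= K + normc b * (n%:R + 2).
  have N0 := natD2_gt0 R n; rewrite -(ler_pM2r N0).
  have := hK n; rewrite -NE; set N := n%:R + 2 in N0 * => h.
  have : normc (a * N%:C ^+ 3) <= K * N + normc (b * N%:C ^+ 2).
    rewrite -[a * _](addrK (b * N%:C ^+ 2)); apply: le_trans (le_normcB _ _) _.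
    by rewrite lerD2r.
  rewrite !(normcX, Normc.normcM) !normc_real (ger0_norm (ltW N0)) => h3.
  have -> : normc a * N ^+ 2 * N = normc a * N ^+ 3 by ring.
  by have -> : (K + normc b * N) * N = K * N + normc b * N ^+ 2 by ring.
have b0 := normc_ge0 b; have a0 := normc_ge0 a.
have K0 : 0 <= K.
  have := le_trans (normc_ge0 _) (hK 0%N); have := natD2_gt0 R 0 => h.
  by rewrite pmulr_lge0.
have az : a = 0.
  apply: Normc.eq0_normc; apply: (arch _ (K + normc b)) => // n.
  have N0 := natD2_gt0 R n; have n0 := ler0n R n; rewrite -(ler_pM2r N0).
  rewrite -mulrA -expr2; apply: le_trans (hN n) _; rewrite mulrDl lerD2r.
  by rewrite ler_peMr//; lra.
split=> //; apply: Normc.eq0_normc; apply: (arch _ K) => // n.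
have N0 := natD2_gt0 R n; have := hK n; rewrite az mul0r add0r -NE.
rewrite Normc.normcM normcX normc_real (ger0_norm (ltW N0)).
by rewrite expr2 mulrA ler_pM2r.
Qed.

End TraceAsymptotics.

(** * From traces to zeta functions and their poles *)

Section ZetaExpansion.
Variable R : realType.
Implicit Types (k : basis_index) (T : hilbert R -> hilbert R) (s z : R[i]) (n : nat).
Implicit Types (alpha beta : R[i]) (x : nat -> R[i]).
Local Notation ebasis := (Defs.basis R).

Lemma simple_poleP (F G : R[i] -> R[i]) c s : c != 0 -> holomorphic_at G s ->
  (forall z, z != s -> F z = c / (z - s) + G z) -> is_simple_pole F s.
Proof.
move=> c0 hG FE; exists (fun z => c + (z - s) * G z); split.
- apply (@holoD _ (fun=> c) (fun z => (z - s) * G z) s); first exact: holo_cst.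
  by refine (@holoM _ (fun z => z - s) G s _ hG); exact: holo_sub.
- by rewrite subrr mul0r addr0.
- apply/dnearcP; exists 1 => // z _ zs; rewrite FE// expr1.
  have z0 : z - s != 0 by rewrite subr_eq0.
  by rewrite mulrDl [(z - s) * _]mulrC mulfK.
Qed.

Lemma residueP (F G : R[i] -> R[i]) c s : holomorphic_at G s ->
  (forall z, z != s -> F z = c / (z - s) + G z) -> is_residue F s c.
Proof.
move=> hG FE; exists 0%N, (fun=> c), G; split=> //.
by apply/dnearcP; exists 1 => // z _ zs; rewrite FE// big_ord1 expr1.
Qed.

Definition cubic_seq x := exists K : R, forall n, normc (x n) <= K * cub R n.

(** [zeta3 s] continues $\sum N^{3-s}$ and [zeta3 (s + 1)] continues $\sum N^{2-s}$; the last sum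
    carries the rest of the trace, of order $N^{1 - Re s}$. *)
Definition zfun alpha beta x s :=
  alpha * zeta3 s + beta * zeta3 (s + 1) + csum (fun n => powN (4 - s) n * x n).

Lemma zeta3_holo s : 2 < Re s -> s != 4 -> holomorphic_at (@zeta3 R) s.
Proof.
move=> s2 s4; have := @zeta3_shift_holo R 0 s; rewrite addr0.
have -> : (fun s => zeta3 (s + 0)) = @zeta3 R by apply/funext => y; rewrite addr0.
by apply.
Qed.

Lemma zeta3_shift1_holo s : 2 < Re s -> s != 3 ->
  holomorphic_at (fun s => zeta3 (s + 1)) s.
Proof.
move=> s2 s3; apply (@zeta3_shift_holo R 1 s); first by rewrite ReD /=; lra.
apply: contra_neq s3 => e; have -> : s = s + 1 - 1 by rewrite addrK.
by rewrite e; ring.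
Qed.

Lemma zrem_holo x s : cubic_seq x -> 2 < Re s ->
  holomorphic_at (fun s => csum (fun n => powN (4 - s) n * x n)) s.
Proof.
move=> [K xK] s2.
apply (@holo_reflect _ (fun w => csum (fun n => powN w n * x n)) 4 s).
apply (@cubic_holo R (fun n _ => x n)); first by rewrite ReD ReN /=; lra.
by move=> z; apply (@cubic_cst R x K z xK).
Qed.

Lemma scale_holo c (f : R[i] -> R[i]) s : (c != 0 -> holomorphic_at f s) ->
  holomorphic_at (fun z => c * f z) s.
Proof.
have [->|c0] := eqVneq c 0 => hf.
  have -> : (fun z => 0 * f z) = fun=> 0 by apply/funext => z; rewrite mul0r.
  exact: holo_cst.
by refine (@holoM _ (fun=> c) f s _ (hf isT)); exact: holo_cst.
Qed.

Lemma zfun_holo alpha beta x s : cubic_seq x -> 2 < Re s ->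
  (alpha != 0 -> s != 4) -> (beta != 0 -> s != 3) ->
  holomorphic_at (zfun alpha beta x) s.
Proof.
move=> cx s2 s4 s3; have h3 := zrem_holo cx s2.
refine (@holoD _ (fun s => alpha * zeta3 s + beta * zeta3 (s + 1)) _ s _ h3).
apply (@holoD _ (fun s => alpha * zeta3 s) (fun s => beta * zeta3 (s + 1)) s).
  by apply scale_holo => /s4 h; apply zeta3_holo.
by apply scale_holo => /s3 h; apply zeta3_shift1_holo.
Qed.

Lemma ReNat m : Re (m%:R : R[i]) = m%:R.
Proof. by rewrite -(rmorph_nat (real_complex R)). Qed.

(** Only the first summand is singular at 4; [zfun 0 beta x] collects the others. *)
Lemma zfun_at4 alpha beta x : cubic_seq x -> exists G : R[i] -> R[i],
  holomorphic_at G 4 /\ forall s, s != 4 -> zfun alpha beta x s = alpha / (s - 4) + G s.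
Proof.
move=> cx; have [G [hG GE]] := zeta3_residue R.
have h43 : 4 != 3 :> R[i] by rewrite -subr_eq0 (_ : 4 - 3 = 1) ?oner_eq0//; ring.
have h := @zfun_holo 0 beta x 4 cx.
exists (fun s => alpha * G s + zfun 0 beta x s); split.
  apply (@holoD _ (fun s => alpha * G s) (zfun 0 beta x) 4).
    by apply scale_holo.
  by apply h => //; [rewrite ReNat; lra|rewrite eqxx].
move=> s s4; rewrite /zfun GE//; move: (csum _) (zeta3 _) => u w.
by rewrite mul0r add0r mulrDr mulrA mulr1; ring.
Qed.

Lemma zfun_at3 alpha beta x : cubic_seq x -> exists G : R[i] -> R[i],
  holomorphic_at G 3 /\ forall s, s != 3 -> zfun alpha beta x s = beta / (s - 3) + G s.
Proof.
move=> cx; have [G [hG GE]] := zeta3_residue R.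
have h34 : 3 != 4 :> R[i] by rewrite eq_sym -subr_eq0 (_ : 4 - 3 = 1) ?oner_eq0//; ring.
have h := @zfun_holo alpha 0 x 3 cx.
exists (fun s => beta * G (s + 1) + zfun alpha 0 x s); split.
  apply (@holoD _ (fun s => beta * G (s + 1)) (zfun alpha 0 x) 3).
    apply scale_holo => _.
    have e1 (y : R[i]) : 1 - (0 - y) = y + 1 by ring.
    have -> : (fun s => G (s + 1)) = (fun y => G (1 - (0 - y))).
      by apply/funext => y; rewrite e1.
    apply (@holo_reflect _ (fun y => G (1 - y)) 0 3).
    by apply (@holo_reflect _ G 1); rewrite e1 (_ : 3 + 1 = 4)//; ring.
  by apply h => //; [rewrite ReNat; lra|rewrite eqxx].
move=> s s3; have s4 : s + 1 != 4.
  apply: contra_neq s3 => e; have -> : s = s + 1 - 1 by rewrite addrK.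
  by rewrite e; ring.
rewrite /zfun (GE _ s4); have -> : s + 1 - 4 = s - 3 by ring.
move: (csum _) (zeta3 _) => u w.
by rewrite mul0r addr0 mulrDr mulrA mulr1; ring.
Qed.

Lemma powN_nat m n : powN m%:R n = ((n%:R + 2 : R)%:C) ^+ m.
Proof.
elim: m => [|m ih]; first by rewrite /powN mul0r cexp0 expr0.
rewrite -natr1 powND ih exprSr; congr (_ * _).
by rewrite /powN mul1r /cexp [Re _]/= [Im _]/= cos0 sin0 mulr0 mulr1 expR_lnN.
Qed.

Definition diag T k := T (ebasis k) k.

(** The error, of order N, is written as $x_n N^4$ with $x_n = O(N^{-3})$: multiplied by $N^{-s}$ it
    becomes a term [powN w n * x n] of a cubic series with $w = 4 - s$. *)
Definition trace_expansion T alpha beta x := cubic_seq x /\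
  forall n, \sum_(k <- level_seq n) diag T k =
    alpha * (n%:R + 2 : R)%:C ^+ 3 + beta * (n%:R + 2 : R)%:C ^+ 2 +
    x n * (n%:R + 2 : R)%:C ^+ 4.

Lemma cub_natX4 n : cub R n * (n%:R + 2) ^+ 4 = n%:R + 2.
Proof.
rewrite /cub -expR_lnN -expRM_natl -expRD; congr expR; ring.
Qed.

Lemma trace_expansionP T kappa g e : decays id g -> decays ac e ->
  (forall k, diag T k = kappa + g (ca k.2) + e k) ->
  exists x, trace_expansion T (4 / 3 * kappa) (2 * csum g) x.
Proof.
move=> dg de TE; have [K K0 hK] := trace_asymptotics kappa dg de.
set alpha := 4 / 3 * kappa; set beta := 2 * csum g.
pose N n : R[i] := (n%:R + 2 : R)%:C.
have N0 n : N n != 0.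
  by rewrite /N -(rmorph0 (real_complex R)) (inj_eq (@complexI R)) gt_eqF ?natD2_gt0.
have NE n : N n = n%:R + 2 by rewrite /N rmorphD !rmorph_nat.
pose S n := \sum_(k <- level_seq n) diag T k.
exists (fun n => (S n - (alpha * N n ^+ 3 + beta * N n ^+ 2)) / N n ^+ 4); split; last first.
  by move=> n; rewrite -/(N n) -/(S n) mulfVK ?expf_neq0// subrKC.
exists K => n; have n0 := natD2_gt0 R n.
rewrite -(@ler_pM2r _ ((n%:R + 2) ^+ 4)) ?exprn_gt0// -[leRHS]mulrA cub_natX4.
have -> : (n%:R + 2) ^+ 4 = normc (N n ^+ 4).
  by rewrite normcX /N normc_real ger0_norm// ltW.
rewrite -Normc.normcM mulfVK ?expf_neq0//.
by have := hK n; rewrite -NE /S; under eq_bigr do rewrite -TE.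
Qed.

Lemma trace_expansion_unique T a b x a' b' x' : trace_expansion T a b x ->
  trace_expansion T a' b' x' -> a = a' /\ b = b'.
Proof.
move=> [[K xK] hT] [[K' xK'] hT'].
have NE n : (n%:R + 2)%:C = n%:R + 2 :> R[i] by rewrite rmorphD !rmorph_nat.
have [] := @asymptotics_unique R (a - a') (b - b') (K + K'); last first.
  by move/subr0_eq => -> /subr0_eq ->.
move=> n; have := hT n; rewrite hT' => E.
have n0 := natD2_gt0 R n; rewrite -NE; set N := _%:C in E *.
have -> : (a - a') * N ^+ 3 + (b - b') * N ^+ 2 = (x' n - x n) * N ^+ 4.
  have -> : (a - a') * N ^+ 3 + (b - b') * N ^+ 2 = (a * N ^+ 3 + b * N ^+ 2 + x n * N ^+ 4) -
    (a' * N ^+ 3 + b' * N ^+ 2) - x n * N ^+ 4 by ring.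
  by rewrite -E; ring.
rewrite Normc.normcM normcX normc_real ger0_norm ?(ltW n0)//.
rewrite -[X in _ <= _ * X]cub_natX4 [leRHS]mulrA ler_pM2r ?exprn_gt0//.
apply: le_trans (le_normcB _ _) _; rewrite mulrDl addrC.
exact: lerD.
Qed.

Lemma cpow_eigenvalue k s : cpow (Defs.eigenvalue R k.2) s = powN s (level k).
Proof.
rewrite cpowE /powN; congr (cexp (_ * (ln _)%:C)).
rewrite eigenvalue_coord -[sz _]/(sz k) sz_level.
rewrite -addn2 -muln2 natrD natrM mulrDl mulfK//.
by rewrite mulfV// -addrA.
Qed.

Lemma diagonal_pow T k s : linear T ->
  Defs.diagonal (T \o abs_dirac_pow s) k = powN s (level k) * diag T k.
Proof.
move=> linT; rewrite /Defs.diagonal inner_basisl /= abs_dirac_pow_basis.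
by rewrite (linearZ_op _ _ linT) hilbertZE cpow_eigenvalue.
Qed.

(** The multiplicities are $O(N^3)$, so the trace is dominated by $\sum N^{3 - Re s}$. *)
Lemma diagonal_summable T s : linear T -> cbounded (diag T) -> 4 < Re s ->
  csummable (Defs.diagonal (T \o abs_dirac_pow (- s))).
Proof.
move=> linT [M M0 hM] s4.
have e0 : 0 < Re s - 4 by rewrite subr_gt0.
pose b k := M * expR (- Re s * lnN R (level k)).
apply: (@csummable_le _ _ _ b) => [k|].
  rewrite diagonal_pow// Normc.normcM normc_powN ReN mulrC /b.
  by rewrite ler_wpM2r ?expR_ge0.
apply: (rsummable_fiber level_seq_uniq mem_level_seq) => [k|].
  by rewrite /b mulr_ge0 ?expR_ge0.
apply: (rsummable_le _ (rsummableZ (2 * M) (rsummable_expN e0))) => n.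
rewrite ger0_norm; last by apply: sumr_ge0 => k _; rewrite /b mulr_ge0 ?expR_ge0.
have -> : \sum_(k <- level_seq n) b k =
    \sum_(k <- level_seq n) M * expR (- Re s * lnN R n).
  by apply: eq_big_seq => k; rewrite mem_level_seq /b => /eqP ->.
have := congr1 (@Re R) (sum_level_cst n ((M * expR (- Re s * lnN R n))%:C)).
rewrite -(rmorph_sum (real_complex R)) [Re _]/= => ->.
have -> : (4 / 3 * (M * expR (- Re s * lnN R n))%:C * ((n%:R + 2) ^+ 3 - (n%:R + 2))) =
  (4 / 3 * (M * expR (- Re s * lnN R n)) * ((n%:R + 2) ^+ 3 - (n%:R + 2)))%:C :> R[i].
  rewrite [RHS]rmorphM [in RHS]rmorphM rmorphB rmorphXn rmorphD.
  by rewrite fmorph_div !rmorph_nat.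
have -> : expR (- (1 + (Re s - 4)) * lnN R n) = expR (- Re s * lnN R n) * (n%:R + 2) ^+ 3.
  by rewrite -expR_lnN -expRM_natl -expRD; congr expR; ring.
rewrite [Re _]/=; have E0 := expR_ge0 (- Re s * lnN R n); have n0 := natD2_gt0 R n.
set E := expR _ in E0 *; set N := n%:R + 2 in n0 *.
have p1 : 0 <= M * E * N ^+ 3 by nonneg; lra.
have p2 : 0 <= M * E * N by nonneg; lra.
have -> : 4 / 3 * (M * E) * (N ^+ 3 - N) = 4 / 3 * (M * E * N ^+ 3) - 4 / 3 * (M * E * N) by ring.
have -> : 2 * M * (E * N ^+ 3) = 2 * (M * E * N ^+ 3) by ring.
lra.
Qed.

Lemma zeta_zfun T alpha beta x s : linear T -> cbounded (diag T) ->
  trace_expansion T alpha beta x -> 4 < Re s -> zfun alpha beta x s = zeta T s.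
Proof.
move=> linT bT [[K xK] hT] s4; have sT := diagonal_summable linT bT s4.
rewrite /zeta /trace (csum_fiber level_seq_uniq mem_level_seq sT).
have w1 : Re (3 - s) < -1 by rewrite ReD ReN ReNat; lra.
have w2 : Re (3 - (s + 1)) < -1 by rewrite ReD ReN ReNat ReD /=; lra.
have w3 : Re (4 - s) < 2 by rewrite ReD ReN ReNat; lra.
have s1 := csummableZ alpha (powN_summable w1).
have s2 := csummableZ beta (powN_summable w2).
have s3 := cubic_summable w3 (cubic_cst (4 - s) xK).
rewrite /zfun zeta3E// zeta3E; last by rewrite ReD /=; lra.
rewrite -(csumZ alpha (powN_summable w1)) -(csumZ beta (powN_summable w2)).
rewrite -csumD// -csumD//; last exact: csummableD.
congr csum; apply/funext => n.
have -> : \sum_(k <- level_seq n) Defs.diagonal (T \o abs_dirac_pow (- s)) k =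
    \sum_(k <- level_seq n) powN (- s) n * diag T k.
  apply: eq_big_seq => k; rewrite mem_level_seq => /eqP kn.
  by rewrite diagonal_pow// kn.
have -> : 3 - (s + 1) = 2 - s by ring.
rewrite -mulr_sumr hT (powND 3) (powND 2) (powND 4) !powN_nat.
by ring.
Qed.

End ZetaExpansion.

(** * The residue at 4 as an integral, and the nonvanishing of a residue at 3 *)

Section PoleAtThree.
Variables (R : realType) (q : R).
Hypotheses (q_gt0 : 0 < q) (q_lt1 : q < 1).
Variable rho : sphere q -> hilbert R -> hilbert R.
Hypothesis rhoP : chiral_representation rho.
Implicit Types (k : basis_index) (a : sphere q).
Local Notation ebasis := (Defs.basis R).

Lemma ket_val (c : bool) (l m1 m2 j : rat) k :
  ket R c l m1 m2 j k = ((k.1 == c) && (val k.2 == (l, m1, m2, j)))%:R.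
Proof.
rewrite /ket; case: insubP => [p _ pE|np].
  by rewrite basisE -pE (inj_eq val_inj); case: k => [x p'].
rewrite (_ : val k.2 == _ = false) ?andbF//.
by apply: contraNF np => /eqP <-; exact: valP.
Qed.

(** The nine vectors in [x1_ket] have distinct labels, so this component is a single coefficient. *)
Lemma x1_component k k' : mv false (1, 1, 0, 1) k = Some k' ->
  rho x1 (ebasis k) k' = (Bp q (kj k) (km1 k) * Cp q (kl k) (kj k) (km2 k))%:C.
Proof.
move=> mk'; have /mvP[c1 _] := mk'; rewrite addbF in c1.
have [hl h1 h2 hj] := mv_k mk'; rewrite /= ?addr0 in hl h1 h2 hj.
have [_ /(_ k.1 (kl k) (km1 k) (km2 k) (kj k))] := rhoP.
rewrite -val_lattice (valP k.2) => /(_ isT)[_ E _].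
have ne (x y : rat) : x < y -> ((y == x) = false) by move=> xy; rewrite gt_eqF.
have n1 (x : rat) : (x + 1 == x) = false by apply: ne; lra.
have n2 (x : rat) : (x + 1 == x - 1) = false by apply: ne; lra.
have NE (u : hilbert R) i : (- u) i = - u i by [].
rewrite basis_ket E /x1_ket !(hilbertDE, hilbertZE, NE) !ket_val val_lattice.
rewrite c1 hl h1 h2 hj !xpair_eqE !eqxx !n1 !n2 /= !(mulr0, oppr0, addr0, mulr1).
by rewrite -rmorphM.
Qed.

Lemma inner_self_ge (u : hilbert R) k : normc (u k) ^+ 2 <= Re (inner u u).
Proof.
have uE i : Re ((u i)^*%C * u i) = normc (u i) ^+ 2.
  by case: (u i) => x y /=; rewrite sqr_sqrtr ?addr_ge0 ?sqr_ge0//; ring.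
rewrite /inner /csum [Re _]/=; have -> : (fun i => Re ((u i)^*%C * u i)) =
  fun i => normc (u i) ^+ 2 by apply/funext.
apply: (@rsum_ge1 _ _ (fun i => normc (u i) ^+ 2)) => [i|]; first exact: sqr_ge0.
have /l2P := hilbert_l2 u; rewrite /rsummable.
by under [X in _ -> (X < _)%E]eq_esum do rewrite ger0_norm ?sqr_ge0//.
Qed.

(** For an element of the algebra both characters give the symbol [sigma a], so the integral in
    [tame_diag] is twice that of [sigma a]. *)
Lemma rho_diag (sigma : sphere q -> R -> R[i]) a : classical_points sigma ->
  exists (kappa : R[i]) (g : nat -> R[i]) (e : basis_index -> R[i]),
  [/\ decays id g, decays ac e, forall k, diag (rho a) k = kappa + g (ca k.2) + e k &
   circle_integral (sigma a) = (2 * pi)%:C * kappa].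
Proof.
move=> sP; have [kappa [g [e [dg de dE I]]]] := tame_diag (rho_tame q_gt0 q_lt1 rhoP a sP).
exists kappa, g, e; split=> //; apply: cprim_integral.
have := cprimZ (1 / 2) I.
have -> : 1 / 2 * ((4 * pi)%:C * kappa) = (2 * pi : R)%:C * kappa.
  have -> : (4 * pi : R) = 2 * (2 * pi) by ring.
  by rewrite [X in X * kappa]rmorphM rmorph_nat; field.
have -> // : (fun t => 1 / 2 * (sigma a t + sigma a t)) = sigma a.
by apply/funext => t; field.
Qed.

Lemma twopi_neq0 : (2 * pi : R)%:C != 0.
Proof.
have := pi_gt0 R => p0.
by rewrite -(rmorph0 (real_complex R)) (inj_eq (@complexI R)) gt_eqF//; lra.
Qed.

Definition x1sx1 : sphere q := star x1 * x1.

Lemma diag_x1sx1 k : diag (rho x1sx1) k = inner (rho x1 (ebasis k)) (rho x1 (ebasis k)).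
Proof.
have [[_ _ _ rhoM rhostar] _] := rhoP.
have sK : star (star x1) = x1 :> sphere q.
  by rewrite /x1 !spi_star; apply/spiE/se_starK.
by rewrite -{1}sK rhostar inner_basisl /diag /x1sx1 rhoM.
Qed.

(* Letting c tend to infinity at fixed a isolates g from e. *)
Lemma decays_limit (g : nat -> R[i]) (e : basis_index -> R[i]) (r : R) (a : nat) : decays ac e ->
  (forall c, r <= Re (g a + e (true, lat a 0 c 0))) -> r <= Re (g a).
Proof.
move=> [K [th [K0 /andP[t0 t1] eK]]] h; rewrite leNgt; apply/negP => lt.
pose d := (r - Re (g a)).
have d0 : 0 < d by rewrite subr_gt0.
have th1 : 0 <= th < 1 by rewrite (ltW t0).
have cv : (fun c => th ^+ c) @ \oo --> (0 : R).
  by apply: cvg_expr; rewrite ger0_norm// ltW.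
have K1 : 0 < K + 1 by lra.
move/cvgrPdist_lt: cv => /(_ _ (divr_gt0 d0 K1))[c _ /(_ c (leqnn c))].
have tc : 0 <= th ^+ c by rewrite exprn_ge0// ltW.
rewrite /= sub0r normrN (ger0_norm tc) ltr_pdivlMr// => hc.
have := h c; rewrite ReD; have := eK (true, lat a 0 c 0).
rewrite /ac /=; have /= [-> _ -> _] := lat_coord a 0 c 0.
have := Re_le_normc (e (true, lat a 0 c 0)); rewrite ler_norml => /andP[_ h1] h2 h3.
have : K * th ^+ (a + c) <= K * th ^+ c.
  by rewrite ler_wpM2l// ler_wiXn2l ?(ltW t0) ?(ltW t1)// leq_addl.
move: hc; rewrite /d; move: (K * th ^+ (a + c)) (th ^+ c) tc h2 => y tc tc0 h2 hc h4; nra.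
Qed.

(** No cancellation can occur in $beta = 2 \sum g$: the diagonal entries are the squared norms of
    $x_1 e_k$, so letting c tend to infinity gives $Re g(a) \ge 0$, and the component bounded in
    [BpCp_lower] gives $Re g(0) \ge (1-q^2)^4$. *)
Lemma x1sx1_expansion (sigma : sphere q -> R -> R[i]) : classical_points sigma ->
  exists2 beta, beta != 0 & exists x, trace_expansion (rho x1sx1) 0 beta x.
Proof.
move=> sP; have [kappa [g [e [dg de dE I]]]] := rho_diag x1sx1 sP.
have k0 : kappa = 0.
  move: I; have -> : sigma x1sx1 = fun=> 0.
    have [[_ _ _ sM _] _ s1 _] := sP; rewrite /x1sx1 sM s1 mulr0.
    by apply/funext.
  have -> : circle_integral (fun=> 0) = 0 :> R[i].
    apply: cprim_integral; exists (fun=> 0), (fun=> 0).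
    by split; [exact: cder_cst|exact: cder_cst|rewrite subrr].
  by move/esym/eqP; rewrite mulf_eq0 (negbTE twopi_neq0) => /eqP.
have hD k : Re (diag (rho x1sx1) k) = Re (g (ca k.2) + e k) by rewrite dE k0 add0r.
have caE (a c : nat) : ca (lat a 0 c 0) = a by have [] := lat_coord a 0 c 0.
have g0 (a : nat) : 0 <= Re (g a).
  apply: (decays_limit de) => c; have := hD (true, lat a 0 c 0); rewrite /= caE => <-.
  by rewrite diag_x1sx1; apply: le_trans (inner_self_ge _ (true, lat a 0 c 0)); exact: sqr_ge0.
pose del : R := ((1 - q ^+ 2) ^+ 2) ^+ 2.
have q21 := q2_lt1 q_gt0 q_lt1.
have del0 : 0 < del by rewrite /del !exprn_gt0// subr_gt0.
have g1 : del <= Re (g 0%N).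
  apply: (decays_limit de) => c; have := hD (true, lat 0 0 c 0); rewrite /= caE => <-.
  rewrite diag_x1sx1; case E : (mv false (1, 1, 0, 1) (true, lat 0 0 c 0)) => [k'|].
    apply: le_trans (inner_self_ge _ k'); rewrite (x1_component E) normc_real /del.
    by rewrite ler_sqr ?nnegrE ?sqr_ge0//; apply: BpCp_lower; rewrite //= caE.
  (* Raising c by 2 at fixed a, b and d cannot leave the lattice, so this case is void. *)
  have E' : mv false (ms 0 1) (true, lat 0 0 c 0) = None by rewrite /ms add0r.
  by have := ms_None E'; rewrite mulr0 addr0 => /(_ isT).
have sg := decays_csummable dg.
have r0 : 0 < rsum (fun i => Re (g i)).
  apply: lt_le_trans del0 (le_trans g1 _).
  by apply: (@rsum_ge1 _ _ (fun i => Re (g i)) 0%N g0); exact: csummable_Re.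
have [x xE] := trace_expansionP dg de dE.
exists (2 * csum g); last by exists x; rewrite -[0](mulr0 (4 / 3)) -{1}k0.
rewrite mulf_neq0 ?pnatr_eq0//; apply: contraTneq r0 => /(congr1 (@Re R)) /= ->.
by rewrite ltxx.
Qed.

End PoleAtThree.

Section Psi0Expansion.
Variables (R : realType) (q : R).
Hypotheses (q_gt0 : 0 < q) (q_lt1 : q < 1).
Variable rho : sphere q -> hilbert R -> hilbert R.
Hypothesis rhoP : chiral_representation rho.

Lemma Psi0_expansion T : Psi0 rho T -> [/\ linear T, cbounded (diag T) &
  exists t : R[i] * R[i] * (nat -> R[i]), trace_expansion T t.1.1 t.1.2 t.2].
Proof.
move=> /(Psi0_tame q_gt0 q_lt1 rhoP)[linT [p /tame_diag[kappa [g [e [dg de dE _]]]]]].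
have [x xE] := trace_expansionP dg de dE; split=> //.
  have [M M0 hM] := decays_bounded dg; have [K K0 hK] := decays_bounded de.
  exists (normc kappa + M + K) => [|k]; first by nonneg.
  rewrite /diag dE; apply: le_trans (le_normcD _ _) _; rewrite lerD//.
  by apply: le_trans (le_normcD _ _) _; rewrite lerD2l hM.
by exists (4 / 3 * kappa, 2 * csum g, x).
Qed.

(** By uniqueness alpha is $\frac43 kappa$, which is $\frac{2}{3\pi} \cdot 2\pi kappa$, and $2\pi
    kappa$ is the integral of the symbol. *)
Lemma rho_expansion (sigma : sphere q -> R -> R[i]) a alpha beta x :
  classical_points sigma -> trace_expansion (rho a) alpha beta x ->
  alpha = (2 / (3 * pi) : R)%:C * circle_integral (sigma a).
Proof.
move=> sP aE; have [kappa [g [e [dg de dE ->]]]] := rho_diag q_gt0 q_lt1 rhoP a sP.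
have [y yE] := trace_expansionP dg de dE.
have [-> _] := trace_expansion_unique aE yE.
rewrite mulrA -rmorphM; congr (_ * _).
have p0 : pi != 0 :> R by rewrite gt_eqF// pi_gt0.
have -> : 2 / (3 * pi) * (2 * pi) = 4 / 3 :> R by move: p0; move: (pi : R) => u u0; field.
by rewrite fmorph_div !rmorph_nat.
Qed.

End Psi0Expansion.

Unset Implicit Arguments.

Theorem proposition4p16 (R : realType) (q : R)
    (q_gt0 : 0 < q) (q_lt1 : q < 1)
    (rho : sphere q -> hilbert R -> hilbert R)
    (rhoP : chiral_representation rho)
    (sigma : sphere q -> R -> R[i])
    (sigmaP : classical_points sigma) :
  exists Z : (hilbert R -> hilbert R) -> R[i] -> R[i],
    [/\ forall T, Psi0 rho T -> zeta_extension T (Z T),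
        [set s : R[i] | 2 < complex.Re s /\
           exists2 T, Psi0 rho T & is_pole (Z T) s] = [set 3; 4],
        forall T (s : R[i]), Psi0 rho T -> 2 < complex.Re s ->
          is_pole (Z T) s -> is_simple_pole (Z T) s &
        forall a : sphere q,
          is_residue (Z (rho a)) 4
            ((2 / (3 * pi) : R)%:C * circle_integral (sigma a))].

Proof.
have ex T : exists t : R[i] * R[i] * (nat -> R[i]),
    Psi0 rho T -> trace_expansion T t.1.1 t.1.2 t.2.
  (* Outside of Psi^0 an arbitrary default makes the expansion a function of T, so that Z is defined
     for every operator. *)
  have [h|h] := pselect (Psi0 rho T); last by exists (0, 0, fun=> 0).
  by have [_ _ [t tE]] := Psi0_expansion q_gt0 q_lt1 rhoP h; exists t.
have [f fP] := boolp.choice ex.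
pose Z T := zfun (f T).1.1 (f T).1.2 (f T).2.
have rhoT a : Psi0 rho (rho a) by apply: Psi0_gen; exact: delta_rep.
have holo T s : Psi0 rho T -> 2 < complex.Re s -> ((f T).1.1 != 0 -> s != 4) ->
    ((f T).1.2 != 0 -> s != 3) -> holomorphic_at (Z T) s.
  by move=> /fP[cT _] s2 h4 h3; apply (zfun_holo cT s2 h4 h3).
have pole4 T : Psi0 rho T -> (f T).1.1 != 0 -> is_simple_pole (Z T) 4.
  move=> /fP[cT _] h0; have [G [hG GE]] := zfun_at4 (f T).1.1 (f T).1.2 cT.
  exact: (simple_poleP h0 hG GE).
have pole3 T : Psi0 rho T -> (f T).1.2 != 0 -> is_simple_pole (Z T) 3.
  move=> /fP[cT _] h0; have [G [hG GE]] := zfun_at3 (f T).1.1 (f T).1.2 cT.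
  exact: (simple_poleP h0 hG GE).
have isp T s : is_simple_pole (Z T) s -> is_pole (Z T) s by exists 1%N.
have h34 : 3 != 4 :> R[i] by rewrite eq_sym -subr_eq0 (_ : 4 - 3 = 1) ?oner_eq0//; ring.
(* At 4 and 3 the coefficients of $N^3$ and $N^2$ decide: if the relevant one is 0, the singular
   summand of [zfun] disappears and Z is holomorphic there. *)
have dich T s : Psi0 rho T -> 2 < complex.Re s -> holomorphic_at (Z T) s \/
    is_simple_pole (Z T) s /\ (s = 3 \/ s = 4).
  move=> hT s2.
  have [s4|s4] := eqVneq s 4.
    have [a0|a0] := eqVneq (f T).1.1 0; last by right; split; [rewrite s4; exact: pole4|right].
    by left; apply holo => // h; rewrite ?a0 ?eqxx// in h *; rewrite s4 eq_sym.
  have [s3|s3] := eqVneq s 3; last by left; apply holo.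
  have [a0|a0] := eqVneq (f T).1.2 0; last by right; split; [rewrite s3; exact: pole3|left].
  by left; apply holo => // h; rewrite a0 eqxx in h.
exists Z; split.
- move=> T hT; have [linT bT _] := Psi0_expansion q_gt0 q_lt1 rhoP hT; split.
    by move=> s /= s2; have [h|[/isp h _]] := dich T s hT s2; [left|right].
  move=> s s4; split; first exact: diagonal_summable.
  exact: (zeta_zfun linT bT (fP T hT)).
- apply/seteqP; split=> s /=.
    move=> [s2 [T hT ps]]; have [h|[_ []]] := dich T s hT s2; [|by left|by right].
    by have := holo_not_pole h ps.
  move=> [->|->]; rewrite ReNat; split; try lra.
    (* By uniqueness the chosen expansion has the nonzero beta of the explicit one. *)
    have [beta b0 [x xE]] := x1sx1_expansion q_gt0 q_lt1 rhoP sigmaP.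
    have [_ eb] := trace_expansion_unique xE (fP _ (rhoT (x1sx1 q))).
    by exists (rho (x1sx1 q)) => //; apply/isp/pole3 => //; rewrite -eb.
  (* The identity has symbol 1, hence the nonzero coefficient $\frac{2}{3\pi} \cdot 2\pi$ at 4. *)
  exists (rho 1) => //; apply/isp/pole4 => //.
  rewrite (rho_expansion q_gt0 q_lt1 rhoP sigmaP (fP _ (rhoT 1))).
  have [[_ -> _ _ _] _ _ _] := sigmaP.
  have -> : circle_integral (1 : R -> R[i]) = (2 * pi)%:C.
    by apply: cprim_integral; exact: (cprim_circle R 0).
  rewrite mulf_neq0 ?twopi_neq0// -(rmorph0 (real_complex R)) (inj_eq (@complexI R)).
  by rewrite mulf_neq0 ?invr_eq0 ?mulf_neq0 ?pnatr_eq0// gt_eqF// pi_gt0.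
- move=> T s hT s2 ps; have [h|[]//] := dich T s hT s2.
  by have := holo_not_pole h ps.
- move=> a; have [cT hE] := fP _ (rhoT a).
  rewrite -(rho_expansion q_gt0 q_lt1 rhoP sigmaP (fP _ (rhoT a))).
  have [G [hG GE]] := zfun_at4 (f (rho a)).1.1 (f (rho a)).1.2 cT.
  exact: (residueP hG GE).
Qed.
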